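(* Consider a program with $n$ program variables, and let $m=|S|$ be the number of small terms (notation as in the context). Then: (Approximate $T$-subsumption) For finite sets $E,E'$ of two-variable equalities it is decidable whether $\bigwedge E$ approximately $T$-subsumes $\bigwedge E'$. (Approximate $T$-compactness) Every $T$-satisfiable conjunction of a set $E$ of two-variable equalities is approximately $T$-subsumed by the conjunction of a subset of $E$ of at most $\mathcal{O}(n^2\cdot m^2)$ equalities.
   Context: $\Omega$ is a ranked signature; $\mathcal{T}_\Omega$ the ground terms; $\mathbf{X}$ the set of $n$ program variables. A template is a term over $\Omega\cup\{\bullet\}$ with at least one occurrence of the fresh variable $\bullet$; $ru=r[u/\bullet]$. A program consists of finitely many procedures given by control flow graphs with edges labelled by assignments $\mathbf{x}=t$ ($t$ containing occurrences of at most one program variable), $\mathbf{x}=?$, or parameterless calls. $R$ is the set of ground right-hand sides of assignments, $G$ the set of ground subterms of non-ground right-hand sides, $M_G$ the set of templates whose ground subterms all lie in $G$, $T=\{mr\mid m\in M_G,r\in R\}$, $S=G\cup R$ the set of small terms, $L=T\setminus S$ the set of large terms. Template variables $A,B$ range over templates. Two-variable equalities have one of the formats, for program variables $\mathbf{x},\mathbf{y}$ (possibly equal) and fixed $s_0\in S$: $[F_{\mathbf{x},\mathbf{y}}]$: $As\mathbf{x}\doteq Bt\mathbf{y}$, $s,t\in M_G$; $[F_{\cdot,\mathbf{x}}]$: $As\doteq Bt\mathbf{x}$, $s\in L,t\in M_G$; $[F_{s_0,\mathbf{x}}]$: $As_0\doteq Bt\mathbf{x}$, $t\in M_G$; $[F_{\mathbf{x},\cdot}]$: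 $At\mathbf{x}\doteq Bs$, $s\in L,t\in M_G$; $[F_{\mathbf{x},s_0}]$: $At\mathbf{x}\doteq Bs_0$, $t\in M_G$. For a set $E$, $E_F$ is the subset of equalities of format $F$. For $U\subseteq\mathcal{T}_\Omega$, a $U$-assignment maps program variables into $U$ and $A,B$ to templates, extended homomorphically with $\sigma(Au)=\sigma(A)\sigma(u)$; it satisfies an equality iff both sides evaluate equally. $U$-satisfiable and $U$-equivalent refer to $U$-assignments; $\phi$ $U$-subsumes $\phi'$ iff $\phi$ is $U$-equivalent to $\phi\wedge\phi'$. A small substitution $\sigma$ maps each program variable $\mathbf{x}$ either to $\mathbf{x}$ itself or to a term in $S$. $\bigwedge E$ approximately $T$-subsumes $\bigwedge E'$ iff for every small substitution $\sigma$ and every format $F$, $\bigwedge\sigma(E_F)$ $L$-subsumes $\bigwedge\sigma(E'_F)$. *)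

(* Defs.v *)
From HB Require Import structures.
From mathcomp Require Import all_boot classical_sets.

Set Implicit Arguments.
Unset Strict Implicit.
Unset Printing Implicit Defensive.

Local Open Scope classical_set_scope.

(** * Terms and templates *)

Record signature := Signature { symbol :> eqType; arity : symbol -> nat }.

(* Arities are enforced by the predicate [wf] below, not by the type. *)
Inductive term (Om : signature) (V : Type) : Type :=
| Var of V
| App of Om & seq (term Om V).

Arguments Var {Om V} _.
Arguments App {Om V} _ _.

Section TermEqType.
Variables (Om : signature) (V : eqType).

Fixpoint tree_of_term (t : term Om V) : GenTree.tree (V + Om) :=
  match t with
  | Var v => GenTree.Leaf (inl v)
  | App f ts => GenTree.Node 0
      (GenTree.Leaf (inr f) :: [seq tree_of_term u | u <- ts])
  end.

Fixpoint term_of_tree (d : GenTree.tree (V + Om)) : option (term Om V) :=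
  match d with
  | GenTree.Leaf (inl v) => Some (Var v)
  | GenTree.Node 0 (GenTree.Leaf (inr f) :: ds) =>
      Some (App f (pmap id [seq term_of_tree e | e <- ds]))
  | _ => None
  end.

Lemma tree_of_termK : pcancel tree_of_term term_of_tree.
Proof.
rewrite /pcancel; fix IH 1; case=> [v|f ts] //=.
congr (Some (App f _)).
by elim: ts => [|u ts IHts] //=; rewrite IH /= IHts.
Qed.

HB.instance Definition _ :=
  Equality.copy (term Om V) (pcan_type tree_of_termK).
End TermEqType.

Section Terms.
Variable Om : signature.

Fixpoint wf V (t : term Om V) : bool :=
  match t with
  | Var _ => true
  | App f ts => (size ts == arity f) && all (@wf V) ts
  end.

Fixpoint subst V W (s : V -> term Om W) (t : term Om V) : term Om W :=
  match t with
  | Var v => s v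
  | App f ts => App f [seq subst s u | u <- ts]
  end.

Fixpoint vars V (t : term Om V) : seq V :=
  match t with
  | Var v => [:: v]
  | App _ ts => flatten [seq vars u | u <- ts]
  end.

Fixpoint subterms V (t : term Om V) : seq (term Om V) :=
  t :: match t with
       | Var _ => [::]
       | App _ ts => flatten [seq subterms u | u <- ts]
       end.

(* T_Omega consists of the elements of [gterm] that satisfy [wf]. *)
Definition gterm := term Om void.

Definition of_ground V (g : gterm) : term Om V := subst (of_void _) g.

(* Partial inverse of [of_ground]. *)
Fixpoint to_ground V (t : term Om V) : option gterm :=
  match t with
  | Var _ => None
  | App f ts =>
      let us := [seq to_ground u | u <- ts] in
      if all isSome us then Some (App f (pmap id us)) else None
  end.

Definition ground_subterms V (t : term Om V) : seq gterm :=
  pmap (@to_ground V) (subterms t).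

(* The hole is [Var tt]. *)
Definition template := term Om unit.

Definition is_template (m : template) : bool := wf m && ~~ nilp (vars m).

Definition plug V (m : template) (u : term Om V) : term Om V :=
  subst (fun=> u) m.

End Terms.

(** * Programs *)

Section Programs.
Variables (Om : signature) (n : nat).

Inductive label (k : nat) : Type :=
| Assign of 'I_n & term Om 'I_n
| Havoc of 'I_n
| Call of 'I_k.

Record cfg (k : nat) := Cfg {
  point : finType;
  entry : point;
  exit : point;
  edges : seq (point * label k * point) }.

Definition label_rhs k (l : label k) : seq (term Om 'I_n) :=
  if l is Assign _ t then [:: t] else [::].

Definition cfg_rhs k (c : cfg k) : seq (term Om 'I_n) :=
  flatten [seq label_rhs e.1.2 | e <- edges c].

Record program := Program {
  nproc : nat;
  proc : 'I_nproc -> cfg nproc;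
  programP : forall i t, t \in cfg_rhs (proc i) ->
    wf t && (size (undup (vars t)) <= 1) }.

Variable P : program.

Definition rhs : seq (term Om 'I_n) :=
  flatten [seq cfg_rhs (proc i) | i <- enum 'I_(nproc P)].

Definition setR : seq (gterm Om) := pmap (@to_ground Om 'I_n) rhs.

Definition setG : seq (gterm Om) :=
  flatten [seq ground_subterms t | t <- rhs & to_ground t == None].

Definition setMG : set (template Om) :=
  [set m | is_template m && all [in setG] (ground_subterms m)].

Definition setT_ : set (gterm Om) :=
  [set u | exists m r, [/\ setMG m, r \in setR & u = plug m r]].

Definition setS : seq (gterm Om) := undup (setG ++ setR).

Definition setL : set (gterm Om) := [set u | setT_ u /\ u \notin setS].

End Programs.

(** * Two-variable equalities *)

Section Equalities.
Variables (Om : signature) (n : nat).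

(* The pair (u, v) stands for A u = B v, with the two template variables A and
   B common to all equalities. *)
Definition equality : Type := (term Om 'I_n * term Om 'I_n)%type.

Definition subst_eq (s : 'I_n -> term Om 'I_n) (e : equality) : equality :=
  (subst s e.1, subst s e.2).

Record assignment := Assignment {
  valA : template Om;
  valB : template Om;
  valX : 'I_n -> gterm Om }.

Definition assignment_in (U : set (gterm Om)) (a : assignment) : Prop :=
  [/\ is_template (valA a), is_template (valB a) & forall x, U (valX a x)].

Definition sat (a : assignment) (e : equality) : Prop :=
  plug (valA a) (subst (valX a) e.1) = plug (valB a) (subst (valX a) e.2).

(* Below, a set of equalities stands for its conjunction. *)
Definition sat_all (a : assignment) (E : set equality) : Prop :=
  forall e, E e -> sat a e.

Definition satisfiable (U : set (gterm Om)) (E : set equality) : Prop :=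
  exists2 a, assignment_in U a & sat_all a E.

Definition equivalent (U : set (gterm Om)) (E E' : set equality) : Prop :=
  forall a, assignment_in U a -> (sat_all a E <-> sat_all a E').

Definition subsumes (U : set (gterm Om)) (E E' : set equality) : Prop :=
  equivalent U E (E `|` E').

(* [FVV x y] is F_{x,y}; [FLV x] and [FVL x] are F_{.,x} and F_{x,.}; [FSV s x]
   and [FVS x s] are F_{s,x} and F_{x,s}. *)
Inductive format : Type :=
| FVV of 'I_n & 'I_n
| FLV of 'I_n
| FSV of gterm Om & 'I_n
| FVL of 'I_n
| FVS of 'I_n & gterm Om.

Variable P : program Om n.

Definition of_format (F : format) : set equality :=
  match F with
  | FVV x y => [set e | exists s t, [/\ setMG P s, setMG P t &
                 e = (plug s (Var x), plug t (Var y))]]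
  | FLV x => [set e | exists s t, [/\ setL P s, setMG P t &
                 e = (of_ground _ s, plug t (Var x))]]
  | FSV s0 x => [set e | exists t, [/\ s0 \in setS P, setMG P t &
                 e = (of_ground _ s0, plug t (Var x))]]
  | FVL x => [set e | exists t s, [/\ setMG P t, setL P s &
                 e = (plug t (Var x), of_ground _ s)]]
  | FVS x s0 => [set e | exists t, [/\ setMG P t, s0 \in setS P &
                 e = (plug t (Var x), of_ground _ s0)]]
  end.

Definition two_variable : set equality :=
  [set e | exists F, of_format F e].

Definition small_subst (s : 'I_n -> term Om 'I_n) : Prop :=
  forall x, s x = Var x \/ exists2 g, g \in setS P & s x = of_ground _ g.

Definition approx_subsumes (E E' : set equality) : Prop :=
  forall s F, small_subst s ->
    subsumes (setL P) (subst_eq s @` (E `&` of_format F))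
                      (subst_eq s @` (E' `&` of_format F)).

End Equalities.

(** * Decidability *)

(* A decision procedure is a program of a first-order LISP over binary trees (a
   Turing-complete language). Asking for a Boolean function instead would be
   vacuous in the presence of classical choice axioms. *)

Inductive data : Type := DNil | DCons of data & data.

Definition dhead (d : data) : data := if d is DCons a _ then a else DNil.
Definition dtail (d : data) : data := if d is DCons _ b then b else DNil.

Inductive expr : Type :=
| Arg of nat
| ENil
| ECons of expr & expr
| EHead of expr
| ETail of expr
| EIf of expr & expr & expr
| ECall of nat & seq expr.

(* [p] lists the bodies of mutually recursive functions, [env] the arguments of
   the current call; [k] bounds the depth of the evaluation, which yields [None]
   when this bound is exceeded. [DNil] is the only false value. *)
Fixpoint run (k : nat) (p : seq expr) (env : seq data) (e : expr) :
    option data :=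
  if k is k'.+1 then
    match e with
    | Arg i => Some (nth DNil env i)
    | ENil => Some DNil
    | ECons a b =>
        match run k' p env a, run k' p env b with
        | Some u, Some v => Some (DCons u v)
        | _, _ => None
        end
    | EHead a => omap dhead (run k' p env a)
    | ETail a => omap dtail (run k' p env a)
    | EIf c a b =>
        match run k' p env c with
        | Some (DCons _ _) => run k' p env a
        | Some DNil => run k' p env b
        | None => None
        end
    | ECall f es =>
        let vs := [seq run k' p env a | a <- es] in
        if all isSome vs then run k' p (pmap id vs) (nth ENil p f) else None
    end
  else None.

Definition computes (p : seq expr) (input output : data) : Prop :=
  exists k, run k p [:: input] (nth ENil p 0) = Some output.

(* [D] is the set of instances of the decision problem, [Q] that of positive
   ones. *)
Definition decidable_problem (I : Type) (enc : I -> data) (D Q : set I) : Prop :=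
  exists p : seq expr, forall i, D i ->
    (Q i -> computes p (enc i) (DCons DNil DNil)) /\
    (~ Q i -> computes p (enc i) DNil).

Definition enc_nat (k : nat) : data := iter k (DCons DNil) DNil.

Definition enc_seq (I : Type) (enc : I -> data) (s : seq I) : data :=
  foldr (fun i => DCons (enc i)) DNil s.

Section Encoding.
(* [code] is a numbering of the symbols. *)
Variables (Om : signature) (code : Om -> nat) (n : nat).

Fixpoint enc_term (t : term Om 'I_n) : data :=
  match t with
  | Var x => DCons DNil (enc_nat x)
  | App f ts => DCons (DCons DNil DNil) (DCons (enc_nat (code f)) (enc_seq enc_term ts))
  end.

Definition enc_equality (e : equality Om n) : data :=
  DCons (enc_term e.1) (enc_term e.2).

Definition enc_instance (EE : seq (equality Om n) * seq (equality Om n)) : data :=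
  DCons (enc_seq enc_equality EE.1) (enc_seq enc_equality EE.2).

End Encoding.

(* Main.v *)
(** Call a ground term big if it is not in G. As G is closed under subterms, a
    template of M_G is determined by its value at one big term, and a z = b w
    with z and w big makes a or b an extension of the other. Two equalities
    with different left-hand sides therefore make A and B comparable, say
    A = B d, which leaves equations d c = t y. By the lemma on f (v h) = v h',
    two such equations with c big force the ground subterms of d to be of the
    form r y with r in M_G.

    Compactness: abstracting y from d turns the equations into word equations
    over irreducible templates. Numerals in a large base make a word equation
    the vanishing of a bilinear form of rank 5, so that a triangular system has
    bounded length and finitely many equations of each format imply all others;
    left-hand sides in G contribute at most one equation each.

    Decidability: a violated implication is violated by terms of height cubic in
    the size of the input. If some c is big, then y is a power of a fixed
    template applied to a short term, and high powers can be lowered; if every c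
    is in G, then y matters only through its finitely many solvable systems,
    represented once and for all. The search through all small candidates is
    written with combinators that compile to LISP. *)

Require Import Defs.
From mathcomp Require Import all_boot all_order all_algebra classical_sets boolp zify ring.

Set Implicit Arguments.
Unset Strict Implicit.
Unset Printing Implicit Defensive.

Local Open Scope classical_set_scope.
Local Notation "m ∙ u" := (plug m u) (at level 40, left associativity).

(** * Terms and templates *)

(** A template may have many holes, and the ground subterms of [A] and [B] are arbitrary, so one
    value does not determine a template. Two cancellation principles replace this: two distinct
    arguments determine any template ([plug_injl2]), one big argument determines a template of M_G
    ([gk_inj]). The bound is quadratic because a variable with a value in G is treated by running
    through G: the n^2 formats F_{x,y} meet at most m^2 pairs of such values each, at 4 equalities
    per pair; the other 2n + 2nm formats cost O(m) each. A small substitution followed by an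
    assignment into L amounts to an assignment into T and S, so both halves are about such values,
    one format at a time. Decidability is a claim for each program separately: the alphabet [S0] and
    the constant [K] come from classical existence and are built into the procedure. A shortened y
    must stay in T; this is why high powers are lowered only as long as y remains taller than R.
    Monadic signatures need extra care: with a symbol of arity at least 2 there are [A], [B] with A
    c = B d for one prescribed pair (c, d) and no other, while over unary symbols one equality
    already makes [A] and [B] comparable. *)

Section Lists.
Variables (A B C : eqType).

Lemma map_eq_zip (F : A -> C) (H : B -> C) s s' :
  [seq F a | a <- s] = [seq H b | b <- s'] ->
  size s = size s' /\ forall p, p \in zip s s' -> F p.1 = H p.2.
Proof.
elim: s s' => [|a s IH] [|b s'] //= [e /IH [-> h]]; split=> // p.
by rewrite inE => /predU1P [-> //|]; apply: h.
Qed.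

Lemma eq_map_zip (F : A -> C) (H : B -> C) s s' :
  size s = size s' -> (forall p, p \in zip s s' -> F p.1 = H p.2) ->
  [seq F a | a <- s] = [seq H b | b <- s'].
Proof.
elim: s s' => [|a s IH] [|b s'] //= [/IH{}IH] h; congr (_ :: _).
  by apply: (h (a, b)); rewrite inE eqxx.
by apply: IH => p hp; apply: h; rewrite inE hp orbT.
Qed.

Lemma mem_zip2 (s : seq A) (s' : seq B) p :
  p \in zip s s' -> p.1 \in s /\ p.2 \in s'.
Proof.
elim: s s' => [|a s IH] [|b s'] //=; rewrite !inE.
by case/predU1P=> [-> /=|/IH [-> ->]]; rewrite ?eqxx ?orbT.
Qed.

Lemma zip_exl (s : seq A) (s' : seq B) a :
  size s = size s' -> a \in s -> exists b, (a, b) \in zip s s'.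
Proof.
elim: s s' => [|a' s IH] [|b s'] //= [e]; rewrite inE.
case/predU1P=> [->|/(IH _ e) [b' h]]; first by exists b; rewrite inE eqxx.
by exists b'; rewrite inE h orbT.
Qed.

End Lists.

Lemma zip_eq (A : eqType) (s s' : seq A) :
  size s = size s' -> (forall p, p \in zip s s' -> p.1 = p.2) -> s = s'.
Proof.
move=> e h; rewrite -(map_id s) -(map_id s').
exact: (@eq_map_zip _ _ _ id id).
Qed.

Section Terms.
Variable Om : signature.

Lemma term_ind2 (V : eqType) (P : term Om V -> Prop) :
  (forall v, P (Var v)) ->
  (forall f ts, (forall t, t \in ts -> P t) -> P (App f ts)) ->
  forall t, P t.
Proof.
move=> hV hA.
have hA' f ts : foldr (fun t Q => P t /\ Q) True ts -> P (App f ts).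
  move=> h; apply: hA; elim: ts h => //= u ts IHts [hu h] t.
  by rewrite inE => /predU1P [->|]; [exact: hu | apply: IHts].
fix IH 1; case=> [v|f ts]; first exact: hV.
apply: hA'; elim: ts => [|u ts IHts]; first exact: I.
by split; [exact: IH | exact: IHts].
Qed.

Fixpoint tsize V (t : term Om V) : nat :=
  if t is App _ ts then (sumn [seq tsize u | u <- ts]).+1 else 1.

Fixpoint height V (t : term Om V) : nat :=
  if t is App _ ts then (foldr maxn 0 [seq height u | u <- ts]).+1 else 0.

(** Non-groundness, over any variables; for a template it says that the hole occurs ([hole_vars]),
    and together with [wf] it is [is_template]. *)
Definition hole V (t : term Om V) := to_ground t == None.

Section Basic.
Variable V : eqType.
Implicit Types (t u : term Om V) (ts us : seq (term Om V)).

Lemma tsize_gt0 t : 0 < tsize t. Proof. by case: t. Qed.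

Lemma tsize_in f ts u : u \in ts -> tsize u < tsize (App f ts).
Proof.
rewrite /= ltnS; elim: ts => //= a ts IH; rewrite inE.
by case/predU1P=> [->|/IH]; [apply: leq_addr|move=> h; apply: leq_trans h (leq_addl _ _)].
Qed.

Lemma height_in f ts u : u \in ts -> height u < height (App f ts).
Proof.
rewrite /= ltnS; elim: ts => //= a ts IH; rewrite inE leq_max.
by case/predU1P=> [->|/IH ->]; rewrite ?leqnn ?orbT.
Qed.

Lemma height_leP f ts n :
  (height (App f ts) <= n.+1) = all (fun u => height u <= n) ts.
Proof. by rewrite /= ltnS; elim: ts => //= a ts <-; rewrite geq_max. Qed.

Lemma subst_comp V' V'' (s : V' -> term Om V'') (r : V -> term Om V') t :
  subst s (subst r t) = subst (fun v => subst s (r v)) t.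
Proof.
elim/term_ind2: t => [//|f ts IH] /=; congr App; rewrite -map_comp.
by apply/eq_in_map => u /IH.
Qed.

Lemma eq_subst V' (s r : V -> term Om V') t : s =1 r -> subst s t = subst r t.
Proof.
move=> e; elim/term_ind2: t => [v|f ts IH] /=; first exact: e.
by congr App; apply/eq_in_map => u /IH.
Qed.

Lemma subst_id t : subst (@Var Om V) t = t.
Proof.
elim/term_ind2: t => [//|f ts IH] /=; congr App.
by rewrite -[RHS]map_id; apply/eq_in_map => u /IH.
Qed.

End Basic.

Lemma subst_of_ground V W (s : V -> term Om W) g :
  subst s (of_ground V g) = of_ground W g.
Proof.
by rewrite /of_ground subst_comp; apply: eq_subst; case.
Qed.

Lemma of_ground_void (g : gterm Om) : of_ground void g = g.
Proof. by rewrite /of_ground -[RHS]subst_id; apply: eq_subst; case. Qed.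

Lemma of_groundK (V : eqType) (g : gterm Om) : to_ground (of_ground V g) = Some g.
Proof.
elim/term_ind2: g => [[]|f ts IH] /=; rewrite -map_comp.
have -> : [seq (@to_ground Om V \o subst (of_void (term Om V))) i | i <- ts]
          = [seq Some u | u <- ts] by apply/eq_in_map => u /IH.
rewrite all_map /= all_predT; congr (Some (App f _)).
by elim: ts {IH} => //= u ts ->.
Qed.

Lemma to_groundK (V : eqType) (t : term Om V) g :
  to_ground t = Some g -> t = of_ground V g.
Proof.
elim/term_ind2: t g => [//|f ts IH] g /=; case: ifP => // a [<-] /=; congr App.
elim: ts IH a => //= u ts IHt IH; case e: (to_ground u) => [v|] //= a.
rewrite -IHt // => [|t' h]; last by apply: IH; rewrite inE h orbT.
by congr (_ :: _); apply: IH e; rewrite inE eqxx.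
Qed.

Lemma of_ground_inj (V : eqType) : injective (@of_ground Om V).
Proof. by move=> g g' e; apply: Some_inj; rewrite -(of_groundK V) e of_groundK. Qed.

Lemma groundP (V : eqType) (t : term Om V) :
  reflect (exists g, t = of_ground V g) (~~ hole t).
Proof.
rewrite /hole; case e: (to_ground t) => [g|] /=; constructor.
  by exists g; apply: to_groundK.
by case=> g e'; rewrite e' of_groundK in e.
Qed.

Lemma holeApp (V : eqType) f (ts : seq (term Om V)) :
  hole (App f ts) = has (@hole V) ts.
Proof.
rewrite /hole /= -[RHS]negbK -all_predC all_map.
have -> : all (predC (fun t => to_ground t == None)) ts
        = all (preim (to_ground (V:=V)) isSome) ts.
  by apply: eq_all => t /=; case: to_ground.
by case: ifP.
Qed.

Lemma hole_vars (V : eqType) (t : term Om V) : hole t = ~~ nilp (vars t).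
Proof.
elim/term_ind2: t => [//|f ts IH]; rewrite holeApp /=.
elim: ts IH => //= u ts IHt IH.
rewrite IH ?inE ?eqxx // IHt => [|t h]; last by apply: IH; rewrite inE h orbT.
by rewrite /nilp size_cat addn_eq0 negb_and.
Qed.

Implicit Types (m a b e v w f : template Om) (g h y z c d : gterm Om).

Lemma plugA V m m' (u : term Om V) : m ∙ m' ∙ u = m ∙ (m' ∙ u).
Proof. by rewrite /plug subst_comp. Qed.

Lemma plug_Var m : m ∙ Var tt = m.
Proof. by rewrite /plug -[RHS]subst_id; apply: eq_subst; case. Qed.

Lemma plug_ground V g (u : term Om V) : of_ground unit g ∙ u = of_ground V g.
Proof. exact: subst_of_ground. Qed.

Lemma hole_subst (V W : eqType) (s : V -> term Om W) (t : term Om V) :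
  (forall x : V, x \in vars t -> hole (s x)) -> hole (subst s t) = hole t.
Proof.
elim/term_ind2: t => [v|f ts IH] h /=; first by rewrite h ?inE.
rewrite !holeApp has_map; apply: eq_in_has => u hu /=; apply: IH => // v hv.
by apply: h; apply/flattenP; exists (vars u) => //; apply: map_f.
Qed.

Lemma hole_plug m m' : hole m' -> hole (m ∙ m') = hole m.
Proof. by move=> h; apply: hole_subst. Qed.

Lemma tsize_of_ground (V : eqType) g : tsize (of_ground V g) = tsize g.
Proof.
elim/term_ind2: g => [[]|F ts IH] /=; congr (sumn _).+1; rewrite -map_comp.
by apply/eq_in_map => u /IH.
Qed.

Lemma tsize_plug (V : eqType) m (u : term Om V) : hole m -> tsize u <= tsize (m ∙ u).
Proof.
elim/term_ind2: m => [//|f ts IH]; rewrite holeApp => /hasP [t ht hh].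
apply: leq_trans (IH _ ht hh) (ltnW _); apply: (@tsize_in _ f).
exact: (map_f (fun m => m ∙ u) ht).
Qed.

Lemma tsize_plug_lt (V : eqType) m (u : term Om V) :
  hole m -> m != Var tt -> tsize u < tsize (m ∙ u).
Proof.
case: m => [[]|f ts]; first by rewrite eqxx.
rewrite holeApp => /hasP [t ht hh] _.
apply: leq_ltn_trans (tsize_plug u hh) _; apply: (@tsize_in _ f).
exact: (map_f (fun m => m ∙ u) ht).
Qed.

Lemma plug_eqVar m (u : term Om void) : hole m -> m ∙ u = u -> m = Var tt.
Proof.
move=> hm e; apply/eqP; apply: contraPT e => hV e.
by have := tsize_plug_lt u hm hV; rewrite e ltnn.
Qed.

Lemma tsize_plug_mono m y z :
  tsize y <= tsize z -> tsize (m ∙ y) <= tsize (m ∙ z).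
Proof.
move=> le; elim/term_ind2: m => [//|f ts IH] /=; rewrite ltnS -!map_comp.
elim: ts IH => //= u ts IHt IH; apply: leq_add.
  by apply: IH; rewrite inE eqxx.
by apply: IHt => t ht; apply: IH; rewrite inE ht orbT.
Qed.

Lemma plug_injr m y z : hole m -> m ∙ y = m ∙ z -> y = z.
Proof.
elim/term_ind2: m => [//|f ts IH]; rewrite holeApp => /hasP [t ht hh] [].
move/eq_in_map => e; exact: (IH _ ht hh (e _ ht)).
Qed.

(** No ground subterm of [m] is [z]. By size, the occurrences of [z] in [m ∙ z] are then exactly the
    holes, so [m] can be recovered from this value. *)
Definition noocc z := fix noocc (m : template Om) : bool :=
  (m != of_ground unit z) && (if m is App _ ts then all noocc ts else true).

Lemma nooccE z m : noocc z m =
  (m != of_ground unit z) && (if m is App _ ts then all (noocc z) ts else true).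
Proof. by case: m. Qed.

Lemma plug_injl z m m' : noocc z m -> noocc z m' -> m ∙ z = m' ∙ z -> m = m'.
Proof.
elim/term_ind2: m m' => [[]|f ts IH] [[]|f' ts'] //.
- move=> _ + /= e; case hh: (hole (App f' ts')).
    by have := @plug_eqVar (App f' ts') z hh (esym e).
  move/negbT/groundP: hh => [g' eg]; have {e} := esym e : App f' ts' ∙ z = z; rewrite eg.
  by rewrite plug_ground of_ground_void => <-; rewrite nooccE eqxx.
- move=> + _ /= e; case hh: (hole (App f ts)).
    by have := @plug_eqVar (App f ts) z hh e.
  move/negbT/groundP: hh => [g' eg]; have {e} := e : App f ts ∙ z = z; rewrite eg.
  by rewrite plug_ground of_ground_void => <-; rewrite nooccE eqxx.
rewrite !nooccE => /andP [_ /allP hn] /andP [_ /allP hn'] [<-] /map_eq_zip [es e].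
congr App; apply: zip_eq => // p hp; have [p1 p2] := mem_zip2 hp.
by apply: IH => //; [apply: hn|apply: hn'|apply: e].
Qed.

(** Where one template has its hole and the other continues with [m0], both arguments are fixed by
    [m0]. If [m0] has a hole, then by size it is the hole; if [m0] is ground, the two arguments
    coincide. *)
Lemma plug_injl2 c1 c2 m m' :
  c1 != c2 -> m ∙ c1 = m' ∙ c1 -> m ∙ c2 = m' ∙ c2 -> m = m'.
Proof.
move=> ne.
have X m0 : c1 = m0 ∙ c1 -> c2 = m0 ∙ c2 -> m0 = Var tt.
  move=> e1 e2; case hh: (hole m0); first exact: plug_eqVar (esym e1).
  move/negbT/groundP: hh => [g eg]; move: e1 e2; rewrite eg !plug_ground => e1 e2.
  by rewrite e1 e2 eqxx in ne.
elim/term_ind2: m m' => [[]|f ts IH] [[]|f' ts'] //.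
- by move=> e1 e2; rewrite (X (App f' ts')).
- by move=> e1 e2; rewrite (X (App f ts)).
move=> [<-] /map_eq_zip [es e1] [] /map_eq_zip [_ e2].
congr App; apply: zip_eq => // p hp; have [p1 p2] := mem_zip2 hp.
by apply: IH => //; [apply: e1|apply: e2].
Qed.

(** Levi's lemma fails for a single ground argument, as the path to a hole of [a] may end in a
    ground subterm of [b]; with two distinct arguments such a subterm would make them equal. The
    path yields [e], and [plug_injl2] lifts the equations to templates. *)
Lemma levi2 a b c1 c2 d1 d2 : hole a -> hole b ->
  c1 != c2 -> a ∙ c1 = b ∙ d1 -> a ∙ c2 = b ∙ d2 ->
  (exists2 e, hole e & [/\ b = a ∙ e, c1 = e ∙ d1 & c2 = e ∙ d2]) \/
  (exists2 e, hole e & [/\ a = b ∙ e, d1 = e ∙ c1 & d2 = e ∙ c2]).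
Proof.
move=> ha hb nc e1 e2.
have nd : d1 != d2.
  by apply: contraNneq nc => ed; apply/eqP; apply: (plug_injr ha); rewrite e1 e2 ed.
have X : (exists2 e, hole e & c1 = e ∙ d1 /\ c2 = e ∙ d2) \/
         (exists2 e, hole e & d1 = e ∙ c1 /\ d2 = e ∙ c2).
  elim/term_ind2: a b ha hb e1 e2 => [[]|f ts IH] [[]|f' ts'] // ha hb e1 e2.
  - by left; exists (Var tt).
  - by left; exists (App f' ts').
  - by right; exists (App f ts).
  move: e1 e2 => [_] /map_eq_zip [es e1] [_] /map_eq_zip [_ e2].
  move: ha; rewrite holeApp => /hasP [t ht hh].
  have [t' htt] := zip_exl es ht.
  have {}e1 : t ∙ c1 = t' ∙ d1 := e1 _ htt.
  have {}e2 : t ∙ c2 = t' ∙ d2 := e2 _ htt.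
  apply: (IH t ht t') => //; apply: contraT => /groundP [g eg].
  case/negP: nc; apply/eqP; apply: (plug_injr hh).
  by rewrite e1 e2 eg !plug_ground.
case: X => [[e he [h1 h2]]|[e he [h1 h2]]]; [left|right]; exists e => //; split=> //.
  by apply: (plug_injl2 nd); rewrite plugA -?h1 -?h2.
by apply: (plug_injl2 nc); rewrite plugA -?h1 -?h2.
Qed.

End Terms.

(** * Overlaps and powers of a template *)

Section SelfOverlap.
Variable Om : signature.
Implicit Types (m a b e v w f : template Om) (g h y z c d t : gterm Om).

Lemma noocc_Var z : noocc z (Var tt).
Proof.
by rewrite nooccE andbT; apply/eqP => /(congr1 (@to_ground _ _)); rewrite of_groundK.
Qed.

Lemma plugApp (V : eqType) F ms (u : term Om V) :
  App F ms ∙ u = App F [seq m ∙ u | m <- ms].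
Proof. by []. Qed.

Lemma tsize_in_plug F ms m y : m \in ms -> tsize (m ∙ y) < tsize (App F ms ∙ y).
Proof. by move=> h; apply: (@tsize_in _ _ F); apply: map_f h. Qed.

Lemma ground_plug m y z : ~~ hole m -> m ∙ y = m ∙ z.
Proof. by case/groundP=> g ->; rewrite !plug_ground. Qed.

Lemma holeNApp F (ms : seq (template Om)) m : ~~ hole (App F ms) -> m \in ms -> ~~ hole m.
Proof. by rewrite holeApp => /hasPn h /h. Qed.

Lemma noocc_plug z m e : noocc z m -> noocc z e -> hole e -> noocc z (m ∙ e).
Proof.
elim/term_ind2: m => [//|F ms IH] + he hh.
case hm: (hole (App F ms)); last first.
  by move/negbT/groundP: hm => [g ->]; rewrite plug_ground.
rewrite !nooccE => /andP [_ /allP a]; apply/andP; split.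
  apply/eqP => /(congr1 (@hole _ _)); rewrite hole_plug // hm.
  by move/esym; rewrite /hole of_groundK.
by rewrite /= all_map; apply/allP => m im /=; apply: IH => //; apply: a.
Qed.

Lemma noocc_small z m : tsize m < tsize z -> noocc z m.
Proof.
elim/term_ind2: m => [[]|F ms IH] lt; first exact: noocc_Var.
rewrite nooccE; apply/andP; split.
  by apply: contraTN lt => /eqP ->; rewrite tsize_of_ground ltnn.
by rewrite /=; apply/allP => m im; apply: IH => //; apply: ltn_trans lt; apply: tsize_in.
Qed.

(** A hole of [m] would put an occurrence of [z] into [e ∙ z], which is just [e]. *)
Lemma noocc_hole z m e : ~~ hole e -> noocc z e -> m ∙ z = e ∙ z -> ~~ hole m.
Proof.
elim/term_ind2: m e => [[]|F ms IH] e he.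
  case/groundP: he => g -> + e'; have {e'} -> : z = g.
    by move: e'; rewrite plug_ground of_ground_void.
  by rewrite nooccE eqxx.
case: e he => [[]|F' es] // he; rewrite nooccE => /andP [_ /allP a] [_] /map_eq_zip [es' ez].
rewrite holeApp; apply/hasPn => m im; have [e ie] := zip_exl es' im.
have [_ /= ie'] := mem_zip2 ie.
exact: (IH m im e (holeNApp he ie') (a _ ie') (ez _ ie)).
Qed.

(* [pre m w]: m is obtained from w by replacing some subterms by the hole. *)
Fixpoint pre m w {struct m} : bool :=
  match m, w with
  | Var _, _ => true
  | App F ms, App F' ws => (F == F') && all2 pre ms ws
  | App _ _, Var _ => false
  end.

Lemma all2P (A B : eqType) (r : A -> B -> bool) s s' :
  reflect (size s = size s' /\ forall p, p \in zip s s' -> r p.1 p.2) (all2 r s s').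
Proof.
apply: (iffP idP).
  elim: s s' => [|a s IH] [|b s'] //= /andP [ab /IH [-> h]]; split=> // p.
  by rewrite inE => /predU1P [-> //|]; apply: h.
elim: s s' => [|a s IH] [|b s'] //= [] // [e] h; rewrite (h (a, b)) ?inE ?eqxx //=.
by apply: IH; split=> // p hp; apply: h; rewrite inE hp orbT.
Qed.

Lemma pre_plug m e w : pre e w -> pre (m ∙ e) (m ∙ w).
Proof.
move=> h; elim/term_ind2: m => [//|F ms IH]; rewrite !plugApp /= eqxx /=.
elim: ms IH => //= m ms IHm IH.
rewrite IH ?inE ?eqxx //=; apply: IHm => e' ie; apply: IH; by rewrite inE ie orbT.
Qed.

Lemma pre_ground m w : pre m w -> ~~ hole m -> w = m.
Proof.
elim/term_ind2: m w => [//|F ms IH] [//|F' ws] /= /andP [/eqP <- /all2P [es h]] hh.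
congr App; symmetry; apply: zip_eq => // p ip; have [p1 p2] := mem_zip2 ip.
by rewrite (IH _ p1 _ (h _ ip) (holeNApp hh p1)).
Qed.

Definition fpow n f : template Om := iter n (plug f) (Var tt).

Lemma hole_fpow n f : hole f -> hole (fpow n f).
Proof. by move=> hf; elim: n => //= n IH; rewrite hole_plug. Qed.

Section Contraction.
Variables (h h' : gterm Om).
Hypothesis lt_hh' : tsize h < tsize h'.

(** A single pass over the occurrences of [h']; new ones may arise, for instance when [h'] is built
    from [h]. As [h] is smaller, terms never grow. *)
Fixpoint ctr t : gterm Om :=
  if t == h' then h else if t is App F ts then App F [seq ctr u | u <- ts] else t.

Lemma ctrE F ts :
  ctr (App F ts) = if App F ts == h' then h else App F [seq ctr u | u <- ts].
Proof. by []. Qed.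

Lemma ctr_h' : ctr h' = h.
Proof.
suff -> t : ctr t = if t == h' then h else if t is App F ts then App F [seq ctr u | u <- ts] else t.
  by rewrite eqxx.
by case: t.
Qed.

(** Contraction of templates, made to commute with evaluation at [h] and at [h'] alike ([vc_h],
    [vc_h']). A hole becomes the constant [h], since [h] and [h'] both contract to [h]; a nonground
    subtemplate with value [h'] at [h] becomes a hole. *)
Fixpoint vc m : template Om :=
  if m ∙ h == h' then (if hole m then Var tt else of_ground unit h)
  else if m is App F ms then App F [seq vc u | u <- ms] else of_ground unit h.

Lemma vcE F ms : vc (App F ms) =
  if App F ms ∙ h == h' then (if hole (App F ms) then Var tt else of_ground unit h)
  else App F [seq vc u | u <- ms].
Proof. by []. Qed.

Lemma neq_hh' : (h == h') = false.
Proof. by apply/eqP => e; move: lt_hh'; rewrite e ltnn. Qed.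

Lemma vcVar : vc (Var tt) = of_ground unit h.
Proof. by rewrite /= neq_hh'. Qed.

Lemma ctr_small t : tsize t < tsize h' -> ctr t = t.
Proof.
elim/term_ind2: t => [[]|F ts IH] lt; rewrite ctrE ifN.
  congr App; rewrite -[RHS]map_id; apply/eq_in_map => u iu; apply: IH => //.
  by apply: ltn_trans lt; apply: tsize_in.
by apply: contraTneq lt => ->; rewrite ltnn.
Qed.

Lemma tsize_ctr t : tsize (ctr t) <= tsize t.
Proof.
elim/term_ind2: t => [[]|F ts IH]; rewrite ctrE; case: eqP => [->|_].
  exact: ltnW.
rewrite /= ltnS -map_comp; elim: ts IH => //= u ts IHu IH; apply: leq_add.
  by apply: IH; rewrite inE eqxx.
by apply: IHu => v iv; apply: IH; rewrite inE iv orbT.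
Qed.

Lemma vc_h m : vc m ∙ h = ctr (m ∙ h).
Proof.
elim/term_ind2: m => [[]|F ms IH].
  by rewrite vcVar plug_ground of_ground_void ctr_small.
rewrite vcE plugApp ctrE -plugApp; case: eqP => [e|_].
  by case: ifP => // _; rewrite plug_ground of_ground_void.
by rewrite plugApp -!map_comp; congr App; apply/eq_in_map => u /IH.
Qed.

(** By size, [h'] occurs in [m ∙ h'] at the holes only, so contraction just replaces the
    argument. *)
Lemma ctr_plug_le m : (if hole m then tsize (m ∙ h) <= tsize h' else tsize (m ∙ h) < tsize h') ->
  ctr (m ∙ h') = m ∙ h.
Proof.
elim/term_ind2: m => [[]|F ms IH] le.
  exact: ctr_h'.
rewrite plugApp ctrE -plugApp ifN.
  rewrite plugApp -map_comp; congr App; apply/eq_in_map => u iu; apply: IH => //.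
  suff lt: tsize (u ∙ h) < tsize h' by case: ifP => // _; apply: ltnW.
  apply: leq_trans (tsize_in_plug F h iu) _.
  by move: le; case: ifP => // _; apply: ltnW.
case hm: (hole (App F ms)) le.
  by move=> _; apply: contraTneq (tsize_plug_lt h' hm isT) => ->; rewrite ltnn.
by rewrite (ground_plug h h' (negbT hm)); apply: contraTneq => ->; rewrite ltnn.
Qed.

Lemma vc_h' m : vc m ∙ h' = ctr (m ∙ h').
Proof.
elim/term_ind2: m => [[]|F ms IH].
  by rewrite vcVar plug_ground of_ground_void ctr_plug_le //= ltnW.
rewrite vcE; case: eqP => [e|ne].
  case hm: (hole _).
    by rewrite ctr_plug_le ?hm e ?leqnn.
  rewrite plug_ground of_ground_void (ground_plug h' h (negbT hm)) e.
  by rewrite ctr_h'.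
have q : App F ms ∙ h' != h'.
  case hm: (hole (App F ms)).
    by apply: contraTneq (tsize_plug_lt h' hm isT) => ->; rewrite ltnn.
  by rewrite (ground_plug h' h (negbT hm)); apply/eqP.
rewrite plugApp ctrE -plugApp ifN // !plugApp -!map_comp.
by congr App; apply/eq_in_map => u /IH.
Qed.

(** Every occurrence of [h'] lies inside a copy of [y]: a subtemplate with a hole has a value larger
    than [h']. *)
Lemma ctr_plug m y : noocc h' m -> tsize h' < tsize y -> ctr (m ∙ y) = m ∙ ctr y.
Proof.
move=> + lt; elim/term_ind2: m => [[]|F ms IH] // no.
rewrite plugApp ctrE -plugApp ifN.
  rewrite plugApp -map_comp; congr App; apply/eq_in_map => u iu; apply: IH => //.
  by move: no; rewrite nooccE => /andP [_ /allP ->].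
case hm: (hole (App F ms)).
  apply: contraTneq (tsize_plug_lt y hm isT) => ->.
  by rewrite -leqNgt; apply: ltnW.
move: no; rewrite nooccE => /andP [+ _]; move/negbT/groundP: hm => [g ->].
by rewrite plug_ground of_ground_void; apply: contraNneq => ->.
Qed.

Lemma noocc_size m : ~~ noocc h' m ->
  tsize h' <= tsize (m ∙ h) /\ (hole m -> tsize h' < tsize (m ∙ h)).
Proof.
elim/term_ind2: m => [[]|F ms IH]; first by rewrite noocc_Var.
rewrite nooccE negb_and negbK.
case: eqP => [-> _|_ /= /allPn [u iu /(IH _ iu) [le _]]].
  by rewrite plug_ground of_ground_void /hole of_groundK.
have lt := leq_ltn_trans le (tsize_in_plug F h iu).
by split=> // ; apply: ltnW.
Qed.

Lemma tsize_ctr_lt m : ~~ noocc h' m -> tsize (ctr (m ∙ h)) < tsize (m ∙ h).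
Proof.
elim/term_ind2: m => [[]|F ms IH]; first by rewrite noocc_Var.
rewrite nooccE negb_and negbK.
case: eqP => [-> _|_ /= /allPn [u iu nu]].
  by rewrite plug_ground of_ground_void ctr_h'.
case: eqP => [e|_]; first by move: lt_hh'; rewrite -e.
rewrite /= ltnS -!map_comp.
move: iu; elim: (ms) IH => //= m ms' IHm IH; rewrite inE => /predU1P [e|iu].
  rewrite -addSn; apply: leq_add; first by apply: IH; rewrite -?e ?inE ?eqxx.
  elim: (ms') => //= a s IHs; apply: leq_add => //; exact: tsize_ctr.
rewrite -addnS; apply: leq_add; first exact: tsize_ctr.
by apply: IHm => // a ia; apply: IH; rewrite inE ia orbT.
Qed.

(* [dk m w]: m is ground and free of h' wherever w is ground. *)
Fixpoint dk m w {struct m} : bool :=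
  (~~ hole m && noocc h' m) || (hole w &&
  match m, w with
  | App _ ms, App _ ws => all2 dk ms ws
  | _, _ => true
  end).

Lemma dkE m w : dk m w = (~~ hole m && noocc h' m) || (hole w &&
  match m, w with
  | App _ ms, App _ ws => all2 dk ms ws
  | _, _ => true
  end).
Proof. by case: m. Qed.

(** Where [v] is ground and free of [h'], the common value is free of [h'] as well, and then [m]
    cannot have a hole there. *)
Lemma dk_shift v m w : v ∙ h = m ∙ h' -> dk v w -> dk m w.
Proof.
elim/term_ind2: m v w => [[]|F ms IH] v w e.
  rewrite !dkE /= => /orP [/andP [hv no]|/andP [-> //]].
  by have := noocc_hole hv no (etrans (esym e) (ground_plug h h' hv)).
rewrite dkE => /orP [/andP [hv no]|].
  have hm := noocc_hole hv no (etrans (esym e) (ground_plug h h' hv)).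
  rewrite dkE; apply/orP; left; apply/andP; split=> //.
  have [g eg] := groundP _ hm; have [g' eg'] := groundP _ hv; move: e no.
  by rewrite eg eg' !plug_ground !of_ground_void => ->.
case/andP=> hw; case: v e => [[]|F' vs] e.
  move=> _; rewrite dkE; case hm: (hole (App F ms)).
    by have := tsize_plug h' hm; rewrite -e leqNgt lt_hh'.
  rewrite noocc_small //; move: e lt_hh'; move/negbT/groundP: hm => [g ->].
  by rewrite plug_ground of_ground_void tsize_of_ground => <-.
case: w hw => [[]|F'' ws] hw; first by rewrite dkE orbT.
move=> /all2P [ew ha]; move: e => [_] /map_eq_zip [es e]; rewrite dkE hw.
apply/orP; right; apply/all2P; split; first by rewrite -es.
case=> m u ip; have [/= im iu] := mem_zip2 ip.
elim: (ms) vs ws es ew {IH}(IH) e ha ip {F F' F'' hw im iu} => [|m' ms' IHm] [|v vs] [|u' ws] //= [es] [ew] IH e ha.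
rewrite inE => /predU1P [[-> ->]|ip].
  by refine (IH m' _ v u' (e (v, m') _) (ha (v, u') _)); rewrite inE eqxx.
apply: (IHm vs ws) => // [a ia|q iq|q iq].
- by apply: IH; rewrite inE ia orbT.
- by apply: e; rewrite inE iq orbT.
- by apply: ha; rewrite inE iq orbT.
Qed.

End Contraction.

(* The iteration lemma below, for [m] the ground template [h']: contraction
   turns it into [h]. *)
Lemma pre_vc h h' m w : tsize h < tsize h' ->
  pre (vc h h' m) w -> dk h' m w -> noocc h' m.
Proof.
move=> lt; elim/term_ind2: m w => [[]|F ms IH] w; first by rewrite noocc_Var.
rewrite vcE dkE; case: eqP => [e|ne].
  case hm: (hole (App F ms)) => /=.
    move=> _ _; apply/negPn/negP => no.
    have [_ /(_ hm)] := @noocc_size h h' (App F ms) no.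
    by rewrite e ltnn.
  move=> p; rewrite (pre_ground p) ?/hole ?of_groundK //=.
  by rewrite orbF.
case: w => [[]|F' ws] //= /andP [_ /all2P [es p]] /orP [/andP [_ //]|/andP [_ /all2P [_ d]]].
apply/andP; split.
  apply/eqP => e; apply: ne; rewrite e plug_ground of_ground_void //.
apply/allP => m im; rewrite size_map in es; have [w iw] := zip_exl es im.
apply: (IH m im w); last exact: (d (m, w)).
apply: (p (vc h h' m, w)).
by move: iw; elim: (ms) (ws) es => [|a s IHs] [|b s'] //= [es]; rewrite !inE => /predU1P [[-> ->]|/(IHs _ es) ->];
  rewrite ?eqxx ?orbT.
Qed.

(** With [m := v] this can be iterated: [v] is ground and free of [h'] wherever any given power of
    [f] is ground. The ground parts of [f] pass to [m] because [h'] does not occur in them; at the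
    holes of [f], [dk_shift] takes over. *)
Lemma dk_plug h h' f v m w : tsize h < tsize h' -> noocc h' f -> hole w ->
  dk h' v w -> f ∙ (v ∙ h) = m ∙ h' -> dk h' m (f ∙ w).
Proof.
move=> lt no hw d; elim/term_ind2: f m no => [[]|F fs IH] m no e.
  exact: dk_shift lt _ _ _ e d.
case hf: (hole (App F fs)); last first.
  have e' : m ∙ h' = App F fs ∙ h' by rewrite -e; apply: ground_plug; rewrite hf.
  have hm := noocc_hole (negbT hf) no e'.
  rewrite dkE; apply/orP; left; apply/andP; split=> //.
  have [g eg] := groundP _ hm; have [g' eg'] := groundP _ (negbT hf); move: e' no.
  by rewrite eg eg' !plug_ground !of_ground_void => ->.
rewrite dkE; apply/orP; right; apply/andP; split; first by rewrite hole_plug.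
case: m e => [[]|F' ms] //= [_] /map_eq_zip [es e]; apply/all2P; split.
  by rewrite size_map.
move: no; rewrite nooccE => /andP [_ /allP no].
have X m f : (f, m) \in zip fs ms -> dk h' m (f ∙ w).
  by move=> i; have [/= i1 i2] := mem_zip2 i; apply: IH => //; [apply: no|apply: (e (f, m))].
elim: (fs) (ms) es X => [|f fs' IHs] [|m ms'] //= [es] X p; rewrite inE => /predU1P [->|].
  by apply: X; rewrite inE eqxx.
by apply: IHs => // ? ? i; apply: X; rewrite inE i orbT.
Qed.

(** Follow a path to a hole of [f]. The size bounds prevent [v] from ending on the way and from
    being ground at the end; what is left of [v] there is [d]. *)
Lemma overlap_down f v y h h' : hole f -> noocc h' v -> tsize h' <= tsize y ->
  f ∙ y = v ∙ h' -> (if hole v then tsize (v ∙ h) <= tsize y else tsize (v ∙ h) < tsize y) ->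
  exists d : template Om, [/\ hole d, noocc h' d & d ∙ h' = y].
Proof.
move=> + + le; elim/term_ind2: f v => [[]|F fs IH] v hf no e lv.
  exists v; split=> //; apply: contraLR lv => hv; rewrite (negbTE hv) -leqNgt.
  by rewrite (ground_plug h h' hv) -e.
case: v no e lv => [[]|F' vs] no e lv.
  have := tsize_plug_lt y hf isT; rewrite e ltnNge.
  by case/negP.
move: hf; rewrite holeApp => /hasP [t ht hh].
move: e => [_] /map_eq_zip [es e]; have [v iv] := zip_exl es ht.
have [_ /= iv2] := mem_zip2 iv.
apply: (IH t ht v) => //; last 1 first.
- suff lt : tsize (v ∙ h) < tsize y by case: ifP => // _; apply: ltnW.
  apply: leq_trans (tsize_in_plug F' h iv2) _.
  by move: lv; case: ifP => // _; apply: ltnW.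
- by move: no; rewrite nooccE => /andP [_ /allP]; apply.
- exact: (e _ iv).
Qed.

(** At a hole of [f] the rest of [v] has value [y], which is smaller than [h']; so it is ground,
    against the bound on [v ∙ h]. Hence [f] never ends before [v] does. *)
Lemma overlap_pre f v y h h' : noocc h' v -> tsize y < tsize h' ->
  f ∙ y = v ∙ h' -> (if hole v then tsize (v ∙ h) <= tsize y else tsize (v ∙ h) < tsize y) ->
  pre v f.
Proof.
move=> + lt; elim/term_ind2: f v => [[]|F fs IH] v no e lv.
  case hv: (hole v) lv => lv.
    by have := tsize_plug h' hv; rewrite -e leqNgt lt.
  by move: lv; rewrite (ground_plug h h' (negbT hv)) -e ltnn.
case: v no e lv => [[]|F' vs] // no [<-] /map_eq_zip [es e] lv /=.
rewrite eqxx; apply/all2P; split=> // p ip.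
have X f v : (f, v) \in zip fs vs -> pre v f.
  move=> i; have [/= i1 i2] := mem_zip2 i; apply: (IH f i1 v); last 1 first.
  - suff lt' : tsize (v ∙ h) < tsize y by case: ifP => // _; apply: ltnW.
    apply: leq_trans (tsize_in_plug F' h i2) _.
    by move: lv; case: ifP => // _; apply: ltnW.
  - by move: no; rewrite nooccE => /andP [_ /allP]; apply.
  - exact: (e _ i).
elim: (fs) (vs) es X p ip {IH e lv no} => [|f fs' IHs] [|m ms'] //= [es] X p; rewrite inE => /predU1P [->|].
  by apply: X; rewrite inE eqxx.
by apply: IHs => // ? ? i; apply: X; rewrite inE i orbT.
Qed.

(** Induction on the size of [v ∙ h]. If [h'] occurs in [v], contraction yields a smaller solution
    of the same equation, and [pre_vc] refutes the occurrence. Otherwise [v] is a prefix of [f] when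
    [v ∙ h] is smaller than [h'], and [v = f ∙ d] for a smaller solution [d] when it is not. *)
Lemma overlap_pow f v h h' : hole f -> f != Var tt -> noocc h' f -> hole v ->
  f ∙ (v ∙ h) = v ∙ h' -> exists n, pre v (fpow n f).
Proof.
move=> hf nf no hv e.
have lt : tsize h < tsize h'.
  rewrite ltnNge; apply/negP => /(tsize_plug_mono v); rewrite -e leqNgt.
  by rewrite tsize_plug_lt.
have [N] := ubnP (tsize (v ∙ h)); elim: N v hv e => // N IH v hv e; rewrite ltnS => leN.
case nv: (noocc h' v); last first.
  have lty : tsize h' < tsize (v ∙ h) by have [_ ->] := noocc_size h (negbT nv).
  have e0 : f ∙ (vc h h' v ∙ h) = vc h h' v ∙ h'.
    by rewrite vc_h // -ctr_plug // e vc_h'.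
  have hv0 : hole (vc h h' v).
    apply: contraLR nf => n0; rewrite negbK; apply/eqP; apply: (@plug_eqVar _ f (vc h h' v ∙ h)) => //.
    by rewrite e0; apply: ground_plug.
  have [|n pn] := IH _ hv0 e0.
    by rewrite vc_h //; apply: leq_trans leN; apply: tsize_ctr_lt; rewrite ?nv.
  suff d : dk h' v (fpow n f) by have := pre_vc lt pn d; rewrite nv.
  (* Relative to the bare hole [dk] is trivially true, which starts the iteration of [dk_plug]. *)
  elim: n {pn} => [|n IHn]; first by rewrite dkE /=; case: (v) => *; rewrite orbT.
  by apply: (dk_plug lt no _ IHn e); apply: hole_fpow.
case: (leqP (tsize h') (tsize (v ∙ h))) => ly; last first.
  by exists 1; rewrite /= plug_Var; apply: overlap_pre nv ly e _; rewrite hv.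
have [|d [hd nd ed]] := overlap_down (h := h) hf nv ly e; first by rewrite hv.
have ev : v = f ∙ d.
  by apply: (@plug_injl _ h') => //; [apply: noocc_plug|rewrite plugA ed].
have [||n pn] := IH d hd; first by rewrite ed ev plugA.
  by apply: leq_trans leN; rewrite ev plugA tsize_plug_lt.
by exists n.+1; rewrite ev; apply: pre_plug.
Qed.

End SelfOverlap.

(** * Templates with ground subterms in G *)

Section GroundKernel.
Variables (Om : signature) (G : seq (gterm Om)).
Implicit Types (m a b e v w f : template Om) (g h y z c d : gterm Om).

Definition gk (V : eqType) (t : term Om V) : bool := all [in G] (ground_subterms t).

Lemma gkApp (V : eqType) F (ts : seq (term Om V)) :
  gk (App F ts) = oapp [in G] true (to_ground (App F ts)) && all (@gk V) ts.
Proof.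
have X (s : seq (term Om V)) :
    all [in G] (pmap (@to_ground _ _) s) = all (fun t => oapp [in G] true (to_ground t)) s.
  by elim: s => //= t s <-; case: to_ground.
rewrite /gk /ground_subterms X [subterms _]/= [all _ (_ :: _)]/=; congr (_ && _).
by elim: ts => //= t ts IH; rewrite all_cat IH -X.
Qed.

Lemma gkVar (V : eqType) (x : V) : gk (Var x : term Om V).
Proof. by []. Qed.

Hypothesis Gsub : forall F ts t, App F ts \in G -> t \in ts -> t \in G.

Lemma gk_of_ground (V : eqType) g : gk (of_ground V g) = (g \in G).
Proof.
elim/term_ind2: g => [[]|F ts IH].
rewrite [of_ground _ _]/= gkApp.
have -> : to_ground (App F [seq subst (of_void (term Om V)) u | u <- ts]) = Some (App F ts).
  exact: (of_groundK V (App F ts)).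
rewrite /=; case i: (App F ts \in G) => //=; apply/allP => _ /mapP [t it ->].
by have := IH t it; rewrite /of_ground => ->; apply: Gsub i it.
Qed.

Lemma gk_noocc z m : z \notin G -> gk m -> noocc z m.
Proof.
move=> nz; elim/term_ind2: m => [[]|F ms IH]; first by rewrite noocc_Var.
move=> gm; rewrite nooccE; apply/andP; split.
  by apply: contraTneq gm => ->; rewrite gk_of_ground.
by move: gm; rewrite gkApp => /andP [_ /allP a]; apply/allP => m im; apply: IH => //; apply: a.
Qed.

Lemma gk_in F (V : eqType) (ts : seq (term Om V)) t : gk (App F ts) -> t \in ts -> gk t.
Proof. by rewrite gkApp => /andP [_ /allP]; apply. Qed.

Lemma gk_hole (V : eqType) F (ts : seq (term Om V)) :
  hole (App F ts) -> gk (App F ts) = all (@gk V) ts.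
Proof. by rewrite gkApp => /eqP ->. Qed.

Lemma gk_subst (V W : eqType) (s : V -> term Om W) (t : term Om V) :
  (forall x : V, x \in vars t -> gk (s x) && hole (s x)) -> gk t -> gk (subst s t).
Proof.
move=> hs; have hh : hole (subst s t) = hole t.
  by apply: hole_subst => x /hs /andP [].
elim/term_ind2: t hs hh => [v|F ts IH] hs hh gt; first by have /andP [] := hs v (mem_head _ _).
case ht: (hole (App F ts)); last first.
  move/negbT/groundP: ht gt => [g ->].
  by rewrite subst_of_ground !gk_of_ground.
have := hh; rewrite ht => hh'; have -> : subst s (App F ts) = App F [seq subst s u | u <- ts] by [].
rewrite gk_hole //; apply/allP => _ /mapP [u iu ->].
have X x : x \in vars u -> gk (s x) && hole (s x).
  by move=> ix; apply: hs; apply/flattenP; exists (vars u) => //; apply: map_f.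
apply: IH => //; last exact: gk_in gt iu.
by apply: hole_subst => x /X /andP [].
Qed.

Lemma gk_plug m e : gk m -> gk e -> hole e -> gk (m ∙ e).
Proof. by move=> gm ge he; apply: gk_subst => // x _; rewrite ge. Qed.

Lemma plug_inG m z : hole m -> m ∙ z \in G -> z \in G.
Proof.
elim/term_ind2: m => [[] //|F ms IH]; rewrite holeApp plugApp => /hasP [m im hm] i.
by apply: (IH m) => //; apply: Gsub i _; apply: map_f.
Qed.

Lemma plug_in_gk m z : m ∙ z \in G -> gk m.
Proof.
elim/term_ind2: m => [[] //|F ms IH] i.
case hm: (hole (App F ms)); last first.
  by move/negbT/groundP: hm i => [g' ->]; rewrite plug_ground of_ground_void gk_of_ground.
rewrite gk_hole //; apply/allP => m im; apply: IH => //.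
by rewrite plugApp in i; apply: Gsub i _; apply: map_f.
Qed.

Lemma gk_ground m z : ~~ hole m -> gk m -> m ∙ z \in G.
Proof. by case/groundP=> g ->; rewrite gk_of_ground plug_ground of_ground_void. Qed.

Lemma plug_big_hole m z : gk m -> m ∙ z \notin G -> hole m.
Proof. by move=> gm; apply: contraR => /gk_ground; apply. Qed.

Lemma plug_big m z : hole m -> z \notin G -> m ∙ z \notin G.
Proof. by move=> hm; apply: contra; apply: plug_inG. Qed.

Lemma gk_inj z m m' : z \notin G -> gk m -> gk m' -> m ∙ z = m' ∙ z -> m = m'.
Proof. by move=> nz gm gm'; apply: plug_injl; apply: gk_noocc. Qed.

(** One argument on each side suffices when the arguments are big: along the path to a hole of [a]
    the value stays big, so the subtemplate of [b] met there is not ground. *)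
Lemma gk_levi a b z (w : gterm Om) : hole a -> hole b -> gk a -> gk b -> z \notin G -> w \notin G ->
  a ∙ z = b ∙ w ->
  (exists e, [/\ hole e, gk e, b = a ∙ e & z = e ∙ w]) \/
  (exists e, [/\ hole e, gk e, a = b ∙ e & w = e ∙ z]).
Proof.
move=> ha hb ga gb nz nw eq.
have X : (exists e, [/\ hole e, gk e & z = e ∙ w]) \/ (exists e, [/\ hole e, gk e & w = e ∙ z]).
  elim/term_ind2: a b ha hb ga gb eq => [[]|F as_ IH] [[]|F' bs] // ha hb ga gb eq.
  - by left; exists (Var tt).
  - by left; exists (App F' bs).
  - by right; exists (App F as_).
  move: eq => [_] /map_eq_zip [es e]; move: ha; rewrite holeApp => /hasP [t ht hh].
  have [t' htt] := zip_exl es ht; have [/= _ ht'] := mem_zip2 htt.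
  have {}e : t ∙ z = t' ∙ w := e _ htt.
  have gt := gk_in ga ht; have gt' := gk_in gb ht'.
  apply: (IH t ht t') => //; apply: (@plug_big_hole _ w) => //.
  by rewrite -e plug_big.
case: X => [[e [he ge h1]]|[e [he ge h1]]]; [left|right]; exists e; split=> //.
  by apply: (gk_inj nw gb); [apply: gk_plug|rewrite plugA -h1].
by apply: (gk_inj nz ga); [apply: gk_plug|rewrite plugA -h1].
Qed.

Lemma gk_pre m w : pre m w -> gk w -> gk m.
Proof.
elim/term_ind2: m w => [[] //|F ms IH] w pm gw.
case hm: (hole (App F ms)); last by rewrite -(pre_ground pm) ?hm.
rewrite gk_hole //; case: w pm gw => [//|F' ws] /= /andP [_ /all2P [es p]] gw.
apply/allP => m im; have [w iw] := zip_exl es im; have [_ /= iw'] := mem_zip2 iw.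
by apply: (IH m im w); [apply: p iw|apply: gk_in gw iw'].
Qed.

Lemma gk_fpow n f : hole f -> gk f -> gk (fpow n f).
Proof. by move=> hf gf; elim: n => //= n IH; apply: gk_plug => //; apply: hole_fpow. Qed.

(** [v] is a prefix of a power of [f], and the ground subterms of a prefix are ground subterms of
    the whole. *)
Lemma overlap_gk f v h h' : hole f -> gk f -> f != Var tt -> h' \notin G -> hole v ->
  f ∙ (v ∙ h) = v ∙ h' -> gk v.
Proof.
move=> hf gf nf nh hv e.
have [n p] := overlap_pow hf nf (gk_noocc nh gf) hv e.
exact: gk_pre p (gk_fpow n hf gf).
Qed.

Fixpoint cnt h (t : gterm Om) : nat :=
  (t == h) + if t is App F ts then sumn [seq cnt h u | u <- ts] else 0.

Lemma cntE h F ts : cnt h (App F ts) = (App F ts == h) + sumn [seq cnt h u | u <- ts].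
Proof. by []. Qed.

Lemma cnt_self h : 0 < cnt h h.
Proof. by case: h => [[]|F ts]; rewrite cntE eqxx. Qed.

Lemma cnt_plug h f y : hole f -> cnt h y <= cnt h (f ∙ y).
Proof.
elim/term_ind2: f => [//|F fs IH]; rewrite holeApp => /hasP [m im hm].
apply: leq_trans (IH m im hm) _; rewrite plugApp cntE -map_comp.
apply: leq_trans (leq_addl _ _); elim: (fs) im => //= a s IHs; rewrite inE.
by case/predU1P=> [->|/IHs]; [apply: leq_addr|move=> le; apply: leq_trans le (leq_addl _ _)].
Qed.

Lemma cntG h g : h \notin G -> g \in G -> cnt h g = 0.
Proof.
move=> nh; elim/term_ind2: g => [[]|F ts IH] i; rewrite cntE.
case: eqP nh => [<-|_ nh]; first by rewrite i.
rewrite add0n; have : {in ts, forall t, cnt h t = 0}.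
  by move=> t it; apply: IH => //; apply: Gsub i it.
elim: (ts) => //= t s IHs X; rewrite X ?inE ?eqxx //= IHs // => u iu.
by apply: X; rewrite inE iu orbT.
Qed.

Lemma cnt_lt h h' m : tsize h < tsize h' -> cnt h h' = 0 ->
  hole m <= cnt h (m ∙ h) - cnt h (m ∙ h') /\ cnt h (m ∙ h') <= cnt h (m ∙ h).
Proof.
move=> lt c0; elim/term_ind2: m => [[]|F ms IH].
  have -> : Var tt ∙ h = h by []; have -> : Var tt ∙ h' = h' by [].
  by rewrite c0 subn0 cnt_self.
case hm: (hole (App F ms)); last first.
  by rewrite (ground_plug h h' (negbT hm)) subnn leqnn.
have q : (App F ms ∙ h' == h) = false.
  apply/eqP => e; have := tsize_plug h' hm; rewrite e leqNgt lt; done.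
have X x : sumn [seq cnt h u | u <- [seq m ∙ x | m <- ms]] = sumn [seq cnt h (m ∙ x) | m <- ms].
  by rewrite -map_comp.
rewrite !plugApp !cntE -!plugApp q add0n !X.
suff : (has (@hole _ _) ms : nat) + sumn [seq cnt h (m ∙ h') | m <- ms]
         <= sumn [seq cnt h (m ∙ h) | m <- ms].
  by rewrite -(holeApp F) hm; set A := sumn _; set B := sumn _; lia.
elim: (ms) IH => //= m s IHs IH.
have [] := IH m (mem_head _ _).
have : has (@hole _ _) s + sumn [seq cnt h (m ∙ h') | m <- s]
         <= sumn [seq cnt h (m ∙ h) | m <- s].
  by apply: IHs => t it; apply: IH; rewrite inE it orbT.
set A := sumn _; set B := sumn _; case: (hole m); case: (has _ _) => /=; lia.
Qed.

(** Count the occurrences of [h]. There are none in [h'], as G is closed under subterms; so [v ∙ h]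
    has more of them than [v ∙ h'], although by the equation the latter contains the former. *)
Lemma overlap_cnt f v h h' : hole f -> f != Var tt -> hole v -> h \notin G -> h' \in G ->
  f ∙ (v ∙ h) = v ∙ h' -> False.
Proof.
move=> hf nf hv nh ih e.
have lt : tsize h < tsize h'.
  rewrite ltnNge; apply/negP => /(tsize_plug_mono v); rewrite -e leqNgt.
  by rewrite tsize_plug_lt.
have [+ _] := cnt_lt v lt (cntG nh ih); rewrite hv -e.
by have := cnt_plug h (v ∙ h) hf; move=> le; rewrite subn_gt0 ltnNge le.
Qed.

(** Two kinds of holes: [true] is the hole proper, [false] marks the places from which the big term
    [y] was abstracted by [abst]. *)
Definition inst (W : eqType) (o : term Om bool) (z u : term Om W) : term Om W :=
  subst (fun b : bool => if b then z else u) o.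

Fixpoint abst y m : term Om bool :=
  if m == of_ground unit y then Var false else
  match m with
  | Var _ => Var true
  | App F ms => App F [seq abst y t | t <- ms]
  end.

Lemma abstE y F ms : abst y (App F ms) =
  if App F ms == of_ground unit y then Var false else App F [seq abst y t | t <- ms].
Proof. by []. Qed.

Lemma abstVar y : abst y (Var tt) = Var true.
Proof.
rewrite /=; case: eqP => // /(congr1 (@hole _ _)).
by rewrite /hole of_groundK.
Qed.

Lemma abstK y m : inst (abst y m) (Var tt) (of_ground unit y) = m.
Proof.
elim/term_ind2: m => [[]|F ms IH]; first by rewrite abstVar.
rewrite abstE; case: eqP => [->//|_]; rewrite /inst /= -map_comp.
by congr App; rewrite -[RHS]map_id; apply/eq_in_map => m /IH.
Qed.

Lemma abst_noocc y m : noocc y m -> abst y m = subst (fun=> Var true) m.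
Proof.
elim/term_ind2: m => [[]|F ms IH]; first by rewrite abstVar.
rewrite nooccE abstE => /andP [/negbTE -> /allP no] /=; congr App.
by apply/eq_in_map => m im; apply: IH => //; apply: no.
Qed.

Lemma abst_ground y m a : y \notin G -> gk a -> m = of_ground unit (a ∙ y) ->
  abst y m = subst (fun=> Var false) a.
Proof.
move=> ny; elim/term_ind2: a m => [[]|F as_ IH] m ga ->.
  have -> : Var tt ∙ y = y by [].
  by case: (y) => [[]|F ts]; rewrite [of_ground _ _]/= abstE -[App _ _]/(of_ground unit (App F ts)) eqxx.
rewrite plugApp [of_ground _ _]/= abstE -[App F (map _ (map _ _))]/(of_ground unit (App F [seq m ∙ y | m <- as_])).
case: eqP => [/of_ground_inj e|_].
  case ha: (hole (App F as_)); first by have := plug_eqVar ha e.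
  by have := gk_ground y (negbT ha) ga; rewrite plugApp e (negbTE ny).
rewrite /= -!map_comp; congr App; apply/eq_in_map => t it /=.
by apply: IH => //; apply: gk_in ga it.
Qed.

Lemma abst_hole y m : hole m = (true \in vars (abst y m)).
Proof.
elim/term_ind2: m => [[]|F ms IH]; first by rewrite abstVar.
rewrite abstE; case: eqP => [->|_]; first by rewrite /hole of_groundK.
rewrite holeApp /=; elim: (ms) IH => //= m s IHs IH.
rewrite mem_cat -IH ?inE ?eqxx // IHs // => t it; apply: IH.
by rewrite inE it orbT.
Qed.

(** Descend [dl], [t1] and [t2] in parallel. Where [t1] reaches its hole, the value of [dl] at [c1]
    is [y], and the second equation becomes the overlap [t2 ∙ (dl ∙ c1) = dl ∙ c2]; likewise for
    [t2]. A ground part of [dl] is a value of [t1] at [y], and abstracting [y] from it gives [t1]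
    back. *)
Lemma overlap_abst dl t1 t2 c1 c2 y : y \notin G -> c1 \notin G -> c1 != c2 ->
  gk t1 -> gk t2 -> dl ∙ c1 = t1 ∙ y -> dl ∙ c2 = t2 ∙ y -> gk (abst y dl).
Proof.
move=> ny nc1 nc; elim/term_ind2: dl t1 t2 => [[]|F ms IH] t1 t2 g1 g2 e1 e2.
  by rewrite abstVar.
case hm: (hole (App F ms)); last first.
  have [g eg] := groundP _ (negbT hm).
  rewrite (@abst_ground _ _ t1) //; last by rewrite eg -e1 eg plug_ground of_ground_void.
  by apply: gk_subst.
have X : gk (App F ms) -> gk (abst y (App F ms)).
  move=> gm; rewrite abst_noocc; last exact: gk_noocc.
  by apply: gk_subst.
case: t1 g1 e1 => [[]|F1 s1] g1 e1.
  apply: X; case h2: (hole t2); last first.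
    by apply: (@plug_in_gk _ c2); rewrite e2; apply: gk_ground => //; rewrite h2.
  have n2 : t2 != Var tt.
    apply: contraNneq nc => et; apply/eqP; apply: (plug_injr hm).
    by rewrite e1 e2 et.
  have ov : t2 ∙ (App F ms ∙ c1) = App F ms ∙ c2 by rewrite e1 e2.
  (* The argument by powers applies to a big [c2]; for [c2] in G counting excludes the overlap
     altogether. *)
  case ic2: (c2 \in G); first by have := overlap_cnt h2 n2 hm nc1 ic2 ov.
  by apply: (overlap_gk h2 g2 n2 _ hm ov); rewrite ic2.
case: t2 g2 e2 => [[]|F2 s2] g2 e2.
  apply: X; case h1: (hole (App F1 s1)); last first.
    apply: (@plug_in_gk _ c1); rewrite e1; apply: gk_ground => //; by rewrite h1.
  have ov : App F1 s1 ∙ (App F ms ∙ c2) = App F ms ∙ c1 by rewrite e1 e2.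
  exact: (overlap_gk h1 g1 isT nc1 hm ov).
rewrite abstE; case: ifP => // _.
move: e1 e2 => [_] /map_eq_zip [z1 e1] [_] /map_eq_zip [z2 e2].
rewrite gk_hole; last first.
  rewrite holeApp has_map; move: hm; rewrite holeApp => /hasP [m im hm].
  apply/hasP; exists m => //=; rewrite hole_vars; apply: contraTN hm => /nilP e.
  by rewrite (abst_hole y) e.
apply/allP => _ /mapP [m im ->].
have [u1 i1] := zip_exl z1 im; have [u2 i2] := zip_exl z2 im.
have [/= _ j1] := mem_zip2 i1; have [/= _ j2] := mem_zip2 i2.
by apply: (IH m im u1 u2 (gk_in g1 j1) (gk_in g2 j2)); [apply: (e1 _ i1)|apply: (e2 _ i2)].
Qed.

End GroundKernel.

Section Subst.
Variable Om : signature.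

Lemma eq_in_subst (V W : eqType) (s r : V -> term Om W) (t : term Om V) :
  {in vars t, s =1 r} -> subst s t = subst r t.
Proof.
elim/term_ind2: t => [v|f ts IH] h /=; first by apply: h; rewrite inE.
congr App; apply/eq_in_map => u iu; apply: IH => // v iv; apply: h.
by apply/flattenP; exists (vars u) => //; apply: map_f.
Qed.

Lemma vars_subst (V W : eqType) (s : V -> term Om W) (t : term Om V) :
  vars (subst s t) = flatten [seq vars (s v) | v <- vars t].
Proof.
elim/term_ind2: t => [v|f ts IH] /=; first by rewrite cats0.
rewrite -map_comp map_flatten; elim: ts IH => //= u us IHu IH.
rewrite IH ?inE ?eqxx // IHu ?flatten_cat // => t it; apply: IH.
by rewrite inE it orbT.
Qed.

Lemma tsize_subst (V W : eqType) (s : V -> term Om W) (t : term Om V) v :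
  v \in vars t -> tsize (s v) <= tsize (subst s t).
Proof.
elim/term_ind2: t => [u|f ts IH] /=; first by rewrite inE => /eqP ->.
case/flattenP=> _ /mapP [t it ->] iv; apply: leq_trans (IH t it iv) (ltnW _).
by apply: (@tsize_in _ _ f); apply: map_f.
Qed.

Lemma tsize_subst_lt (V W : eqType) (s : V -> term Om W) f ts v :
  v \in vars (App f ts) -> tsize (s v) < tsize (subst s (App f ts)).
Proof.
case/flattenP=> _ /mapP [t it ->] /(tsize_subst s) le; apply: leq_ltn_trans le _.
by apply: (@tsize_in _ _ f); apply: map_f.
Qed.

Lemma leq_tsize_subst (V W : eqType) (s : V -> term Om W) (t : term Om V) :
  tsize t <= tsize (subst s t).
Proof.
elim/term_ind2: t => [u|f ts IH] /=; first exact: tsize_gt0.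
rewrite ltnS -map_comp; elim: ts IH => //= u us IHu IH; apply: leq_add.
  by apply: IH; rewrite inE eqxx.
by apply: IHu => t it; apply: IH; rewrite inE it orbT.
Qed.

Lemma ltn_tsize_subst (V W : eqType) (s : V -> term Om W) (t : term Om V) v :
  v \in vars t -> 1 < tsize (s v) -> tsize t < tsize (subst s t).
Proof.
move=> + lt; elim/term_ind2: t => [u|f ts IH]; first by rewrite inE => /eqP <-.
case/flattenP=> _ /mapP [t it ->] iv; rewrite /= ltnS -map_comp.
elim: ts IH it => //= u us IHu IH; rewrite inE => /predU1P [e|it].
  rewrite -addSn; apply: leq_add; first by apply: IH; rewrite ?inE -?e ?eqxx.
  by elim: us {IHu IH} => //= w ws IHw; apply: leq_add => //; apply: leq_tsize_subst.
rewrite -addnS; apply: leq_add; first exact: leq_tsize_subst.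
by apply: IHu => // w iw; apply: IH; rewrite inE iw orbT.
Qed.

Lemma tsize_hole_gt1 (V : eqType) f (ts : seq (term Om V)) :
  hole (App f ts) -> 1 < tsize (App f ts).
Proof.
rewrite holeApp; case: ts => //= t ts _; rewrite ltnS.
exact: leq_trans (tsize_gt0 t) (leq_addr _ _).
Qed.

Lemma height_rename (V W : eqType) (r : V -> W) (t : term Om V) :
  height (subst (fun v => Var (r v)) t) = height t.
Proof.
elim/term_ind2: t => [//|F ts IH] /=; congr (foldr _ _ _).+1; rewrite -map_comp.
by apply/eq_in_map => u /IH.
Qed.

End Subst.

(** * Factorization of templates with two kinds of holes *)

Section Skeleton.
Variables (Om : signature) (G : seq (gterm Om)).
Hypothesis Gsub : forall F ts t, App F ts \in G -> t \in ts -> t \in G.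
Implicit Types (m a b e v w f r t : template Om) (g h y z c d : gterm Om).
Implicit Types (o : term Om bool).
Let gk := @gk Om G.

Lemma inst_plug (W : eqType) o a b (u : term Om W) :
  inst o a b ∙ u = inst o (a ∙ u) (b ∙ u).
Proof. by rewrite /inst /plug subst_comp; apply: eq_subst; case. Qed.

Lemma gk_inst (W : eqType) o (a b : term Om W) :
  gk o -> gk a -> hole a -> gk b -> hole b -> gk (inst o a b).
Proof. by move=> go ga ha gb hb; apply: gk_subst => // - [] _; apply/andP. Qed.

Lemma gk_substK (V W : eqType) (s : V -> term Om W) (t : term Om V) :
  (forall x, hole (s x)) -> gk (subst s t) -> gk t.
Proof.
move=> hs; elim/term_ind2: t => [//|F ms IH] g.
case hm: (hole (App F ms)); last first.
  by move/negbT/groundP: hm g => [g' ->]; rewrite subst_of_ground /gk !gk_of_ground.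
rewrite /gk gk_hole //; apply/allP => m im; apply: IH => //.
by apply: gk_in g _; apply: map_f.
Qed.

Definition lift r : term Om bool := subst (fun=> Var true) r.

Definition comp o r : term Om bool :=
  subst (fun b : bool => if b then lift r else Var false) o.

Lemma inst_comp (W : eqType) o r (z u : term Om W) : inst (comp o r) z u = inst o (r ∙ z) u.
Proof.
rewrite /inst /comp subst_comp; apply: eq_subst => - [] //=.
by rewrite /lift subst_comp.
Qed.

Lemma comp_comp o r e : comp (comp o r) e = comp o (r ∙ e).
Proof.
rewrite /comp subst_comp; apply: eq_subst => - [] //=.
by rewrite /lift !subst_comp.
Qed.

Lemma comp_Var o : comp o (Var tt) = o.
Proof. by rewrite /comp -[RHS]subst_id; apply: eq_subst; case. Qed.

(** Follow a [true] hole of [o]. If [t] lasts as long, the rest of it is [t']. If [t] ends earlier,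
    a nontrivial subtemplate of [o] has value [y]; by size it has no [false] hole, so it is a
    template [r] with [y = r ∙ z]. *)
Lemma factor_split o t z y : gk o -> gk t -> y \notin G -> z \notin G ->
  true \in vars o -> inst o z y = t ∙ y ->
  (exists t', [/\ gk t', hole t' & t' ∙ y = z]) \/
  (exists r, [/\ gk r, hole r, r != Var tt, y = r ∙ z & height r <= height o]).
Proof.
move=> + + ny nz; elim/term_ind2: o t => [b|F os IH] t go gt io e.
  left; exists t; move: io e; rewrite inE => /eqP <- e; split=> //.
  by apply: (@plug_big_hole _ G Gsub _ y) => //; rewrite -e.
case: t gt e => [[]|F' ts] gt e.
  right; exists (subst (fun=> Var tt) (App F os)); split=> //.
  - by apply: gk_subst.
  - by rewrite hole_subst // hole_vars /nilp -lt0n; case: (vars _) io.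
  - rewrite -[LHS]e /inst /plug subst_comp; apply: eq_in_subst => - [] // i.
    have := tsize_subst_lt (fun b : bool => if b then z else y) i.
    by rewrite -/(inst (App F os) z y) e ltnn.
  - by rewrite height_rename.
case/flattenP: io => _ /mapP [o io ->] ib.
move: e => [_] /map_eq_zip [es e]; have [t it] := zip_exl es io.
have [/= _ it'] := mem_zip2 it.
have [[t' h]|[r [h1 h2 h3 h4 h5]]] := IH o io t (gk_in go io) (gk_in gt it') ib (e _ it).
  by left; exists t'.
by right; exists r; split=> //; apply: leq_trans h5 (ltnW (height_in _ io)).
Qed.

(** At a hole of [t] the value is [r], so [o] has there either a [false] hole or, by size, a copy of
    [r] with [true] holes only. All [true] holes of [o] lie in such copies. *)
Lemma comp_factor o t r : hole r -> r != Var tt ->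
  inst o (Var tt) r = t ∙ r -> exists o', o = comp o' r.
Proof.
move=> hr nr; elim/term_ind2: t o => [[]|F ts IH] o e.
  case: o e => [[]|F os] e.
  - by case/negP: nr; rewrite -[r]/(Var tt ∙ r) -e.
  - by exists (Var false).
  exists (Var true).
  have -> : comp (Var true) r = lift (inst (App F os) (Var tt) r) by rewrite e.
  rewrite /lift /inst subst_comp.
  rewrite -[LHS]subst_id; apply: eq_in_subst => - [] // i.
  have := tsize_subst_lt (fun b : bool => if b then Var tt else r) i.
  by rewrite -/(inst (App F os) (Var tt) r) e ltnn.
case: o e => [[]|F' os] //.
  move=> e; have e' : App F ts ∙ r = r by rewrite -e.
  case ht: (hole (App F ts)).
    by have := tsize_plug_lt r ht isT; rewrite e' ltnn.
  by move/negbT/groundP: ht e' hr => [g ->]; rewrite plug_ground => <-; rewrite /hole of_groundK.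
move=> [->] /map_eq_zip [es e].
suff [cs ->] : exists cs : seq (term Om bool), os = map (comp^~ r) cs by exists (App F cs).
have X o : o \in os -> exists c : term Om bool, o = comp c r.
  move=> io; have [t it] := zip_exl es io; have [/= _ it'] := mem_zip2 it.
  by apply: (IH t it' o); apply: e it.
elim: (os) X => [|o s IHs] X; first by exists [::].
have [c ->] := X o (mem_head _ _); have [|cs ->] := IHs.
  by move=> u iu; apply: X; rewrite inE iu orbT.
by exists (c :: cs).
Qed.

Lemma factor o t z y : gk o -> gk t -> y \notin G -> z \notin G ->
  true \in vars o -> inst o z y = t ∙ y ->
  (exists t', [/\ gk t', hole t', t' ∙ y = z & t = inst o t' (Var tt)]) \/
  (exists r o', [/\ gk r, hole r, r != Var tt & o = comp o' r]).
Proof.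
move=> go gt ny nz io e.
case: (factor_split go gt ny nz io e) => [[t' [g h ez]]|[r [g h n ey _]]]; [left|right].
  exists t'; split=> //; apply: (gk_inj Gsub ny gt); first by apply: gk_inst.
  by rewrite inst_plug -e ez.
exists r; suff [o' eo] : exists o', o = comp o' r by exists o'.
apply: (@comp_factor o t r) => //; apply: (gk_inj Gsub nz).
- by apply: gk_inst.
- by apply: gk_plug.
by rewrite inst_plug plugA -ey -e.
Qed.

(** Right factors [r] of [o] are moved into [e] as long as there are any; [o] shrinks each time. In
    the end the second alternative of [factor] is excluded, so [o] splits off from the right-hand
    side of every equation of this shape, and what remains no longer mentions [y] inside the
    left-hand template. *)
Lemma skeleton y dl : gk (abst y dl) -> hole dl ->
  exists o e, [/\ gk o, true \in vars o, gk e, hole e & dl = inst o e (of_ground unit y)] /\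
  forall t y' c, gk t -> y' \notin G -> e ∙ c \notin G -> inst o (e ∙ c) y' = t ∙ y' ->
  exists t', [/\ gk t', hole t', t' ∙ y' = e ∙ c & t = inst o t' (Var tt)].
Proof.
move=> ga hd.
suff X n : forall o e, tsize o < n -> gk o -> true \in vars o -> gk e -> hole e ->
    abst y dl = comp o e -> exists o e,
    [/\ gk o, true \in vars o, gk e, hole e & abst y dl = comp o e] /\
    forall t y' c, gk t -> y' \notin G -> e ∙ c \notin G -> inst o (e ∙ c) y' = t ∙ y' ->
    exists t', [/\ gk t', hole t', t' ∙ y' = e ∙ c & t = inst o t' (Var tt)].
  have [o [e [[go io ge he ea] he']]] := X _ (abst y dl) (Var tt) (ltnSn _) ga
    (etrans (esym (abst_hole y dl)) hd) isT isT (esym (comp_Var _)).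
  exists o, e; split=> //; split=> //.
  have -> : inst o e (of_ground unit y) = inst o (e ∙ Var tt) (of_ground unit y) by rewrite plug_Var.
  by rewrite -inst_comp -ea abstK.
elim: n => // n IH o e; rewrite ltnS => leo go io ge he ea.
case: (pselect (forall t y' c, gk t -> y' \notin G -> e ∙ c \notin G ->
    inst o (e ∙ c) y' = t ∙ y' ->
    exists t', [/\ gk t', hole t', t' ∙ y' = e ∙ c & t = inst o t' (Var tt)])) => [H|].
  by exists o, e.
move=> /existsNP [t] /existsNP [y'] /existsNP [c].
move=> /not_implyP [gt] /not_implyP [ny] /not_implyP [nc] /not_implyP [et ne].
case: (factor go gt ny nc io et) => [//|[r [o' [gr hr nr eo]]]].
have io' : true \in vars o'.
  move: io; rewrite eo vars_subst => /flattenP [_ /mapP [[] // ib ->]].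
  by rewrite inE.
apply: (IH o' (r ∙ e)) => //.
- apply: leq_trans leo; rewrite eo; apply: ltn_tsize_subst io' _.
  apply: leq_trans (leq_tsize_subst (fun=> Var true) r).
  by case: (r) nr hr => [[]|F ts] // _; apply: tsize_hole_gt1.
- by apply: (@gk_substK _ _ _ o') => //; last first; [move: go; rewrite eo; apply|case=> //; rewrite hole_subst].
- exact: gk_plug.
- by rewrite hole_plug.
- by rewrite -comp_comp -eo.
Qed.

End Skeleton.

(** * Triangular systems *)

Section Greedy.
Variables (X : eqType) (Y : Type) (sat : X -> Y -> Prop).

(** Encodes a chain of [k] strict inclusions between the solution sets of growing subsystems. *)
Definition triangular k (E : set X) (Phi : set Y) :=
  exists (e : nat -> X) (p : nat -> Y),
  [/\ forall i, i < k -> E (e i), forall i, i < k -> Phi (p i),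
      forall i, i < k -> ~ sat (e i) (p i) &
      forall i j, i < j < k -> sat (e i) (p j)].

(** Relative to a set [Phi] of points, so that case distinctions on the solution add up
    ([basisU]). *)
Definition basis k (E : set X) (Phi : set Y) :=
  exists s : seq X, [/\ forall e, e \in s -> E e, size s <= k &
    forall p, Phi p -> (forall e, e \in s -> sat e p) -> forall e, E e -> sat e p].

(** Keep adding equalities that do not follow from those already chosen; the choices form a
    triangular system. *)
Lemma greedy k (E : set X) (Phi : set Y) : ~ triangular k.+1 E Phi -> basis k E Phi.
Proof.
move=> nt; apply: contrapT => nb.
suff T j : j <= k.+1 -> triangular j E Phi by apply: nt; apply: T.
elim: j => [_|j IH lj].
  have [e0 [p0 _]] : exists e p, E e /\ Phi p.
    apply: contrapT => n; apply: nb; exists [::]; split=> // p Pp _ e Ee.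
    by case: n; exists e, p.
  by exists (fun=> e0), (fun=> p0); split=> // i j; lia.
have [e [p [he hp hn hs]]] := IH (ltnW lj).
have : exists e' p', [/\ E e', Phi p', ~ sat e' p' & forall i, i < j -> sat (e i) p'].
  apply: contrapT => n; apply: nb; exists [seq e i | i <- iota 0 j]; split.
  - by move=> e' /mapP [i]; rewrite mem_iota => ii ->; apply: he.
  - by rewrite size_map size_iota.
  move=> p' Pp hall e' Ee; apply: contrapT => ns; apply: n; exists e', p'; split=> // i ij.
  by apply: hall; apply/mapP; exists i; rewrite ?mem_iota.
move=> [e' [p' [Ee Pp ns hs']]].
exists (fun i => if i == j then e' else e i), (fun i => if i == j then p' else p i).
split.
- by move=> i; rewrite ltnS leq_eqVlt; case: eqP => //= _; apply: he.
- by move=> i; rewrite ltnS leq_eqVlt; case: eqP => //= _; apply: hp.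
- by move=> i; rewrite ltnS leq_eqVlt; case: eqP => //= _; apply: hn.
move=> i l /andP [il lj']; move: lj'; rewrite ltnS => lj'; rewrite (ltn_eqF (leq_trans il lj')); move: lj'; rewrite leq_eqVlt.
by case: eqP => [el _|ne /= lj'']; [apply: hs'; rewrite -el|apply: hs; rewrite il].
Qed.

End Greedy.

(** * Templates with a hole as a free monoid *)

Section Words.
Variable Om : signature.
Implicit Types (m a b e p q r s t u v : template Om).

Lemma plug_injl_hole m m' q : hole q -> m ∙ q = m' ∙ q -> m = m'.
Proof.
move=> hq; have X f : hole f -> f ∙ q = q -> f = Var tt.
  move=> hf e; apply/eqP; apply: contraPT e => nf e.
  by have := tsize_plug_lt q hf nf; rewrite e ltnn.
elim/term_ind2: m m' => [[]|F ms IH] [[]|F' ms'] // e.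
- by rewrite (X (App F' ms')) // -(hole_plug _ hq) -e.
- by rewrite (X (App F ms)) // -(hole_plug _ hq) e.
move: e => [<-] /map_eq_zip [es e]; congr App; apply: zip_eq => // x ix.
by have [p1 p2] := mem_zip2 ix; apply: IH => //; apply: e.
Qed.

Lemma levi a b p q : hole a -> hole b -> hole p -> hole q -> a ∙ p = b ∙ q ->
  (exists2 e, hole e & b = a ∙ e /\ p = e ∙ q) \/
  (exists2 e, hole e & a = b ∙ e /\ q = e ∙ p).
Proof.
move=> ha hb hp hq eq.
have X : (exists2 e, hole e & p = e ∙ q) \/ (exists2 e, hole e & q = e ∙ p).
  elim/term_ind2: a b ha hb eq => [[]|F as_ IH] [[]|F' bs] // ha hb eq.
  - by left; exists (Var tt).
  - by left; exists (App F' bs).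
  - by right; exists (App F as_).
  move: eq => [_] /map_eq_zip [es e]; move: ha; rewrite holeApp => /hasP [t ht hh].
  have [t' htt] := zip_exl es ht; have {}e : t ∙ p = t' ∙ q := e _ htt.
  by apply: (IH t ht t') => //; rewrite -(hole_plug _ hq) -e hole_plug.
case: X => [[e he h1]|[e he h1]]; [left|right]; exists e => //; split=> //.
  by apply: (plug_injl_hole hq); rewrite plugA -h1.
by apply: (plug_injl_hole hp); rewrite plugA -h1.
Qed.

Definition irred u := [/\ hole u, u != Var tt &
  forall a b, hole a -> hole b -> u = a ∙ b -> a = Var tt \/ b = Var tt].

Definition tprod (s : seq (template Om)) : template Om := foldr (@plug Om unit) (Var tt) s.

Lemma tprod_cat (s s' : seq (template Om)) : tprod (s ++ s') = tprod s ∙ tprod s'.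
Proof. by elim: s => //= m s ->; rewrite plugA. Qed.

Lemma hole_tprod (s : seq (template Om)) : (forall m, m \in s -> hole m) -> hole (tprod s).
Proof.
elim: s => //= m s IH h; rewrite hole_plug; first by apply: h; rewrite inE eqxx.
by apply: IH => a ia; apply: h; rewrite inE ia orbT.
Qed.

Lemma tprod_ex m : hole m -> exists s : seq (template Om), (forall u, u \in s -> irred u) /\ tprod s = m.
Proof.
have [n] := ubnP (tsize m); elim: n m => // n IH m; rewrite ltnS => le hm.
case: (eqVneq m (Var tt)) => [->|nm]; first by exists [::].
case: (pselect (irred m)) => [im|nim].
  by exists [:: m]; split=> [u|]; rewrite ?inE ?[tprod _]plug_Var // => /eqP ->.
have [a [b [[ha hb na nb] em]]] : exists a b, [/\ hole a, hole b, a != Var tt & b != Var tt] /\ m = a ∙ b.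
  apply: contrapT => n'; apply: nim; split=> // a b ha hb em.
  case: (eqVneq a (Var tt)) => [|na]; first by left.
  case: (eqVneq b (Var tt)) => [|nb]; first by right.
  by case: n'; exists a, b.
have lb : tsize b < tsize m by rewrite em; apply: tsize_plug_lt.
have la : tsize a < tsize m.
  rewrite em; apply: (@ltn_tsize_subst _ _ _ _ _ tt).
    by move: ha; rewrite hole_vars; case: (vars a) => [|[] ?] //; rewrite inE.
  by case: (b) hb nb => [[]|F bs] // hb _; apply: tsize_hole_gt1.
have [sa [ia ea]] := IH a (leq_trans la le) ha.
have [sb [ib eb]] := IH b (leq_trans lb le) hb.
exists (sa ++ sb); rewrite tprod_cat ea eb em; split=> // u.
by rewrite mem_cat => /orP [/ia|/ib].
Qed.

(** By Levi's lemma one of the two leading factors extends the other, and irreducibility makes them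
    equal. *)
Lemma tprod_inj (s s' : seq (template Om)) : (forall u, u \in s -> irred u) -> (forall u, u \in s' -> irred u) ->
  tprod s = tprod s' -> s = s'.
Proof.
elim: s s' => [|m s IH] [|m' s'] // is_ is' e.
- have [hm' /negP nm' _] := is' m' (mem_head _ _).
  have hs : hole (tprod s') by apply: hole_tprod => a ia; case: (is' a); rewrite // inE ia orbT.
  have := tsize_plug (tprod s') hm'; rewrite -[m' ∙ _]e => le; case: nm'.
  case: m' e {is' hm' le} => [[]|] //.
- have [hm' /negP nm' _] := is_ m (mem_head _ _).
  by case: m e nm' {is_ hm'} => [[]|] //.
have [hm nm im] := is_ m (mem_head _ _); have [hm' nm' im'] := is' m' (mem_head _ _).
have hs' : forall a, a \in s' -> irred a by move=> a ia; apply: is'; rewrite inE ia orbT.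
have hs : forall a, a \in s -> irred a by move=> a ia; apply: is_; rewrite inE ia orbT.
have h1 : hole (tprod s) by apply: hole_tprod => a /hs [].
have h2 : hole (tprod s') by apply: hole_tprod => a /hs' [].
case: (levi hm hm' h1 h2 e) => [[r hr [er es]]|[r hr [er es]]].
  case: (im' _ _ hm hr er) => [em|em]; first by rewrite em eqxx in nm.
  rewrite em plug_Var in er; rewrite er; congr (_ :: _); apply: IH => //.
  by rewrite es em.
case: (im _ _ hm' hr er) => [em|em]; first by rewrite em eqxx in nm'.
rewrite em plug_Var in er; rewrite er; congr (_ :: _); apply: IH => //.
by rewrite es em.
Qed.

(** The equality supplies the two middle factors, the solution the four outer ones. Systems with big
    values end up in this form. *)
Definition word_sat (e : template Om * template Om)
    (x : (template Om * template Om) * (template Om * template Om)) : Prop :=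
  x.1.1 ∙ e.1 ∙ x.1.2 = x.2.1 ∙ e.2 ∙ x.2.2.

End Words.

Section Numeral.
Variables (T : eqType) (S : seq T).
(** The base exceeds every value of [index _ S], including the default [size S] for letters outside
    [S], so that [numeral_lt] holds for all words. *)
Let B := (size S).+1.

Fixpoint numeral (w : seq T) : nat :=
  if w is u :: w' then index u S * B ^ size w' + numeral w' else 0.

Lemma numeral_cat w w' : numeral (w ++ w') = numeral w * B ^ size w' + numeral w'.
Proof. by elim: w => //= u w ->; rewrite size_cat expnD mulnDl addnA mulnA. Qed.

Lemma numeral_lt w : numeral w < B ^ size w.
Proof.
elim: w => //= u w IH; rewrite expnS.
apply: (@leq_trans ((index u S).+1 * B ^ size w)).
  by rewrite mulSn addnC ltn_add2r.
by rewrite leq_mul2r ltnS index_size orbT.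
Qed.

Lemma numeral_inj w w' : {subset w <= S} -> {subset w' <= S} ->
  size w = size w' -> numeral w = numeral w' -> w = w'.
Proof.
elim: w w' => [|u w IH] [|u' w'] //= su su' [es]; rewrite -es => e.
have lt := numeral_lt w; have lt' := numeral_lt w'; rewrite -es in lt'.
have p : 0 < B ^ size w by rewrite expn_gt0.
have ei : index u S = index u' S.
  by have := congr1 (divn^~ (B ^ size w)) e; rewrite !divnMDl // !divn_small // !addn0.
have ev : numeral w = numeral w' by move: e; rewrite ei => /addnI.
congr (_ :: _).
  rewrite -(nth_index u (su u (mem_head _ _))) ei.
  by rewrite (set_nth_default u') ?nth_index ?index_mem ?su' ?mem_head.
by apply: IH => // x ix; [apply: su|apply: su']; rewrite inE ix orbT.
Qed.

End Numeral.

Section Rank.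
Import GRing.Theory Num.Theory.
Local Open Scope ring_scope.

(** The 6 x 6 matrix of values would be triangular with nonzero diagonal, hence invertible, but it
    factors through dimension 5. *)
Lemma rank5 (v w : 'I_6 -> 'I_5 -> rat) :
  (forall i j : 'I_6, (i < j)%N -> \sum_k v i k * w j k = 0) ->
  (forall i : 'I_6, \sum_k v i k * w i k != 0) -> False.
Proof.
move=> h0 hn.
pose V : 'M_(6, 5) := \matrix_(i, k) v i k; pose W : 'M_(5, 6) := \matrix_(k, j) w j k.
have E i j : (V *m W) i j = \sum_k v i k * w j k.
  by rewrite mxE; apply: eq_bigr => k _; rewrite !mxE.
have u : V *m W \in unitmx.
  rewrite unitmxE det_trig; last by apply/is_trig_mxP => i j /h0; rewrite E.
  by rewrite unitfE; apply/prodf_neq0 => i _; rewrite E.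
have := mxrankM_maxl V W; rewrite mxrank_unit // => le.
by have := leq_trans le (rank_leq_col V).
Qed.

End Rank.

Section Triangular.
Import GRing.Theory Num.Theory.
Variable Om : signature.
Implicit Types (m u : template Om).

Let holes2 : set (template Om * template Om) := [set e | hole e.1 /\ hole e.2]%classic.

(* For a fixed difference of word lengths, [word_sat] is the vanishing of a
   bilinear form in five variables: read words over the irreducible templates
   as numerals. *)
Lemma word_triangular :
  ~ triangular (@word_sat Om) 8 holes2 [set x | holes2 x.1 /\ holes2 x.2]%classic.
Proof.
move=> [e [x [he hx hn hs]]].
have /choice [f hf] : forall m, exists s : seq (template Om),
    hole m -> (forall u, u \in s -> irred u) /\ tprod s = m.
  move=> m; case: (boolP (hole m)) => [/tprod_ex [s hs']|_]; first by exists s.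
  by exists [::].
pose ws i := [:: f (e i).1; f (e i).2; f (x i).1.1; f (x i).1.2; f (x i).2.1; f (x i).2.2].
pose S := flatten [seq flatten (ws i) | i <- iota 0 8].
have sub i w : (i < 8)%N -> w \in ws i -> {subset w <= S}.
  move=> li iw u iu; apply/flattenP; exists (flatten (ws i)).
    by apply/mapP; exists i; rewrite ?mem_iota.
  by apply/flattenP; exists w.
clearbody S.
pose L i j := f (x j).1.1 ++ f (e i).1 ++ f (x j).1.2.
pose R i j := f (x j).2.1 ++ f (e i).2 ++ f (x j).2.2.
have SE i j : (i < 8)%N -> (j < 8)%N -> word_sat (e i) (x j) <-> L i j = R i j.
  move=> li lj; have [h1 h2] := he i li; have [[h3 h4] [h5 h6]] := hx j lj.
  have [[i1 e1] [i2 e2]] := (hf _ h1, hf _ h2).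
  have [[i3 e3] [i4 e4]] := (hf _ h3, hf _ h4).
  have [[i5 e5] [i6 e6]] := (hf _ h5, hf _ h6).
  have eL : tprod (L i j) = (x j).1.1 ∙ (e i).1 ∙ (x j).1.2.
    by rewrite /L !tprod_cat e1 e3 e4 plugA.
  have eR : tprod (R i j) = (x j).2.1 ∙ (e i).2 ∙ (x j).2.2.
    by rewrite /R !tprod_cat e2 e5 e6 plugA.
  rewrite /word_sat -eL -eR; split=> [|->] //; apply: tprod_inj => u.
    by rewrite !mem_cat => /or3P [/i3|/i1|/i4].
  by rewrite !mem_cat => /or3P [/i5|/i2|/i6].
(* The difference of the lengths is a function of [i] plus a function of [j]. It vanishes for
   [i = 0] and for [j = 7], hence everywhere in between: this is why the chain has two members more
   than the six used below. *)
have sz i j : (0 < i < 7)%N -> (0 < j < 7)%N -> size (L i j) = size (R i j).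
  move=> li lj.
  have /(congr1 size) A : L 0 j = R 0 j by apply/SE; [lia|lia|apply: hs; lia].
  have /(congr1 size) C : L 0 7 = R 0 7 by apply/SE; [lia|lia|apply: hs; lia].
  have /(congr1 size) D : L i 7 = R i 7 by apply/SE; [lia|lia|apply: hs; lia].
  by move: A C D; rewrite /L /R !size_cat; lia.
have VE i j : (0 < i < 7)%N -> (0 < j < 7)%N ->
    word_sat (e i) (x j) <-> numeral S (L i j) = numeral S (R i j).
  move=> li lj; rewrite SE; try lia; split=> [->//|]; apply: numeral_inj; last exact: sz.
    by move=> u; rewrite !mem_cat => /or3P [] iu; [refine (sub j (f (x j).1.1) _ _ u iu)|refine (sub i (f (e i).1) _ _ u iu)|refine (sub j (f (x j).1.2) _ _ u iu)];
      rewrite ?inE ?eqxx ?orbT //; lia.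
  by move=> u; rewrite !mem_cat => /or3P [] iu; [refine (sub j (f (x j).2.1) _ _ u iu)|refine (sub i (f (e i).2) _ _ u iu)|refine (sub j (f (x j).2.2) _ _ u iu)];
    rewrite ?inE ?eqxx ?orbT //; lia.
pose B := (size S).+1.
pose N (w : seq (template Om)) : rat := (numeral S w)%:R%R; pose P (w : seq (template Om)) : rat := (B%:R ^+ size w)%R.
(* The numeral of [u ++ w ++ u'] is [N u * P w * P u' + N w * P u' + N u']. Each side contributes
   the coordinates [P] and [N] of its middle word, and the summands without a middle word share the
   coordinate 1. *)
pose v (i : 'I_6) (k : 'I_5) : rat := nth 0%R
  [:: P (f (e i.+1).1); N (f (e i.+1).1); 1%R; P (f (e i.+1).2); N (f (e i.+1).2)] k.
pose w (j : 'I_6) (k : 'I_5) : rat := nth 0%R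
  [:: (N (f (x j.+1).1.1) * P (f (x j.+1).1.2))%R; P (f (x j.+1).1.2);
      (N (f (x j.+1).1.2) - N (f (x j.+1).2.2))%R;
      (- (N (f (x j.+1).2.1) * P (f (x j.+1).2.2)))%R; (- P (f (x j.+1).2.2))%R] k.
have D (i j : 'I_6) : (\sum_k v i k * w j k = N (L i.+1 j.+1) - N (R i.+1 j.+1))%R.
  rewrite !big_ord_recl big_ord0 /v /w /= /N /P /L /R !numeral_cat !size_cat !expnD.
  by rewrite !(natrD, natrM, natrX); ring.
apply: (@rank5 v w) => [i j lij|i].
  have li := ltn_ord i; have lj := ltn_ord j.
  rewrite D; apply/eqP; rewrite subr_eq0 /N eqr_nat; apply/eqP/VE; [lia|lia|].
  by apply: hs; lia.
have li := ltn_ord i; rewrite D subr_eq0 /N eqr_nat; apply/eqP => h.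
by case: (hn i.+1); first lia; apply/VE => //; lia.
Qed.

End Triangular.

(** * Bases of systems of equalities *)

Section Basis.
Variables (X : eqType) (Y : Type) (sat : X -> Y -> Prop).
Implicit Types (E : set X) (Phi : set Y).

Lemma basis_sub k k' E Phi Phi' : k <= k' -> Phi' `<=` Phi ->
  basis sat k E Phi -> basis sat k' E Phi'.
Proof.
move=> le sub [s [h1 h2 h3]]; exists s; split=> // [|p /sub]; last exact: h3.
exact: leq_trans le.
Qed.

Lemma basis0 k E Phi : (forall p, Phi p -> forall e, E e -> sat e p) -> basis sat k E Phi.
Proof. by move=> h; exists [::]; split=> // p Pp _; apply: h. Qed.

Lemma basisU k1 k2 E Phi1 Phi2 : basis sat k1 E Phi1 -> basis sat k2 E Phi2 ->
  basis sat (k1 + k2) E (Phi1 `|` Phi2).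
Proof.
move=> [s1 [a1 b1 c1]] [s2 [a2 b2 c2]]; exists (s1 ++ s2); split.
- by move=> e; rewrite mem_cat => /orP [/a1|/a2].
- by rewrite size_cat leq_add.
move=> p Pp h; case: Pp => Pp; [apply: c1 => // e ie|apply: c2 => // e ie].
  by apply: h; rewrite mem_cat ie.
by apply: h; rewrite mem_cat ie orbT.
Qed.

Lemma basisUl k1 k2 E1 E2 Phi : basis sat k1 E1 Phi -> basis sat k2 E2 Phi ->
  basis sat (k1 + k2) (E1 `|` E2) Phi.
Proof.
move=> [s1 [a1 b1 c1]] [s2 [a2 b2 c2]]; exists (s1 ++ s2); split.
- by move=> e; rewrite mem_cat => /orP [/a1|/a2]; [left|right].
- by rewrite size_cat leq_add.
move=> p Pp h e [Ee|Ee]; [apply: c1 Ee => // e' ie|apply: c2 Ee => // e' ie].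
  by apply: h; rewrite mem_cat ie.
by apply: h; rewrite mem_cat ie orbT.
Qed.

Lemma basis_bigcup (I : eqType) (r : seq I) k E (Phi : I -> set Y) :
  (forall i, i \in r -> basis sat k E (Phi i)) ->
  basis sat (size r * k) E [set p | exists2 i, i \in r & Phi i p].
Proof.
elim: r => [_|i r IH h]; first by apply: basis0 => p [].
rewrite /= mulSn; apply: (@basis_sub _ _ _ (Phi i `|` [set p | exists2 i, i \in r & Phi i p]) _ (leqnn _)).
  by move=> p [j]; rewrite inE => /predU1P [->|ij] Pp; [left|right; exists j].
apply: basisU; first by apply: h; rewrite inE eqxx.
by apply: IH => j ij; apply: h; rewrite inE ij orbT.
Qed.

(** Once [s] belongs to the basis, only solutions of [s] have to be considered. *)
Lemma basis_cond k E Phi (s : seq X) : (forall e, e \in s -> E e) ->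
  basis sat k E [set p | Phi p /\ forall e, e \in s -> sat e p] ->
  basis sat (size s + k) E Phi.
Proof.
move=> hs [s' [a b c]]; exists (s ++ s'); split.
- by move=> e; rewrite mem_cat => /orP [/hs|/a].
- by rewrite size_cat leq_add2l.
move=> p Pp h; apply: c => [|e ie]; last by apply: h; rewrite mem_cat ie orbT.
by split=> // e ie; apply: h; rewrite mem_cat ie.
Qed.

Lemma basis_unsat k E Phi (s : seq X) : (forall e, e \in s -> E e) -> size s <= k ->
  (forall p, Phi p -> (forall e, e \in s -> sat e p) -> False) -> basis sat k E Phi.
Proof. by move=> hs le h; exists s; split=> // p Pp /(h p Pp). Qed.

(** As all points of [Phi] agree on every equality, an equality refuted by one point is refuted by
    all and forms a basis; if there is none, the empty basis will do. *)
Lemma basis1 k E Phi : 0 < k ->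
  (forall e p p', E e -> Phi p -> Phi p' -> sat e p -> sat e p') -> basis sat k E Phi.
Proof.
move=> k0 h; case: (pselect (exists e p, [/\ E e, Phi p & ~ sat e p])) => [[e [p [Ee Pp n]]]|ne].
  apply: (@basis_unsat _ _ _ [:: e]) => // [e'|p' Pp' hs]; first by rewrite inE => /eqP ->.
  by apply: n; apply: h (hs e (mem_head _ _)).
by apply: basis0 => p Pp e Ee; apply: contrapT => n; apply: ne; exists e, p.
Qed.

Lemma basis_one k E Phi e : 0 < k -> E e -> (forall e', E e' -> e' = e) -> basis sat k E Phi.
Proof.
move=> k0 Ee h; exists [:: e]; split=> // [e'|p _ hs e' /h ->]; last exact: hs (mem_head _ _).
by rewrite inE => /eqP ->.
Qed.

End Basis.

(** The tool for changing the form of a system: equalities correspond along [R] in both directions,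
    and each point has a translation with the same truth values along [R]. *)
Lemma basis_rel (X X' : eqType) (Y Y' : Type) (sat : X -> Y -> Prop) (sat' : X' -> Y' -> Prop)
    (R : X -> X' -> Prop) k (E : set X) (E' : set X') (Phi : set Y) (Phi' : set Y') :
  (forall e, E e -> exists2 e', E' e' & R e e') ->
  (forall e', E' e' -> exists2 e, E e & R e e') ->
  (forall p, Phi p -> exists2 p', Phi' p' &
     forall e e', E e -> E' e' -> R e e' -> (sat e p <-> sat' e' p')) ->
  basis sat' k E' Phi' -> basis sat k E Phi.
Proof.
move=> r1 r2 hp [s' [a b c]].
have [s [sE ss hs]] : exists s, [/\ forall e, e \in s -> E e, size s = size s' &
    forall e', e' \in s' -> exists2 e, e \in s & R e e'].
  elim: s' a {b c} => [|e' s' IH] a; first by exists [::].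
  have [|s [sE ss hs]] := IH; first by move=> e ie; apply: a; rewrite inE ie orbT.
  have [e Ee re] := r2 _ (a e' (mem_head _ _)).
  exists (e :: s); split=> [x||x]; rewrite /= ?ss // !inE.
    by case/predU1P=> [->|/sE].
  case/predU1P=> [->|/hs [y iy ry]]; first by exists e; rewrite ?inE ?eqxx.
  by exists y; rewrite ?inE ?iy ?orbT.
exists s; rewrite ss; split=> // p Pp h e Ee.
have [p' Pp' q] := hp p Pp; have [e' Ee' re] := r1 e Ee.
apply/(q _ _ Ee Ee' re); apply: c => // x ix; have [y iy ry] := hs x ix.
by apply/(q _ _ (sE _ iy) (a _ ix) ry); apply: h.
Qed.

(** * Equalities between two variables with big values *)

Section Two.
Variables (Om : signature) (G : seq (gterm Om)).
Hypothesis Gsub : forall F ts t, App F ts \in G -> t \in ts -> t \in G.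
Implicit Types (m a b v w f r s t A B : template Om) (g h x y z c d : gterm Om).
Implicit Types (o : term Om bool).
Let gk := @gk Om G.

(** The number 7 is one less than the length excluded by [word_triangular]. *)
Lemma basis_words (X : eqType) (Y : Type) (sat : X -> Y -> Prop) (E : set X) (Phi : set Y)
    (R : X -> template Om * template Om -> Prop) k : 7 <= k ->
  (forall e, E e -> exists2 e', hole e'.1 /\ hole e'.2 & R e e') ->
  (forall p, Phi p -> exists2 p', (hole p'.1.1 /\ hole p'.1.2) /\ (hole p'.2.1 /\ hole p'.2.2) &
     forall e e', E e -> R e e' -> (sat e p <-> word_sat e' p')) ->
  basis sat k E Phi.
Proof.
move=> k7 hE hP; apply: (@basis_sub _ _ sat 7 k E Phi Phi k7) => //.
pose E' := [set e' : template Om * template Om | (hole e'.1 /\ hole e'.2) /\ exists2 e, E e & R e e'].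
apply: (basis_rel (sat' := @word_sat Om) (R := R) (E' := E')
   (Phi' := [set x | (hole x.1.1 /\ hole x.1.2) /\ (hole x.2.1 /\ hole x.2.2)])).
- by move=> e Ee; have [e' h r] := hE e Ee; exists e' => //; split=> //; exists e.
- by move=> e' [_ [e Ee r]]; exists e.
- by move=> p /hP [p' h q]; exists p' => // e e' Ee _; apply: q.
apply: greedy => -[e [p [h1 h2 h3 h4]]]; apply: (@word_triangular Om).
by exists e, p; split=> // i li; have [] := h1 i li.
Qed.

Definition nontriv o := [/\ gk o, true \in vars o & o != Var true].
(** [t ∙ y] is then [o] with [t' ∙ y] in the [true] holes and [y] in the [false] ones. A divisor
    common to all equalities can be moved into the template variable in front. *)
Definition divides o t := exists t', [/\ gk t', hole t' & t = inst o t' (Var tt)].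

Lemma divides_big o t y z : gk o -> gk t -> y \notin G -> z \notin G -> true \in vars o ->
  tsize y <= tsize z -> inst o z y = t ∙ y -> divides o t.
Proof.
move=> go gt ny nz io le e.
case: (factor_split Gsub go gt ny nz io e) => [[t' [g h ez]]|[r [gr hr nr ey _]]].
  exists t'; split=> //; apply: (gk_inj Gsub ny gt); first by apply: gk_inst.
  by rewrite inst_plug -e ez.
by have := tsize_plug_lt z hr nr; rewrite -ey ltnNge le.
Qed.

Lemma hole_inst_true o y : true \in vars o -> hole (inst o (Var tt) (of_ground unit y)).
Proof.
move=> i; rewrite hole_vars vars_subst.
set s := flatten _; suff : tt \in s by case: s.
by apply/flattenP; exists [:: tt]; rewrite ?inE //; apply/mapP; exists true.
Qed.

(** Three elements witness that all of [T] has no common divisor. Take a common divisor [o1] of [t1]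
    and [t2] that is smallest at [y], and a [t3] that it does not divide. By [levi2], applied to the
    cofactors at [y], every common divisor extends [o1], so it does not divide [t3] either. *)
Lemma third_factor (T : set (template Om)) t1 t2 y : y \notin G ->
  (forall t, T t -> gk t /\ hole t) -> T t1 -> T t2 -> t1 != t2 ->
  (forall o, nontriv o -> exists2 t, T t & ~ divides o t) ->
  exists2 t3, T t3 & forall o, nontriv o -> divides o t1 -> divides o t2 -> ~ divides o t3.
Proof.
move=> ny hT T1 T2 nt hno.
pose cand o := [/\ nontriv o, divides o t1 & divides o t2].
case: (pselect (exists o, cand o)) => [|nc]; last first.
  by exists t1 => // o no d1 d2 _; apply: nc; exists o.
pose sz o := tsize (inst o (Var tt) (of_ground unit y)).
case=> o0 co0; have [o1 co1 omin] : exists2 o1, cand o1 & forall o, cand o -> sz o1 <= sz o.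
  have [n] := ubnP (sz o0); elim: n o0 co0 => // n IH o0 co0; rewrite ltnS => le.
  case: (pselect (exists2 o, cand o & sz o < sz o0)) => [[o co lo]|n'].
    by apply: (IH o co); apply: leq_trans le.
  by exists o0 => // o co; rewrite leqNgt; apply/negP => lo; apply: n'; exists o.
have [no1 [u1 [g1 h1 e1]] [u2 [g2 h2 e2]]] := co1.
have [t3 T3 nd] := hno o1 no1; exists t3 => // o no d1 d2 [v3 [gv3 hv3 ev3]]; apply: nd.
have co : cand o by [].
have [v1 [gv1 hv1 ev1]] := d1; have [v2 [gv2 hv2 ev2]] := d2.
have [go io _] := no; have [go1 io1 _] := no1.
pose W (o : term Om bool) : template Om := inst o (Var tt) (of_ground unit y).
have hW o' : true \in vars o' -> hole (W o') by apply: hole_inst_true.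
have WE o' t' : inst o' t' (Var tt) ∙ y = W o' ∙ (t' ∙ y).
  by rewrite inst_plug /W inst_plug plug_ground of_ground_void.
have n12 : v1 ∙ y != v2 ∙ y.
  by apply: contraNneq nt => /(gk_inj Gsub ny gv1 gv2) e12; rewrite ev1 ev2 e12.
have f1 : W o ∙ (v1 ∙ y) = W o1 ∙ (u1 ∙ y) by rewrite -!WE -ev1 -e1.
have f2 : W o ∙ (v2 ∙ y) = W o1 ∙ (u2 ∙ y) by rewrite -!WE -ev2 -e2.
have X e' : hole e' -> W o = W o1 ∙ e' -> divides o1 t3.
  move=> he eW; apply: (@divides_big _ _ y (e' ∙ (v3 ∙ y))) => //.
  - by have [] := hT t3 T3.
  - by apply: plug_big => //; apply: plug_big.
  - by apply: leq_trans (tsize_plug _ he); apply: tsize_plug.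
  rewrite {1}ev3 WE eW plugA /W inst_plug plug_ground of_ground_void; done.
case: (levi2 (hW _ io) (hW _ io1) n12 f1 f2) => [[e' he [eW _ _]]|[e' he [eW _ _]]]; last exact: X he eW.
case: (eqVneq e' (Var tt)) => [ee|ne]; first by apply: (X (Var tt)) => //; rewrite eW ee !plug_Var.
have := omin o co; rewrite /sz -/(W o) -/(W o1) eW leqNgt => /negP [].
apply: (@ltn_tsize_subst _ _ _ _ _ tt); last first.
  by case: (e') ne he => [[]|F ts] // _; apply: tsize_hole_gt1.
by have := hW o io; rewrite hole_vars; case: (vars _) => [|[] ?] //; rewrite inE.
Qed.

(** The skeleton of [dl] divides [t1], [t2] and [t3], so it is the bare hole, and no [y] is left in
    [dl]. *)
Lemma overlap_gk_factor (dl : template Om) t1 t2 t3 c1 c2 c3 y :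
  (forall o, nontriv o -> divides o t1 -> divides o t2 -> ~ divides o t3) ->
  gk t1 -> gk t2 -> gk t3 -> hole dl -> y \notin G -> c1 \notin G -> c2 \notin G -> c3 \notin G ->
  c1 != c2 -> dl ∙ c1 = t1 ∙ y -> dl ∙ c2 = t2 ∙ y -> dl ∙ c3 = t3 ∙ y -> gk dl.
Proof.
move=> no g1 g2 g3 hd ny n1 n2 n3 nc e1 e2 e3.
have ga := overlap_abst Gsub ny n1 nc g1 g2 e1 e2.
have [o [e [[go io ge he ed] H]]] := skeleton Gsub ga hd.
have D c : dl ∙ c = inst o (e ∙ c) y by rewrite {1}ed inst_plug plug_ground of_ground_void.
have Dv c t : c \notin G -> gk t -> dl ∙ c = t ∙ y -> divides o t.
  move=> nc' gt; rewrite D => /(H t y c gt ny (plug_big Gsub he nc')) [t' [? ? _ ->]].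
  by exists t'.
case: (eqVneq o (Var true)) => [eo|neo]; first by move: ed; rewrite eo => ->.
by case: (no o) => //; [apply: Dv e1|apply: Dv e2|apply: Dv e3].
Qed.

(* The pair (s, t) stands for A s x = B t y. *)
Definition satVV (e : template Om * template Om) (p : (template Om * template Om) * (gterm Om * gterm Om)) :=
  p.1.1 ∙ (e.1 ∙ p.2.1) = p.1.2 ∙ (e.2 ∙ p.2.2).
Definition solVV : set ((template Om * template Om) * (gterm Om * gterm Om)) :=
  [set p | [/\ hole p.1.1, hole p.1.2, p.2.1 \notin G & p.2.2 \notin G]].
Definition eqVV : set (template Om * template Om) :=
  [set e | [/\ gk e.1, hole e.1, gk e.2 & hole e.2]].

Lemma basisVV_swap k (E : set (template Om * template Om)) : basis satVV k [set e | E (e.2, e.1)] solVV -> basis satVV k E solVV.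
Proof.
apply: (basis_rel (R := fun e e' => e' = (e.2, e.1))).
- by move=> [s t] Ee; exists (t, s).
- by move=> [s t] Ee; exists (t, s).
move=> [[A B] [x y]] [/= hA hB nx ny]; exists ((B, A), (y, x)) => // e _ _ _ ->.
by rewrite /satVV /=; split=> ->.
Qed.

(** [B] absorbs the common part [o], with [y] as a constant in it. This is legitimate because the
    ground subterms of [B] are arbitrary. *)
Lemma basisVV_strip k (E : set (template Om * template Om)) o : E `<=` eqVV -> nontriv o -> (forall e, E e -> divides o e.2) ->
  basis satVV k [set e | E (e.1, inst o e.2 (Var tt)) /\ eqVV e] solVV -> basis satVV k E solVV.
Proof.
move=> hE [go io no] hd; apply: (basis_rel (R := fun e e' => e = (e'.1, inst o e'.2 (Var tt)))).
- move=> [s t] Ee; have [t' [gt ht /= et]] := hd _ Ee; rewrite et in Ee *.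
  by exists (s, t') => //; split=> //; have [/= ? ? _ _] := hE _ Ee.
- by move=> [s t] [Ee _]; exists (s, inst o t (Var tt)).
move=> [[A B] [x y]] [/= hA hB nx ny].
exists ((A, B ∙ inst o (Var tt) (of_ground unit y)), (x, y)).
  by split=> //=; rewrite hole_plug //; apply: hole_inst_true.
by move=> e [s t] _ _ ->; rewrite /satVV /= inst_plug !plugA inst_plug plug_ground of_ground_void.
Qed.

Lemma tsize_divides o t : nontriv o -> tsize t < tsize (inst o t (Var tt)).
Proof.
move=> [_ io no]; case: o io no => [b|F ts] io no.
  by move: io no; rewrite inE => /eqP <-; rewrite eqxx.
exact: (tsize_subst_lt (fun b : bool => if b then t else Var tt) io).
Qed.

(** 11 = 4 + 7. After stripping common divisors, fix two equalities that differ on both sides, which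
    make [A] and [B] comparable, and one more for each side, so that the difference [dl] has its
    ground subterms in G whichever of [A] and [B] is longer. Then seven word equations remain. *)
Lemma basisVV (E : set (template Om * template Om)) : E `<=` eqVV -> basis satVV 11 E solVV.
Proof.
move=> hE; case: (pselect (exists e, E e)) => [[e0 E0]|n]; last first.
  by apply: basis0 => p _ e Ee; case: n; exists e.
have [N] := ubnP (tsize e0.1 + tsize e0.2); elim: N E hE e0 E0 => // N IH E hE e0 E0; rewrite ltnS => le.
case: (pselect (exists2 o, nontriv o & forall e, E e -> divides o e.2)) => [[o no hd]|nd2].
  apply: (basisVV_strip hE no hd); have [t' [gt ht et]] := hd _ E0.
  have [g1 h1 g2 h2] := hE _ E0.
  apply: (IH _ _ (e0.1, t')) => [e [] //||].
    by split=> //=; rewrite -et -surjective_pairing.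
  apply: leq_trans le; rewrite [in X in _ < X]et ltn_add2l; exact: tsize_divides.
case: (pselect (exists2 o, nontriv o & forall e, E e -> divides o e.1)) => [[o no hd]|nd1].
  apply: basisVV_swap; apply: (@basisVV_strip _ _ o) => //.
  - by move=> e /hE [].
  - by move=> e /hd.
  have [t' [gt ht et]] := hd _ E0; have [g1 h1 g2 h2] := hE _ E0.
  apply: (IH _ _ (e0.2, t')) => [e [] //||].
    by split=> //=; rewrite -et -surjective_pairing.
  by apply: leq_trans le; rewrite addnC [in X in _ < X]et ltn_add2r; apply: tsize_divides.
case: (pselect (forall e, E e -> e = e0)) => [h|].
  exact: (basis_one satVV solVV _ E0).
move=> /existsNP [e1] /not_implyP [E1 /eqP ne].
have [gs0 hs0 gt0 ht0] := hE _ E0; have [gs1 hs1 gt1 ht1] := hE _ E1.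
(* Two distinct equalities with a side in common have no common solution with big values. *)
case: (eqVneq e0.1 e1.1) => [es|ns].
  apply: (@basis_unsat _ _ _ _ _ _ [:: e0; e1]) => // [e|p [hA hB nx ny] h].
    by rewrite !inE => /orP [] /eqP ->.
  have a0 := h e0 (mem_head _ _); have a1 : satVV e1 p by apply: h; rewrite !inE eqxx orbT.
  case/negP: ne; rewrite (surjective_pairing e1) (surjective_pairing e0) -es xpair_eqE eqxx /=.
  apply/eqP/esym/(gk_inj Gsub ny gt0 gt1)/(plug_injr hB).
  by rewrite -a0 -a1 es.
case: (eqVneq e0.2 e1.2) => [et|nt].
  apply: (@basis_unsat _ _ _ _ _ _ [:: e0; e1]) => // [e|p [hA hB nx ny] h].
    by rewrite !inE => /orP [] /eqP ->.
  have a0 := h e0 (mem_head _ _); have a1 : satVV e1 p by apply: h; rewrite !inE eqxx orbT.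
  case/negP: ns; apply/eqP/(gk_inj Gsub nx gs0 gs1)/(plug_injr hA).
  by rewrite a0 a1 et.
case: (pselect (exists y, y \notin G)) => [[y0 ny0]|ny]; last first.
  by apply: basis0 => p [_ _ n _]; case: ny; exists p.2.1.
have [_ [e2 E2 <-] d2] : exists2 t3, [set e.2 | e in E] t3 &
    forall o, nontriv o -> divides o e0.2 -> divides o e1.2 -> ~ divides o t3.
  apply: (third_factor ny0) nt _; try by [exists e0|exists e1].
    by move=> _ [e /hE [? ? ? ?] <-].
  move=> o no; apply: contrapT => n; apply: nd2; exists o => // e Ee.
  by apply: contrapT => nd; apply: n; exists e.2 => //; exists e.
have [_ [e3 E3 <-] d3] : exists2 t3, [set e.1 | e in E] t3 &
    forall o, nontriv o -> divides o e0.1 -> divides o e1.1 -> ~ divides o t3.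
  apply: (third_factor ny0) ns _; try by [exists e0|exists e1].
    by move=> _ [e /hE [? ? ? ?] <-].
  move=> o no; apply: contrapT => n; apply: nd1; exists o => // e Ee.
  by apply: contrapT => nd; apply: n; exists e.1 => //; exists e.
apply: (@basis_cond _ _ _ 7 _ _ [:: e0; e1; e2; e3]).
  by move=> e; rewrite !inE => /or4P [] /eqP ->.
apply: (@basis_words _ _ _ _ _ eq) => // [e /hE [? ? ? ?]|]; first by exists e.
have [gs2 hs2 gt2 ht2] := hE _ E2; have [gs3 hs3 gt3 ht3] := hE _ E3.
move=> [[A B] [x y]] [[/= hA hB nx ny] hs].
have a0 : A ∙ (e0.1 ∙ x) = B ∙ (e0.2 ∙ y) by apply: hs; rewrite !inE eqxx.
have a1 : A ∙ (e1.1 ∙ x) = B ∙ (e1.2 ∙ y) by apply: hs; rewrite !inE eqxx ?orbT.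
have a2 : A ∙ (e2.1 ∙ x) = B ∙ (e2.2 ∙ y) by apply: hs; rewrite !inE eqxx ?orbT.
have a3 : A ∙ (e3.1 ∙ x) = B ∙ (e3.2 ∙ y) by apply: hs; rewrite !inE eqxx ?orbT.
have nc : e0.1 ∙ x != e1.1 ∙ x.
  by apply: contraNneq ns => /(gk_inj Gsub nx gs0 gs1) ->.
have nd : e0.2 ∙ y != e1.2 ∙ y.
  by apply: contraNneq nt => /(gk_inj Gsub ny gt0 gt1) ->.
case: (levi2 hA hB nc a0 a1) => [[dl hd [eB c0 c1]]|[dl hd [eA c0 c1]]].
  have c3 : e3.1 ∙ x = dl ∙ (e3.2 ∙ y) by apply: (plug_injr hA); rewrite a3 eB plugA.
  have gd : gk dl.
    apply: (overlap_gk_factor d3 gs0 gs1 gs3 hd nx _ _ _ nd (esym c0) (esym c1) (esym c3)); exact: plug_big.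
  have S e : E e -> satVV e (A, B, (x, y)) <-> e.1 ∙ x = dl ∙ (e.2 ∙ y).
    move=> Ee; rewrite /satVV /= eB plugA; split=> [/(plug_injr hA) //|-> //].
  rewrite -plugA in c0; have hd0 : hole (dl ∙ e0.2) by rewrite hole_plug.
  have gd0 : gk (dl ∙ e0.2) by apply: gk_plug.
  (* Now [x] and [y] are comparable too; cancelling the common end leaves equations between
     templates. *)
  case: (gk_levi Gsub hs0 hd0 gs0 gd0 nx ny c0) => [[r [hr gr _ er]]|[r [hr gr _ er]]].
    exists ((Var tt, r), (dl, Var tt)) => // e _ Ee <-; rewrite (S e Ee) /word_sat /= !plug_Var.
    have [g1 h1 g2 h2] := hE _ Ee; rewrite er -!plugA.
    split=> [/(gk_inj Gsub ny)|/(congr1 (fun m => m ∙ y)) //]; apply; exact: gk_plug.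
  exists ((Var tt, Var tt), (dl, r)) => // e _ Ee <-; rewrite (S e Ee) /word_sat /= !plug_Var.
  have [g1 h1 g2 h2] := hE _ Ee; rewrite er -!plugA.
  split=> [/(gk_inj Gsub nx)|/(congr1 (fun m => m ∙ x)) //]; apply=> //; apply: gk_plug => //; exact: gk_plug.
have c2 : e2.2 ∙ y = dl ∙ (e2.1 ∙ x) by apply: (plug_injr hB); rewrite -a2 eA plugA.
have gd : gk dl.
  apply: (overlap_gk_factor d2 gt0 gt1 gt2 hd ny _ _ _ nc (esym c0) (esym c1) (esym c2)); exact: plug_big.
have S e : E e -> satVV e (A, B, (x, y)) <-> dl ∙ (e.1 ∙ x) = e.2 ∙ y.
  move=> Ee; rewrite /satVV /= eA plugA; split=> [/(plug_injr hB) //|-> //].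
move/esym in c0; rewrite -plugA in c0; have hd0 : hole (dl ∙ e0.1) by rewrite hole_plug.
have gd0 : gk (dl ∙ e0.1) by apply: gk_plug.
case: (gk_levi Gsub hd0 ht0 gd0 gt0 nx ny c0) => [[r [hr gr _ er]]|[r [hr gr _ er]]].
  exists ((dl, r), (Var tt, Var tt)) => // e _ Ee <-; rewrite (S e Ee) /word_sat /= !plug_Var.
  have [g1 h1 g2 h2] := hE _ Ee; rewrite er -!plugA.
  split=> [/(gk_inj Gsub ny)|/(congr1 (fun m => m ∙ y)) //]; apply=> //; apply: gk_plug => //; exact: gk_plug.
exists ((dl, Var tt), (Var tt, r)) => // e _ Ee <-; rewrite (S e Ee) /word_sat /= !plug_Var.
have [g1 h1 g2 h2] := hE _ Ee; rewrite er -!plugA.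
split=> [/(gk_inj Gsub nx)|/(congr1 (fun m => m ∙ x)) //]; apply; exact: gk_plug.
Qed.

End Two.

(** * Equalities with a constant side *)

Section Constants.
Variables (Om : signature) (G : seq (gterm Om)).
Hypothesis Gsub : forall F ts t, App F ts \in G -> t \in ts -> t \in G.
Implicit Types (m a b v w f r s t A B : template Om) (g h x y z c d u : gterm Om).
Implicit Types (o : term Om bool).
Let gk := @gk Om G.

Definition satCC (e : gterm Om * gterm Om) (p : template Om * template Om) :=
  p.1 ∙ e.1 = p.2 ∙ e.2.
Definition solCC : set (template Om * template Om) := [set p | hole p.1 /\ hole p.2].

(** 4 = 2 + (1 + 1). Two equalities determine the difference of [A] and [B], both when [A] is the
    longer one and when [B] is; in each case every further equality has the same truth value at all
    solutions. *)
Lemma basisCC (E : set (gterm Om * gterm Om)) : basis satCC 4 E solCC.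
Proof.
case: (pselect (exists e, E e)) => [[e0 E0]|n]; last first.
  by apply: basis0 => p _ e Ee; case: n; exists e.
case: (pselect (forall e, E e -> e = e0)) => [h|]; first exact: (basis_one _ _ _ E0).
move=> /existsNP [e1] /not_implyP [E1 /eqP ne].
have U : e0.1 = e1.1 \/ e0.2 = e1.2 -> basis satCC 4 E solCC.
  move=> ee; apply: (@basis_unsat _ _ _ _ _ _ [:: e0; e1]) => // [e|[A B] [/= hA hB] h].
    by rewrite !inE => /orP [] /eqP ->.
  have a0 : A ∙ e0.1 = B ∙ e0.2 := h e0 (mem_head _ _).
  have a1 : A ∙ e1.1 = B ∙ e1.2 by apply: h; rewrite !inE eqxx orbT.
  case/negP: ne; rewrite (surjective_pairing e1) (surjective_pairing e0) xpair_eqE.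
  case: ee => ee; rewrite ee eqxx ?andbT /=; apply/eqP/esym.
    by apply: (plug_injr hB); rewrite -a0 -a1 ee.
  by apply: (plug_injr hA); rewrite a0 a1 ee.
case: (eqVneq e0.1 e1.1) => [e01|nc]; first by apply: U; left.
case: (eqVneq e0.2 e1.2) => [e01|nd]; first by apply: U; right.
apply: (@basis_cond _ _ _ 2 _ _ [:: e0; e1]).
  by move=> e; rewrite !inE => /orP [] /eqP ->.
pose P1 : set (template Om * template Om) := [set p | hole p.2 /\ exists2 dl, p.1 = p.2 ∙ dl & dl ∙ e0.1 = e0.2 /\ dl ∙ e1.1 = e1.2].
pose P2 : set (template Om * template Om) := [set p | hole p.1 /\ exists2 dl, p.2 = p.1 ∙ dl & dl ∙ e0.2 = e0.1 /\ dl ∙ e1.2 = e1.1].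
apply: (@basis_sub _ _ _ (1 + 1) _ _ (P1 `|` P2)) => // [[A B] [[/= hA hB] hs]|].
  have a0 : A ∙ e0.1 = B ∙ e0.2 := hs e0 (mem_head _ _).
  have a1 : A ∙ e1.1 = B ∙ e1.2 by apply: hs; rewrite !inE eqxx orbT.
  case: (levi2 hA hB nc a0 a1) => [[dl hd [eB c0 c1]]|[dl hd [eA c0 c1]]]; [right|left].
    by split=> //; exists dl.
  by split=> //; exists dl.
apply: basisU; apply: basis1 => // e [A B] [A' B'] Ee [/= hA [dl -> [d0 d1]]] [/= hB [dl' -> [d0' d1']]].
  have -> : dl' = dl by apply: (plug_injl2 nc); rewrite ?d0 ?d1.
  by rewrite /satCC /= !plugA => /(plug_injr hA) ->.
have -> : dl' = dl by apply: (plug_injl2 nd); rewrite ?d0 ?d1.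
by rewrite /satCC /= !plugA => /(plug_injr hA) ->.
Qed.

Definition satCV (e : gterm Om * template Om) (p : (template Om * template Om) * gterm Om) :=
  p.1.1 ∙ e.1 = p.1.2 ∙ (e.2 ∙ p.2).
Definition solCV : set ((template Om * template Om) * gterm Om) :=
  [set p | [/\ hole p.1.1, hole p.1.2 & p.2 \notin G]].
Definition eqCV : set (gterm Om * template Om) := [set e | [/\ e.1 \notin G, gk e.2 & hole e.2]].

(** Two equalities with the same constant and different templates have no common solution and form a
    basis. Otherwise each constant of [r] occurs at most once. *)
Lemma basisCG (E : set (gterm Om * template Om)) (r : seq (gterm Om)) :
  (forall e, E e -> [/\ e.1 \in r, gk e.2 & hole e.2]) -> basis satCV (size r + 2) E solCV.
Proof.
move=> hE.
case: (pselect (exists e0 e1, [/\ E e0, E e1, e0.1 = e1.1 & e0.2 <> e1.2])) => [|nf].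
  case=> e0 [e1 [E0 E1 ee ne]].
  apply: (@basis_unsat _ _ _ _ _ _ [:: e0; e1]) => // [e||[[A B] y] [/= hA hB ny] h].
  - by rewrite !inE => /orP [] /eqP ->.
  - by rewrite /= leq_addl.
  have a0 : A ∙ e0.1 = B ∙ (e0.2 ∙ y) := h e0 (mem_head _ _).
  have a1 : A ∙ e1.1 = B ∙ (e1.2 ∙ y) by apply: h; rewrite !inE eqxx orbT.
  have [_ g0 _] := hE _ E0; have [_ g1 _] := hE _ E1.
  by apply: ne; apply/(gk_inj Gsub ny g0 g1)/(plug_injr hB); rewrite -a0 -a1 ee.
have [s [h1 h2 h3]] : exists s : seq (gterm Om * template Om), [/\ forall e, e \in s -> E e, size s <= size r & forall e, E e -> e \in s].
  have {hE} : forall e, E e -> e.1 \in r by move=> e /hE [].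
  elim: r E nf => [|c r IH] E nf hE; first by exists [::]; split=> // e /hE.
  have [|e /= [Ee ne]|s [h1 h2 h3]] := IH [set e | E e /\ e.1 != c].
  - by move=> [e0 [e1 [[E0 _] [E1 _] ee n]]]; apply: nf; exists e0, e1.
  - by have := hE e Ee; rewrite inE (negbTE ne).
  case: (pselect (exists2 e, E e & e.1 = c)) => [[e Ee ec]|n].
    exists (e :: s); split=> // [e'|e' Ee'].
      by rewrite inE => /predU1P [-> //|/h1 []].
    rewrite inE; case: (eqVneq e'.1 c) => [ec'|nc]; last by rewrite h3 ?orbT.
    suff -> : e' = e by rewrite eqxx.
    rewrite (surjective_pairing e') (surjective_pairing e) ec ec'; congr (_, _).
    by apply: contrapT => ne; apply: nf; exists e', e; rewrite ec ec'.
  exists s; split=> // [e /h1 [] //||e Ee]; first exact: leq_trans h2 _.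
  by apply: h3; split=> //; apply/eqP => ec; apply: n; exists e.
by exists s; split=> // [|p _ hs e /h3 /hs //]; apply: leq_trans h2 (leq_addr _ _).
Qed.

(** The end of a big term after splitting off as much of [gk] as possible: in [c = n ∙ u] the
    template [n] acts as a word and [u] as its end marker. *)
Definition primary u := u \notin G /\
  forall r z, gk r -> hole r -> z \notin G -> u = r ∙ z -> r = Var tt.

Lemma primary_ex c : c \notin G -> exists n u, [/\ gk n, hole n, primary u & c = n ∙ u].
Proof.
have [N] := ubnP (tsize c); elim: N c => // N IH c; rewrite ltnS => le nc.
case: (pselect (primary c)) => [pc|]; first by exists (Var tt), c.
move=> /not_andP [//|] /existsNP [r] /existsNP [z].
move=> /not_implyP [gr] /not_implyP [hr] /not_implyP [nz] /not_implyP [ec /eqP nr].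
have [|n [u [gn hn pu ez]]] := IH z _ nz.
  by apply: leq_trans le; rewrite ec; apply: tsize_plug_lt.
exists (r ∙ n), u; split=> //; [exact: gk_plug|by rewrite hole_plug|by rewrite plugA -ez].
Qed.

Lemma primary_uniq n n' u u' : gk n -> gk n' -> hole n -> hole n' -> primary u -> primary u' ->
  n ∙ u = n' ∙ u' -> u = u'.
Proof.
move=> gn gn' hn hn' [nu pu] [nu' pu'] e.
case: (gk_levi Gsub hn hn' gn gn' nu nu' e) => [[r [hr gr _ er]]|[r [hr gr _ er]]].
  by rewrite er (pu r u').
by rewrite er (pu' r u).
Qed.

(** The primary end of [y] is also that of [t ∙ y], hence it is [u]. *)
Lemma primary_right t y n u : gk t -> hole t -> y \notin G -> gk n -> hole n -> primary u ->
  t ∙ y = n ∙ u -> exists q, [/\ gk q, hole q & y = q ∙ u].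
Proof.
move=> gt ht ny gn hn pu e; have [q [u' [gq hq pu' ey]]] := primary_ex ny.
exists q; split=> //; rewrite ey; congr (_ ∙ _).
apply: (@primary_uniq (t ∙ q) n) => //; first exact: gk_plug; first by rewrite hole_plug.
by rewrite plugA -ey.
Qed.

Lemma basisCV_strip k (E : set (gterm Om * template Om)) o : E `<=` eqCV -> nontriv G o ->
  (forall e, E e -> divides G o e.2) ->
  basis satCV k [set e | E (e.1, inst o e.2 (Var tt)) /\ eqCV e] solCV -> basis satCV k E solCV.
Proof.
move=> hE [go io no] hd; apply: (basis_rel (R := fun e e' => e = (e'.1, inst o e'.2 (Var tt)))).
- move=> [s t] Ee; have [t' [gt ht /= et]] := hd _ Ee; rewrite et in Ee *.
  by exists (s, t') => //; split=> //; have [/= ? _ _] := hE _ Ee.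
- by move=> [s t] [Ee _]; exists (s, inst o t (Var tt)).
move=> [[A B] y] [/= hA hB ny].
exists ((A, B ∙ inst o (Var tt) (of_ground unit y)), y).
  by split=> //=; rewrite hole_plug //; apply: hole_inst_true.
by move=> e [s t] _ _ ->; rewrite /satCV /= inst_plug !plugA inst_plug plug_ground of_ground_void.
Qed.

(** 19 = 3 + (8 + 8): three equalities as in [basisVV], then one part for [A] extending [B] and one
    for the converse. In each part either a single equality refutes all solutions, or seven word
    equations suffice. *)
Lemma basisCV (E : set (gterm Om * template Om)) : E `<=` eqCV -> basis satCV 19 E solCV.
Proof.
move=> hE; case: (pselect (exists e, E e)) => [[e0 E0]|n]; last first.
  by apply: basis0 => p _ e Ee; case: n; exists e.
have [N] := ubnP (tsize e0.2); elim: N E hE e0 E0 => // N IH E hE e0 E0; rewrite ltnS => le.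
case: (pselect (exists2 o, nontriv G o & forall e, E e -> divides G o e.2)) => [[o no hd]|nd2].
  apply: (basisCV_strip hE no hd); have [t' [gt ht et]] := hd _ E0.
  have [nc gt0 ht0] := hE _ E0.
  apply: (IH _ _ (e0.1, t')) => [e [] //||].
    by split=> //=; rewrite -et -surjective_pairing.
  by apply: leq_trans le; rewrite [in X in _ < X]et; apply: tsize_divides no.
case: (pselect (forall e, E e -> e = e0)) => [h|].
  exact: (basis_one _ _ _ E0).
move=> /existsNP [e1] /not_implyP [E1 /eqP ne].
have [nc0 gt0 ht0] := hE _ E0; have [nc1 gt1 ht1] := hE _ E1.
have U : e0.1 = e1.1 \/ e0.2 = e1.2 -> basis satCV 19 E solCV.
  move=> ee; apply: (@basis_unsat _ _ _ _ _ _ [:: e0; e1]) => // [e|[[A B] y] [/= hA hB ny] h].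
    by rewrite !inE => /orP [] /eqP ->.
  have a0 : A ∙ e0.1 = B ∙ (e0.2 ∙ y) := h e0 (mem_head _ _).
  have a1 : A ∙ e1.1 = B ∙ (e1.2 ∙ y) by apply: h; rewrite !inE eqxx orbT.
  case/negP: ne; rewrite (surjective_pairing e1) (surjective_pairing e0) xpair_eqE.
  case: ee => ee; rewrite ee eqxx ?andbT /=; apply/eqP/esym.
    by apply/(gk_inj Gsub ny gt0 gt1)/(plug_injr hB); rewrite -a0 -a1 ee.
  by apply: (plug_injr hA); rewrite a0 a1 ee.
case: (eqVneq e0.1 e1.1) => [e01|nc]; first by apply: U; left.
case: (eqVneq e0.2 e1.2) => [e01|nt]; first by apply: U; right.
have [_ [e2 E2 <-] d2] : exists2 t3, [set e.2 | e in E] t3 &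
    forall o, nontriv G o -> divides G o e0.2 -> divides G o e1.2 -> ~ divides G o t3.
  apply: (third_factor Gsub nc0) nt _; try by [exists e0|exists e1].
    by move=> _ [e /hE [? ? ?] <-].
  move=> o no; apply: contrapT => n; apply: nd2; exists o => // e Ee.
  by apply: contrapT => nd; apply: n; exists e.2 => //; exists e.
have [nc2 gt2 ht2] := hE _ E2.
apply: (@basis_cond _ _ _ 16 _ _ [:: e0; e1; e2]).
  by move=> e; rewrite !inE => /or3P [] /eqP ->.
pose P1 : set ((template Om * template Om) * gterm Om) := [set p | solCV p /\
  exists dl, [/\ hole dl, gk dl, p.1.1 = p.1.2 ∙ dl & dl ∙ e0.1 = e0.2 ∙ p.2]].
pose Q2 (p : (template Om * template Om) * gterm Om) (dl : template Om) := [/\ solCV p, hole dl, p.1.2 = p.1.1 ∙ dl &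
  [/\ dl ∙ (e0.2 ∙ p.2) = e0.1, dl ∙ (e1.2 ∙ p.2) = e1.1 & dl ∙ (e2.2 ∙ p.2) = e2.1]].
apply: (@basis_sub _ _ _ (8 + 8) _ _ (P1 `|` [set p | exists dl, Q2 p dl])) => // [[[A B] y] [[/= hA hB ny] hs]|].
  have a0 : A ∙ e0.1 = B ∙ (e0.2 ∙ y) by apply: hs; rewrite !inE eqxx.
  have a1 : A ∙ e1.1 = B ∙ (e1.2 ∙ y) by apply: hs; rewrite !inE eqxx ?orbT.
  have a2 : A ∙ e2.1 = B ∙ (e2.2 ∙ y) by apply: hs; rewrite !inE eqxx ?orbT.
  case: (levi2 hA hB nc a0 a1) => [[dl hd [eB c0 c1]]|[dl hd [eA c0 c1]]]; [right|left].
    exists dl; split=> //; split=> //=; apply: (plug_injr hA); by rewrite a2 eB plugA.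
  have c2 : e2.2 ∙ y = dl ∙ e2.1 by apply: (plug_injr hB); rewrite -a2 eA plugA.
  split=> //; exists dl; split=> //.
  exact: (overlap_gk_factor Gsub d2 gt0 gt1 gt2 hd ny nc0 nc1 nc2 nc (esym c0) (esym c1) (esym c2)).
apply: basisU.
  (* Here [dl] has its ground subterms in G, so the constant of [e0] fixes the primary end of [y],
     and all other constants must share it. *)
  have [n0 [u [gn0 hn0 pu ec0]]] := primary_ex nc0; have [nu _] := pu.
  have Y p : P1 p -> exists q, [/\ gk q, hole q & p.2 = q ∙ u].
    move=> [[hA hB ny] [dl [hd gd _ e]]].
    apply: (@primary_right e0.2 _ (dl ∙ n0)) => //; [exact: gk_plug|by rewrite hole_plug|].
    by rewrite -e ec0 plugA.
  case: (pselect (exists2 e, E e & ~ exists n, [/\ gk n, hole n & e.1 = n ∙ u])) => [[e Ee nb]|hn].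
    apply: (@basis_unsat _ _ _ _ _ _ [:: e]) => // [e'|p Pp h]; first by rewrite inE => /eqP ->.
    have [q [gq hq ey]] := Y p Pp; have [[hA hB ny] [dl [hd gd eA _]]] := Pp.
    have a : p.1.1 ∙ e.1 = p.1.2 ∙ (e.2 ∙ p.2) := h e (mem_head _ _).
    have [nc' gt ht] := hE _ Ee; have [n [u' [gn hnn pu' ec]]] := primary_ex nc'.
    apply: nb; exists n; split=> //; rewrite ec; congr (_ ∙ _).
    apply: (@primary_uniq (dl ∙ n) (e.2 ∙ q)); rewrite ?hole_plug //; try exact: gk_plug.
    by rewrite !plugA -ec -ey; apply: (plug_injr hB); rewrite -a eA plugA.
  apply: (@basis_words _ _ _ _ _ _ (fun e e' => [/\ e'.2 = e.2, gk e'.1 & e.1 = e'.1 ∙ u])) => // [e Ee|p Pp].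
    have [nc' gt ht] := hE _ Ee.
    have [n [gn hnn ec]] : exists n, [/\ gk n, hole n & e.1 = n ∙ u].
      by apply: contrapT => nb; apply: hn; exists e.
    by exists (n, e.2).
  have [q [gq hq ey]] := Y p Pp; have [[hA hB ny] [dl [hd gd eA _]]] := Pp.
  exists ((dl, Var tt), (Var tt, q)) => // e [n t] Ee [/= -> gn ec].
  have [nc' gt ht] := hE _ Ee; rewrite /satCV /word_sat /= plug_Var.
  have -> : Var tt ∙ e.2 ∙ q = e.2 ∙ q by [].
  rewrite eA plugA ec ey -[dl ∙ (n ∙ u)]plugA -[e.2 ∙ (q ∙ u)]plugA.
  split=> [/(plug_injr hB)|-> //].
  apply: (gk_inj Gsub nu); apply: gk_plug => //.
  by apply: (@plug_big_hole _ G Gsub _ u) => //; rewrite -ec.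
(* Here [dl] is applied to the side of [y] and its value is a given constant, so it may contain
   anything. A smallest one, [dl0], is a prefix of all others, and [overlap_gk_factor] applies to
   the quotients. *)
case: (pselect (exists p dl, Q2 p dl)) => [[p0 [dl0 q0]]|nq]; last first.
  by apply: basis0 => p [dl q]; case: nq; exists p, dl.
have {p0 dl0 q0} [p0 [dl0 [q0 qmin]]] : exists p0 dl0, Q2 p0 dl0 /\ forall p dl, Q2 p dl -> tsize dl0 <= tsize dl.
  have [M] := ubnP (tsize dl0); elim: M p0 dl0 q0 => // M IHM p0 dl0 q0; rewrite ltnS => leM.
  case: (pselect (exists p dl, Q2 p dl /\ tsize dl < tsize dl0)) => [[p [dl [q lt]]]|n'].
    by apply: (IHM p dl q); apply: leq_trans leM.
  exists p0, dl0; split=> // p dl q; rewrite leqNgt; apply/negP => lt.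
  by apply: n'; exists p, dl.
have [[_ _ ny0] hd0 _ [f0 f1 f2]] := q0.
have [n0 [u [gn0 hn0 pu ez0]]] := primary_ex (plug_big Gsub ht0 ny0); have [nu _] := pu.
have Y p : (exists dl, Q2 p dl) -> exists r q, [/\ hole p.1.1, gk r && hole r, gk q && hole q, p.1.2 = p.1.1 ∙ (dl0 ∙ r) & p.2 = q ∙ u].
  move=> [dl [[hA hB ny] hd eB [g0 g1 g2]]].
  have nd : e0.2 ∙ p.2 != e1.2 ∙ p.2.
    by apply: contraNneq nt => /(gk_inj Gsub ny gt0 gt1) ->.
  have X r : hole r -> dl = dl0 ∙ r -> exists r q, [/\ hole p.1.1, gk r && hole r, gk q && hole q, p.1.2 = p.1.1 ∙ (dl0 ∙ r) & p.2 = q ∙ u].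
    move=> hr er.
    have k0 : r ∙ (e0.2 ∙ p.2) = e0.2 ∙ p0.2 by apply: (plug_injr hd0); rewrite -plugA -er g0 f0.
    have k1 : r ∙ (e1.2 ∙ p.2) = e1.2 ∙ p0.2 by apply: (plug_injr hd0); rewrite -plugA -er g1 f1.
    have k2 : r ∙ (e2.2 ∙ p.2) = e2.2 ∙ p0.2 by apply: (plug_injr hd0); rewrite -plugA -er g2 f2.
    have gr : gk r.
      apply: (overlap_gk_factor Gsub d2 gt0 gt1 gt2 hr ny0 _ _ _ nd k0 k1 k2); exact: plug_big.
    have [|||q [gq hq ey]] := @primary_right (r ∙ e0.2) p.2 n0 u _ _ ny gn0 hn0 pu.
    - exact: gk_plug.
    - by rewrite hole_plug.
    - by rewrite plugA k0.
    by exists r, q; rewrite gr gq hr hq eB er.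
  case: (levi2 hd hd0 nd (etrans g0 (esym f0)) (etrans g1 (esym f1))) => [[r hr [er _ _]]|[r hr [er _ _]]]; last exact: X er.
  case: (eqVneq r (Var tt)) => [rV|nr].
    by apply: (X (Var tt)) => //; rewrite er rV !plug_Var.
  have := qmin p dl; rewrite er leqNgt; case/(_ _)/negP; first by split.
  apply: (@ltn_tsize_subst _ _ _ _ _ tt); last first.
    by case: (r) nr hr => [[]|F ts] // _; apply: tsize_hole_gt1.
  by move: hd; rewrite hole_vars; case: (vars dl) => [|[] ?] //; rewrite inE.
case: (pselect (exists2 e, E e & ~ exists n, [/\ gk n, hole n & e.1 = dl0 ∙ (n ∙ u)])) => [[e Ee nb]|hn].
  apply: (@basis_unsat _ _ _ _ _ _ [:: e]) => // [e'|p Pp h]; first by rewrite inE => /eqP ->.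
  have [r [q [hA /andP [gr hr] /andP [gq hq] eB ey]]] := Y p Pp; have [nc' gt ht] := hE _ Ee.
  have a : p.1.1 ∙ e.1 = p.1.2 ∙ (e.2 ∙ p.2) := h e (mem_head _ _).
  apply: nb; exists (r ∙ (e.2 ∙ q)); split; rewrite ?hole_plug //.
    by apply: gk_plug => //; [apply: gk_plug|rewrite hole_plug].
  by apply: (plug_injr hA); rewrite a eB ey !plugA.
apply: (@basis_words _ _ _ _ _ _ (fun e e' => [/\ e'.2 = e.2, gk e'.1 & e.1 = dl0 ∙ (e'.1 ∙ u)])) => // [e Ee|p Pp].
  have [nc' gt ht] := hE _ Ee.
  have [n [gn hnn ec]] : exists n, [/\ gk n, hole n & e.1 = dl0 ∙ (n ∙ u)].
    by apply: contrapT => nb; apply: hn; exists e.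
  by exists (n, e.2).
have [r [q [hA /andP [gr hr] /andP [gq hq] eB ey]]] := Y p Pp.
exists ((Var tt, Var tt), (r, q)) => // e [n t] Ee [/= -> gn ec].
have [nc' gt ht] := hE _ Ee; rewrite /satCV /word_sat /= plug_Var.
have -> : Var tt ∙ n = n by [].
have X : gk (r ∙ e.2 ∙ q) by apply: gk_plug => //; apply: gk_plug.
rewrite eB ec ey plugA plugA -[e.2 ∙ (q ∙ u)]plugA -[r ∙ (e.2 ∙ q ∙ u)]plugA -[r ∙ (e.2 ∙ q)]plugA.
split=> [/(plug_injr hA)/(plug_injr hd0)|-> //].
exact: (gk_inj Gsub nu).
Qed.

End Constants.

(** * Compactness *)

Section SmallTerms.
Variables (Om : signature) (n : nat) (P : program Om n).
Implicit Types (m s t : template Om) (g c d : gterm Om).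
Implicit Types (e : equality Om n) (a : assignment Om n).

Lemma subterms_self (V : eqType) (t : term Om V) : t \in subterms t.
Proof. by case: t => *; rewrite inE eqxx. Qed.

Lemma subterms_child (V : eqType) (t : term Om V) F ts u :
  App F ts \in subterms t -> u \in ts -> u \in subterms t.
Proof.
elim/term_ind2: t => [v|f us IH]; first by rewrite inE.
rewrite [subterms _]/= !inE => /orP [/eqP [_ <-] iu|/flattenP [_ /mapP [w iw ->] i] iu].
  apply/orP; right; apply/flattenP; exists (subterms u); last exact: subterms_self.
  exact: map_f.
apply/orP; right; apply/flattenP; exists (subterms w); first exact: map_f.
exact: IH iu.
Qed.

Lemma setG_sub F ts u : App F ts \in setG P -> u \in ts -> u \in setG P.
Proof.
move=> /flattenP [_ /mapP [t it ->]]; rewrite /ground_subterms mem_pmap => /mapP [w iw ew] iu.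
apply/flattenP; exists (ground_subterms t); first exact: map_f.
rewrite mem_pmap; apply/mapP; exists (of_ground _ u); last by rewrite of_groundK.
have ew' := to_groundK (esym ew); rewrite ew' in iw.
exact: subterms_child iw (map_f _ iu).
Qed.

Lemma setMGE m : setMG P m <-> [/\ wf m, hole m & gk (setG P) m].
Proof.
rewrite /setMG /is_template /mkset -hole_vars; split=> [/andP [/andP [w h] g]|[w h g]] //.
by rewrite w h.
Qed.

Lemma mem_setS g : (g \in setS P) = (g \in setG P) || (g \in setR P).
Proof. by rewrite mem_undup mem_cat. Qed.

Lemma setL_big g : setL P g -> g \notin setG P.
Proof. by case=> _; rewrite mem_setS => /norP []. Qed.

Lemma size_undupG : size (undup (setG P)) <= size (setS P).
Proof.
apply: uniq_leq_size; first exact: undup_uniq.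
by move=> g; rewrite mem_undup mem_setS => ->.
Qed.

Lemma subst_plug (V W : eqType) (r : V -> term Om W) m (u : term Om V) :
  subst r (m ∙ u) = m ∙ subst r u.
Proof. by rewrite /plug subst_comp. Qed.

Lemma subst_ground (V : eqType) (r : V -> gterm Om) g : subst r (of_ground V g) = g.
Proof. by rewrite subst_of_ground of_ground_void. Qed.

(** A small substitution followed by an assignment into L takes its values in T and S. *)
Lemma approx_subsumesI (E E' : set (equality Om n)) :
  (forall F a, is_template (valA a) -> is_template (valB a) ->
     (forall x, setT_ P (valX a x) \/ valX a x \in setS P) ->
     sat_all a (E `&` of_format P F) -> sat_all a (E' `&` of_format P F)) ->
  approx_subsumes P E E'.
Proof.
move=> H s F hs a [hA hB hX]; split=> [h|h e Ee]; last by apply: h; left.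
pose b := Assignment (valA a) (valB a) (fun x => subst (valX a) (s x)).
have sb e : sat b e <-> sat a (subst_eq s e) by rewrite /sat /= !subst_comp.
move=> e [/h //|[e0 [E0 F0] <-]]; apply/sb.
apply: (H F b) => //= [x|e1 [E1 F1]].
  by case: (hs x) => [->|[g ig ->]]; [left; case: (hX x)|right; rewrite subst_ground].
by apply/sb; apply: h; exists e1.
Qed.

Let satA e a := sat a e.
Let hol : set (assignment Om n) := [set a | hole (valA a) /\ hole (valB a)].
Let gk := @gk Om (setG P).

Lemma basis_sideCC (E : set (equality Om n)) Phi : Phi `<=` hol ->
  (forall e, E e -> exists c d, forall a, Phi a -> subst (valX a) e.1 = c /\ subst (valX a) e.2 = d) ->
  basis satA 4 E Phi.
Proof.
move=> hP hE.
pose R e (e' : gterm Om * gterm Om) := forall a, Phi a -> subst (valX a) e.1 = e'.1 /\ subst (valX a) e.2 = e'.2.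
apply: (basis_rel (R := R) (sat' := @satCC Om) (E' := [set e' | exists2 e, E e & R e e']) (Phi' := @solCC Om)).
- by move=> e Ee; have [c [d h]] := hE e Ee; exists (c, d) => //; exists e.
- by move=> e' [e Ee r]; exists e.
- move=> a Pa; exists (valA a, valB a); first exact: hP Pa.
  by move=> e e' _ _ r; have [e1 e2] := r a Pa; rewrite /satA /sat e1 e2.
exact: basisCC.
Qed.

(** [basisCV] handles the big constants, [basisCG] those in the list [r]. *)
Lemma basis_sideCV (E : set (equality Om n)) Phi y (r : seq (gterm Om)) : Phi `<=` hol ->
  (forall a, Phi a -> valX a y \notin setG P) ->
  (forall e, E e -> exists c t, [/\ forall a, Phi a -> subst (valX a) e.1 = c,
     e.2 = t ∙ Var y, gk t, hole t & c \in r \/ c \notin setG P]) ->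
  basis satA (19 + (size r + 2)) E Phi.
Proof.
move=> hP hy hE.
pose R e (e' : gterm Om * template Om) := [/\ forall a, Phi a -> subst (valX a) e.1 = e'.1,
  e.2 = e'.2 ∙ Var y, gk e'.2 & hole e'.2].
pose Q (T : set (gterm Om)) := [set e | E e /\ exists2 e', R e e' & T e'.1].
have X k (T : set (gterm Om)) :
    basis (@satCV Om) k [set e' | T e'.1 /\ exists2 e, E e & R e e'] (solCV (setG P)) ->
    basis satA k (Q T) Phi.
  apply: (basis_rel (R := R)).
  - by move=> e [Ee [e' r' Te]]; exists e' => //; split=> //; exists e.
  - by move=> e' [Te [e Ee r']]; exists e => //; split=> //; exists e'.
  move=> a Pa; exists ((valA a, valB a), valX a y).
    by have [h1 h2] := hP a Pa; split=> //=; apply: hy.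
  by move=> e e' _ _ [/(_ a Pa) e1 e2 _ _]; rewrite /satA /sat e1 e2 subst_plug.
have -> : E = Q [set c | c \notin setG P] `|` Q [set c | c \in r].
  apply/seteqP; split=> [e Ee|e [[] //|[] //]].
  have [c [t [h1 h2 h3 h4 [h5|h5]]]] := hE e Ee; [right|left]; split=> //; by exists (c, t).
apply: basisUl; apply: X.
  by apply: (basisCV setG_sub) => e' [ne [e _ [_ _ g h]]].
by apply: (basisCG setG_sub) => e' [ne [e _ [_ _ g h]]].
Qed.

Lemma basis_swap k (E : set (equality Om n)) Phi :
  basis satA k [set e | E (e.2, e.1)] [set a | Phi (Assignment (valB a) (valA a) (valX a))] ->
  basis satA k E Phi.
Proof.
apply: (basis_rel (R := fun e e' => e' = (e.2, e.1))).
- by move=> [s t] Ee; exists (t, s).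
- by move=> [s t] Ee; exists (t, s).
move=> [A B X] Pa; exists (Assignment B A X) => // e _ _ _ ->.
by rewrite /satA /sat /=; split=> ->.
Qed.

Let M := size (undup (setG P)).

(** If [y] is not big, its value is one of the [M] elements of G; both sides are then constants, at
    4 equalities for each value. *)
Lemma basis_half k (E : set (equality Om n)) y : k >= 19 + (M + 2) ->
  (forall e, E e -> exists c t, [/\ e.1 = of_ground _ c, e.2 = t ∙ Var y, gk t & hole t]) ->
  forall r, size r <= M ->
  (forall e c, E e -> e.1 = of_ground _ c -> c \in r \/ c \notin setG P) ->
  basis satA (k + M * 4) E hol.
Proof.
move=> lk hE r sr hr.
pose P1 : set (assignment Om n) := [set a | hol a /\ valX a y \notin setG P].
pose P2 : set (assignment Om n) :=
  [set a | exists2 g, g \in undup (setG P) & hol a /\ valX a y = g].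
apply: (@basis_sub _ _ _ _ _ _ (P1 `|` P2) _ (leqnn _)) => [a ha|].
  case i: (valX a y \in setG P); last by left; split=> //; rewrite i.
  by right; exists (valX a y); rewrite ?mem_undup.
apply: basisU.
  apply: (@basis_sub _ _ _ (19 + (size r + 2)) _ _ P1) => //; first by lia.
  apply: (@basis_sideCV _ _ y) => [a []//|a [] //|e Ee].
  have [c [t [e1 e2 gt ht]]] := hE e Ee; exists c, t; split=> //; last exact: hr e1.
  by move=> a _; rewrite e1 subst_ground.
apply: basis_bigcup => g _; apply: basis_sideCC => [a [] //|e Ee].
have [c [t [e1 e2 gt ht]]] := hE e Ee; exists c, (t ∙ g) => a [_ ey].
by rewrite e1 e2 subst_ground subst_plug /= ey.
Qed.

Lemma basis_gn (E : set (equality Om n)) x y :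
  (forall e, E e -> exists s t, [/\ e.1 = s ∙ Var x, e.2 = t ∙ Var y, gk t & hole t]) ->
  basis satA (M * (19 + (M + 2))) E [set a | exists2 g, g \in undup (setG P) &
    [/\ hol a, valX a x = g & valX a y \notin setG P]].
Proof.
move=> hE; apply: basis_bigcup => g _; apply: (@basis_sideCV _ _ y) => [a []//|a [] //|e Ee].
have [s [t [e1 e2 gt ht]]] := hE e Ee; exists (s ∙ g), t; split=> //.
  by move=> a [_ ex _]; rewrite e1 subst_plug /= ex.
by rewrite mem_undup; case: (_ \in _); [left|right].
Qed.

(** Each of [x] and [y] is big or takes one of [M] values. The case of two values in G contributes
    [M * (M * 4)]; the mixed cases are quadratic as well, since a constant side may take all values
    in G. *)
Lemma basis_FVV (E : set (equality Om n)) x y : E `<=` of_format P (FVV Om x y) ->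
  basis satA (11 + (M * (19 + (M + 2)) + (M * (19 + (M + 2)) + M * (M * 4)))) E hol.
Proof.
move=> hE; pose nG a z := valX a z \notin setG P; pose U := undup (setG P).
pose Pnn : set (assignment Om n) := [set a | [/\ hol a, nG a x & nG a y]].
pose Pgn : set (assignment Om n) := [set a | exists2 g, g \in U & [/\ hol a, valX a x = g & nG a y]].
pose Png : set (assignment Om n) := [set a | exists2 g, g \in U & [/\ hol a, valX a y = g & nG a x]].
pose Pgg : set (assignment Om n) := [set a | exists2 g, g \in U & exists2 h, h \in U &
  [/\ hol a, valX a x = g & valX a y = h]].
apply: (@basis_sub _ _ _ _ _ _ (Pnn `|` (Pgn `|` (Png `|` Pgg))) _ (leqnn _)) => [a ha|].
  case ix: (valX a x \in setG P); case iy: (valX a y \in setG P).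
  - right; right; right; exists (valX a x); first by rewrite mem_undup.
    by exists (valX a y); rewrite ?mem_undup.
  - by right; left; exists (valX a x); rewrite ?mem_undup // /nG iy.
  - by right; right; left; exists (valX a y); rewrite ?mem_undup // /nG ix.
  - by left; rewrite /Pnn /nG /= ix iy.
have F e : E e -> exists s t, [/\ e = (s ∙ Var x, t ∙ Var y), gk s, hole s, gk t & hole t].
  by move/hE => [s [t [/setMGE [_ ? ?] /setMGE [_ ? ?] ->]]]; exists s, t.
do 3?apply: basisU.
- apply: (basis_rel (R := fun (e : equality Om n) (e' : template Om * template Om) => e = (e'.1 ∙ Var x, e'.2 ∙ Var y)) (sat' := @satVV Om)
    (E' := [set e' | eqVV (setG P) e' /\ E (e'.1 ∙ Var x, e'.2 ∙ Var y)]) (Phi' := @solVV Om (setG P))).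
  + by move=> e Ee; have [s [t [ee ? ? ? ?]]] := F e Ee; exists (s, t) => //; split=> //=; rewrite -ee.
  + by move=> e' [_ Ee]; exists (e'.1 ∙ Var x, e'.2 ∙ Var y).
  + move=> a [[hA hB] nx ny]; exists ((valA a, valB a), (valX a x, valX a y)) => // e e' _ _ ->.
    by rewrite /satA /sat /= !subst_plug.
  by apply: (basisVV setG_sub) => e' [].
- by apply: basis_gn => e /F [s [t [-> ? ? ? ?]]]; exists s, t.
- apply: basis_swap; apply: (@basis_sub _ _ _ _ _ _ [set a | exists2 g, g \in undup (setG P) &
    [/\ hol a, valX a y = g & valX a x \notin setG P]] _ (leqnn _)).
    by move=> a [g ig [[? ?] ? ?]]; exists g.
  by apply: basis_gn => e /F [s [t [[e2 e1] ? ? ? ?]]]; exists t, s; rewrite e1 e2.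
apply: basis_bigcup => g _; apply: basis_bigcup => h _; apply: basis_sideCC => [a []//|e /F [s [t [-> _ _ _ _]]]].
by exists (s ∙ g), (t ∙ h) => a [_ ex ey]; rewrite !subst_plug /= ex ey.
Qed.

Lemma basis_FLV (E : set (equality Om n)) x : E `<=` of_format P (FLV Om x) ->
  basis satA (19 + (M + 2) + M * 4) E hol.
Proof.
move=> hE; apply: (@basis_half _ _ x _ _ [::]) => // [e /hE [s [t [_ /setMGE [_ ? ?] ->]]]|e c /hE].
  by exists s, t.
by move=> [s [t [Ls _ ->]]] /= /of_ground_inj <-; right; apply: setL_big.
Qed.

Lemma basis_FSV (E : set (equality Om n)) g x : E `<=` of_format P (FSV g x) ->
  basis satA (19 + (M + 2) + M * 4) E hol.
Proof.
(* At most one constant; it is obtained by filtering G so that the length stays within [M] even if G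
   is empty. *)
move=> hE; pose r := [seq c <- undup (setG P) | c == g].
apply: (@basis_half _ _ x _ _ r) => // [e /hE [t [_ /setMGE [_ ? ?] ->]]||e c /hE].
- by exists g, t.
- by rewrite size_filter; apply: count_size.
move=> [t [_ _ ->]] /= /of_ground_inj <-; case i: (g \in setG P); last by right.
by left; rewrite mem_filter eqxx mem_undup.
Qed.

Lemma basis_FVL (E : set (equality Om n)) x : E `<=` of_format P (FVL Om x) ->
  basis satA (19 + (M + 2) + M * 4) E hol.
Proof.
move=> hE; apply: basis_swap; apply: (@basis_sub _ _ _ _ _ _ hol _ (leqnn _)); first by move=> a [].
apply: (@basis_FLV _ x) => e /hE [t [s [? ? [e2 e1]]]]; exists s, t; split=> //.
by rewrite -e1 -e2 -surjective_pairing.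
Qed.

Lemma basis_FVS (E : set (equality Om n)) g x : E `<=` of_format P (FVS x g) ->
  basis satA (19 + (M + 2) + M * 4) E hol.
Proof.
move=> hE; apply: basis_swap; apply: (@basis_sub _ _ _ _ _ _ hol _ (leqnn _)); first by move=> a [].
apply: (@basis_FSV _ g x) => e /hE [t [? ? [e2 e1]]]; exists t; split=> //.
by rewrite -e1 -e2 -surjective_pairing.
Qed.

(** One basis for each format: approximate subsumption compares the formats one at a time. *)
Lemma cover (I : eqType) (r : seq I) (F : I -> format Om n) k (E : set (equality Om n)) :
  (forall i, basis satA k (E `&` of_format P (F i)) hol) ->
  exists s : seq (equality Om n), [/\ forall e, e \in s -> E e, size s <= size r * k &
    forall i a, i \in r -> hol a -> sat_all a ([set` s] `&` of_format P (F i)) ->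
    sat_all a (E `&` of_format P (F i))].
Proof.
move=> hb; elim: r => [|i r [s [h1 h2 h3]]]; first by exists [::].
have [s' [k1 k2 k3]] := hb i; exists (s' ++ s); split.
- by move=> e; rewrite mem_cat => /orP [/k1 []|/h1].
- by rewrite size_cat mulSn leq_add.
move=> j a; rewrite inE => ij ha hs.
case/predU1P: ij hs => [->|ij] hs.
  by apply: k3 => // e ie; apply: hs; split; [rewrite /= mem_cat ie|have [] := k1 e ie].
apply: h3 ij ha _ => e [ie Fe].
by apply: hs; split=> //=; rewrite /= mem_cat; apply/orP; right.
Qed.
End SmallTerms.

Lemma approx_compactness (Om : signature) (n : nat) (P : program Om n) (E : set (equality Om n)) :
  E `<=` two_variable P -> satisfiable (setT_ P) E ->
  exists E0 : seq (equality Om n), [/\ [set` E0] `<=` E,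
    size E0 <= 200 * (n ^ 2 * size (setS P) ^ 2) & approx_subsumes P [set` E0] E].
Proof.
move=> hE [a0 [_ _ hX0] _].
(* If S is empty then so is R, and a variable could have no value in T. Every format mentions a
   variable, so nothing is left to imply. *)
case: (posnP (size (setS P))) => [S0|Sp].
  exists [::]; split=> //; apply: approx_subsumesI => F a _ _ _ _ e [/hE [F' _] _].
  have X (x : 'I_n) : False.
    have [m [r [_ ir _]]] := hX0 x; have : r \in setS P by rewrite mem_setS ir orbT.
    by case: (setS P) S0.
  by case: F => [x y|x|g x|x|x g]; case: (X x).
case: (posnP n) => [n0|np].
  exists [::]; split=> //; apply: approx_subsumesI => F a _ _ _ _ e _.
  have X (x : 'I_n) : False by case: (x) => i; rewrite n0.
  by case: F => [x y|x|g x|x|x g]; case: (X x).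
have le := size_undupG P; set M := size (undup (setG P)) in le; set m := size (setS P) in le Sp *.
pose k1 := 11 + (M * (19 + (M + 2)) + (M * (19 + (M + 2)) + M * (M * 4))).
pose k2 := 19 + (M + 2) + M * 4.
have sub (Q : set (equality Om n)) : E `&` Q `<=` Q by move=> e [].
have [s1 [a1 b1 c1]] := @cover _ _ P _ (enum {: 'I_n * 'I_n}) (fun p => FVV Om p.1 p.2) _ E
  (fun p => basis_FVV (sub (of_format P (FVV Om p.1 p.2)))).
have [s2 [a2 b2 c2]] := @cover _ _ P _ (enum 'I_n) (fun x => FLV Om x) _ E
  (fun x => basis_FLV (sub (of_format P (FLV Om x)))).
have [s3 [a3 b3 c3]] := @cover _ _ P _ (enum 'I_n) (fun x => FVL Om x) _ E
  (fun x => basis_FVL (sub (of_format P (FVL Om x)))).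
pose gx := [seq (g, x) | g <- setS P, x <- enum 'I_n].
have [s4 [a4 b4 c4]] := @cover _ _ P _ gx (fun p => FSV p.1 p.2) _ E
  (fun p => basis_FSV (sub (of_format P (FSV p.1 p.2)))).
have [s5 [a5 b5 c5]] := @cover _ _ P _ gx (fun p => FVS p.2 p.1) _ E
  (fun p => basis_FVS (sub (of_format P (FVS p.2 p.1)))).
exists (s1 ++ (s2 ++ (s3 ++ (s4 ++ s5)))); split.
- by move=> e /=; rewrite !mem_cat => /orP [/a1|/orP [/a2|/orP [/a3|/orP [/a4|/a5]]]].
- rewrite !size_cat.
  have z1 : size (enum {: 'I_n * 'I_n}) = n * n by rewrite -cardE card_prod card_ord.
  have z2 : size (enum 'I_n) = n by rewrite -cardE card_ord.
  have z3 : size gx = m * n by rewrite size_allpairs z2.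
  rewrite z1 -/M -/k1 in b1; rewrite z2 -/M -/k2 in b2 b3; rewrite z3 -/M -/k2 in b4 b5.
  (* [k1] is [6 * M ^ 2 + 42 * M + 11] and [k2] is [5 * M + 21]. The five contributions add up to at
     most [65 + 4 * 26 = 169] times [n ^ 2 * m ^ 2]. *)
  have l1 : k1 <= 65 * (m * m).
    have : M * M <= m * m by apply: leq_mul.
    have : m <= m * m by rewrite leq_pmulr.
    by rewrite /k1; lia.
  have l2 : k2 <= 26 * m by rewrite /k2; lia.
  have l3 : n * n * k1 <= 65 * (n * n * (m * m)) by rewrite mulnCA leq_mul.
  have q1 : n * m <= n * n * (m * m) by apply: leq_mul; rewrite leq_pmulr.
  have q2 : n * (m * m) <= n * n * (m * m) by rewrite leq_mul2r leq_pmulr ?orbT.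
  have l4 : n * k2 <= 26 * (n * n * (m * m)).
    apply: leq_trans (leq_mul (leqnn n) l2) _.
    by rewrite mulnCA leq_mul2l.
  have l5 : m * n * k2 <= 26 * (n * n * (m * m)).
    apply: leq_trans (leq_mul (leqnn _) l2) _.
    by rewrite mulnCA (mulnC m n) -mulnA leq_mul2l.
  rewrite -!mulnn; lia.
apply: approx_subsumesI => F a tA tB _ hs.
have ha : hole (valA a) /\ hole (valB a).
  by move: tA tB; rewrite /is_template -!hole_vars => /andP [_ ->] /andP [_ ->].
have X (s : seq (equality Om n)) : {subset s <= s1 ++ (s2 ++ (s3 ++ (s4 ++ s5)))} ->
    sat_all a ([set` s] `&` of_format P F).
  by move=> ss e [ie Fe]; apply: hs; split=> //=; apply: ss.
have Y e : (E `&` of_format P F) e -> forall g x, F = FSV g x \/ F = FVS x g -> (g, x) \in gx.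
  move=> [_ Fe] g x h; apply/allpairsP; exists (g, x); split; rewrite ?mem_enum //=.
  by case: h Fe => -> [t []].
case: F X Y {hs} => [x y|x|g x|x|x g] X Y.
- by apply: (c1 (x, y)) => //; [rewrite mem_enum|apply: X => e ie; rewrite mem_cat ie].
- by apply: (c2 x) => //; [rewrite mem_enum|apply: X => e ie; rewrite !mem_cat ie ?orbT].
- move=> e he; have i : (g, x) \in gx by apply: (Y e he); left.
  by apply: (c4 (g, x)) he => //; apply: X => e' ie; rewrite !mem_cat ie ?orbT.
- by apply: (c3 x) => //; [rewrite mem_enum|apply: X => e ie; rewrite !mem_cat ie ?orbT].
move=> e he; have i : (g, x) \in gx by apply: (Y e he); right.
by apply: (c5 (g, x)) he => //; apply: X => e' ie; rewrite !mem_cat ie ?orbT.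
Qed.

(** * Heights and pumping *)

Section Heights.
Variable Om : signature.
Implicit Types (m a b f r : template Om).

(** Well-formed with all symbols in [Q]. The search is finite only if both the height and the
    alphabet are bounded, so the two are tracked side by side. *)
Fixpoint ok (Q : pred Om) V (t : term Om V) : bool :=
  match t with
  | Var _ => true
  | App f ts => [&& Q f, size ts == arity f & all (@ok Q V) ts]
  end.

Lemma okApp (Q : pred Om) V F (ts : seq (term Om V)) :
  ok Q (App F ts) = [&& Q F, size ts == arity F & all (@ok Q V) ts].
Proof. by []. Qed.

Lemma ok_wf Q (V : eqType) (t : term Om V) : ok Q t -> wf t.
Proof.
elim/term_ind2: t => [//|f ts IH] /= /and3P [_ -> /allP a].
by apply/allP => u iu; apply: IH => //; apply: a.
Qed.

Lemma wf_ok (V : eqType) (t : term Om V) : wf t = ok predT t.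
Proof. by elim/term_ind2: t => [//|f ts IH] /=; congr (_ && _); apply: eq_in_all. Qed.

Lemma ok_plug Q (V : eqType) m (u : term Om V) : ok Q m -> ok Q u -> ok Q (m ∙ u).
Proof.
move=> + ou; elim/term_ind2: m => [//|f ts IH]; rewrite plugApp !okApp size_map.
case/and3P=> -> -> /allP a /=; rewrite all_map; apply/allP => t it /=.
by apply: IH => //; apply: a.
Qed.

Lemma ok_plugl Q (V : eqType) m (u : term Om V) : ok Q (m ∙ u) -> ok Q m.
Proof.
elim/term_ind2: m => [//|f ts IH]; rewrite plugApp !okApp size_map.
case/and3P=> -> -> /allP a /=; apply/allP => t it; apply: IH => //.
by apply: a; apply: map_f.
Qed.

Lemma ok_plugr Q (V : eqType) m (u : term Om V) : hole m -> ok Q (m ∙ u) -> ok Q u.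
Proof.
elim/term_ind2: m => [//|f ts IH]; rewrite holeApp plugApp okApp.
move=> /hasP [t it ht] /and3P [_ _ /allP a]; apply: (IH t) => //.
by apply: a; apply: (map_f (fun m => m ∙ u)).
Qed.

Lemma height_plug (V : eqType) m (u : term Om V) : height (m ∙ u) <= height m + height u.
Proof.
elim/term_ind2: m => [//|f ts IH]; rewrite plugApp addSn height_leP all_map.
apply/allP => t it /=; apply: leq_trans (IH t it) _; rewrite leq_add2r.
by have := height_in f it; rewrite /= ltnS.
Qed.

Lemma height_plugl (V : eqType) m (u : term Om V) : height m <= height (m ∙ u).
Proof.
elim/term_ind2: m => [//|f ts IH]; rewrite plugApp.
case e: (height (App f [seq m ∙ u | m <- ts])) => [|k] //; rewrite height_leP.
apply/allP => t it; apply: leq_trans (IH t it) _; rewrite -ltnS -e.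
by apply: height_in; apply: (map_f (fun m => m ∙ u)).
Qed.

Lemma height_plugr (V : eqType) m (u : term Om V) : hole m -> height u <= height (m ∙ u).
Proof.
elim/term_ind2: m => [//|f ts IH]; rewrite holeApp plugApp => /hasP [t it ht].
apply: leq_trans (IH t it ht) (ltnW _).
by apply: height_in; apply: (map_f (fun m => m ∙ u)).
Qed.

Lemma height_plugr_lt (V : eqType) m (u : term Om V) :
  hole m -> m != Var tt -> height u < height (m ∙ u).
Proof.
case: m => [[]|f ts]; first by rewrite eqxx.
rewrite holeApp plugApp => /hasP [t it ht] _; apply: leq_ltn_trans (height_plugr u ht) _.
by apply: height_in; apply: (map_f (fun m => m ∙ u)).
Qed.

Lemma height_of_ground (V : eqType) (g : gterm Om) : height (of_ground V g) = height g.
Proof.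
elim/term_ind2: g => [[]|F ts IH] /=; congr (foldr _ _ _).+1; rewrite -map_comp.
by apply/eq_in_map => u /IH.
Qed.

Lemma ok_of_ground Q (V : eqType) (g : gterm Om) : ok Q (of_ground V g) = ok Q g.
Proof.
elim/term_ind2: g => [[]|F ts IH] /=; rewrite size_map all_map; congr [&& _, _ & _].
by apply: eq_in_all => u /IH.
Qed.

Lemma height_subst (V W : eqType) (s : V -> term Om W) (t : term Om V) :
  height t <= height (subst s t).
Proof.
elim/term_ind2: t => [//|F ts IH] /=; rewrite ltnS -map_comp.
elim: (ts) IH => //= t us IHs IH; rewrite geq_max !leq_max IH ?inE ?eqxx //=.
by rewrite IHs ?orbT // => u iu; apply: IH; rewrite inE iu orbT.
Qed.

Lemma height_subst_in (V W : eqType) (s : V -> term Om W) (t : term Om V) v :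
  v \in vars t -> height (s v) <= height (subst s t).
Proof.
elim/term_ind2: t => [u|F ts IH] /=; first by rewrite inE => /eqP ->.
case/flattenP=> _ /mapP [t it ->] iv; apply: leq_trans (IH t it iv) (ltnW _).
by apply: (@height_in _ _ F); apply: map_f.
Qed.

Lemma hole_subst_in (V W : eqType) (s : V -> term Om W) (t : term Om V) v :
  v \in vars t -> hole (s v) -> hole (subst s t).
Proof.
move=> + hv; elim/term_ind2: t => [u|F ts IH]; first by rewrite inE => /eqP <-.
case/flattenP=> _ /mapP [t it ->] iv; have -> : subst s (App F ts) = App F [seq subst s u | u <- ts] by [].
by rewrite holeApp has_map; apply/hasP; exists t => //=; apply: IH.
Qed.

Lemma ok_subst_in Q (V W : eqType) (s : V -> term Om W) (t : term Om V) v :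
  v \in vars t -> ok Q (subst s t) -> ok Q (s v).
Proof.
elim/term_ind2: t => [u|F ts IH] /=; first by rewrite inE => /eqP ->.
case/flattenP=> _ /mapP [t it ->] iv /and3P [_ _ /allP a].
by apply: (IH t it iv); apply: a; apply: map_f.
Qed.

Lemma height_swap m (u u' : gterm Om) : height (m ∙ u') <= height (m ∙ u) + height u'.
Proof.
elim/term_ind2: m => [[]|F ms IH]; first exact: leq_addl.
rewrite !plugApp addSn height_leP all_map; apply/allP => m im /=.
apply: leq_trans (IH m im) _; rewrite leq_add2r -ltnS.
by apply: (@height_in _ _ F); apply: (map_f (fun m => m ∙ u)).
Qed.

(** Depth of the deepest hole; unlike the height it is additive under [plug] for templates with
    holes. *)
Fixpoint hdepth m : nat :=
  match m with
  | Var _ => 0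
  | App _ ts => foldr maxn 0 [seq (if hole u then (hdepth u).+1 else 0) | u <- ts]
  end.

Lemma hdepth_plug m r : hole m -> hole r -> hdepth (m ∙ r) = hdepth m + hdepth r.
Proof.
move=> + hr; elim/term_ind2: m => [//|f ts IH].
rewrite holeApp plugApp /=.
have -> : [seq (if hole u then (hdepth u).+1 else 0) | u <- [seq u ∙ r | u <- ts]] =
    [seq (if hole u then (hdepth u + hdepth r).+1 else 0) | u <- ts].
  rewrite -map_comp; apply/eq_in_map => u iu /=.
  by rewrite hole_plug //; case hu: (hole u) => //; rewrite IH.
elim: (ts) => //= u s IHs; case hu: (hole u) => /=.
  move=> _; case hs: (has (@hole _ _) s); first by rewrite IHs // addn_maxl addSn.
  have Z (F : template Om -> nat) : foldr maxn 0 [seq (if hole u then (F u).+1 else 0) | u <- s] = 0.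
    move/negbT: hs; elim: (s) => //= v s' IH' /norP [/negbTE -> hs]; rewrite max0n.
    exact: IH'.
  by rewrite !Z !maxn0 addSn.
by rewrite !max0n.
Qed.

Lemma hdepth0 r : hole r -> hdepth r = 0 -> r = Var tt.
Proof.
case: r => [[]|f ts] //; rewrite holeApp /=; elim: ts => //= u s IH.
case: (hole u) => /= [_ /eqP|hs]; first by rewrite -leqn0 geq_max.
by rewrite max0n => /(IH hs).
Qed.

Lemma hdepth_height m : hdepth m <= height m.
Proof.
elim/term_ind2: m => [//|f ts IH] /=.
elim: (ts) IH => //= u s IHs IH; rewrite geq_max; apply/andP; split.
  case: ifP => // _; rewrite ltnS leq_max IH ?inE ?eqxx //.
apply: leq_trans (IHs _) _ => [v iv|]; first by apply: IH; rewrite inE iv orbT.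
by rewrite ltnS leq_max leqnn orbT.
Qed.

Lemma hdepth_gt0 m : hole m -> m != Var tt -> 0 < hdepth m.
Proof. by move=> hm; apply: contraNltn; rewrite leqn0 => /eqP /(hdepth0 hm) ->. Qed.

Lemma height_hdepth m (u : gterm Om) : hole m -> hdepth m + height u <= height (m ∙ u).
Proof.
elim/term_ind2: m => [//|f ts IH]; rewrite holeApp plugApp => hh.
rewrite -[hdepth _]/(foldr maxn 0 [seq (if hole u then (hdepth u).+1 else 0) | u <- ts]).
rewrite -[height (App f _)]/(foldr maxn 0 [seq height v | v <- [seq m ∙ u | m <- ts]]).+1.
elim: (ts) IH hh => //= t s IHs IH.
have [ht _|ht /= hs] := boolP (hole t); last first.
  rewrite max0n; apply: leq_trans (IHs _ hs) _; last by rewrite ltnS leq_maxr.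
  by move=> v iv; apply: IH; rewrite inE iv orbT.
have [hs|hs] := boolP (has (@hole _ _) s).
  rewrite addn_maxl geq_max; apply/andP; split.
    by rewrite addSn ltnS leq_max IH ?inE ?eqxx.
  apply: leq_trans (IHs _ hs) _; last by rewrite ltnS leq_maxr.
  by move=> v iv; apply: IH; rewrite inE iv orbT.
have -> : foldr maxn 0 [seq (if hole u then (hdepth u).+1 else 0) | u <- s] = 0.
  elim: (s) hs => //= v s' IH' /norP [/negbTE -> hs]; rewrite max0n; exact: IH'.
by rewrite maxn0 addSn ltnS leq_max IH ?inE ?eqxx.
Qed.

Lemma fpowD i k f : fpow (i + k) f = fpow i f ∙ fpow k f.
Proof. by elim: i => //= i IH; rewrite plugA -IH. Qed.

Lemma fpowSr k f : fpow k.+1 f = fpow k f ∙ f.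
Proof. by rewrite -addn1 fpowD /= plug_Var. Qed.

Lemma hdepth_fpow k f : hole f -> hdepth (fpow k f) = k * hdepth f.
Proof. by move=> hf; elim: k => //= k IH; rewrite hdepth_plug ?hole_fpow // IH. Qed.

Lemma height_fpow k f : height (fpow k f) <= k * height f.
Proof.
elim: k => //= k IH; apply: leq_trans (height_plug _ _) _.
by rewrite mulSn leq_add2l.
Qed.

Lemma ok_fpow Q k f : ok Q f -> ok Q (fpow k f).
Proof. by move=> o; elim: k => //= k IH; apply: ok_plug. Qed.

Lemma leq_height_fpow k f (z : gterm Om) : hole f -> f != Var tt -> k <= height (fpow k f ∙ z).
Proof.
move=> hf nf; elim: k => //= k IH; apply: leq_ltn_trans IH _.
by rewrite plugA; apply: height_plugr_lt.
Qed.

End Heights.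

Section Pumping.
Variables (Om : signature) (G : seq (gterm Om)) (kG : nat).
Hypothesis Gsub : forall F ts t, App F ts \in G -> t \in ts -> t \in G.
Hypothesis hG : forall g, g \in G -> height g <= kG.
Implicit Types (m a b d f r s t : template Om) (h y z c : gterm Om).
Let gk := @gk Om G.

Lemma tall_big z : kG < height z -> z \notin G.
Proof. by move=> lt; apply/negP => /hG; rewrite leqNgt lt. Qed.

(** The power is deeper than [d], so [d] is a prefix of it. Then [d ∙ f] and [f ∙ d] are comparable
    and of equal hole depth, hence equal. The summand [kG] in the bound keeps all arguments big. *)
Lemma pow_shift f d z z' j : hole f -> gk f -> f != Var tt -> hole d -> gk d ->
  hdepth d + kG + 2 <= j -> fpow j f ∙ z = d ∙ (fpow j f ∙ z') ->
  d ∙ f = f ∙ d /\ z = d ∙ z'.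
Proof.
move=> hf gf nf hd gd lj e; set i := hdepth d in lj.
have big k (w : gterm Om) : kG < k -> fpow k f ∙ w \notin G.
  by move=> lt; apply: tall_big; apply: leq_trans lt (leq_height_fpow _ _ hf nf).
have hp k := hole_fpow k hf; have gp k := gk_fpow Gsub k hf gf.
have ej : fpow i f ∙ (fpow (j - i) f ∙ z) = d ∙ (fpow j f ∙ z').
  by rewrite -plugA -fpowD subnKC //; lia.
have [e' [he ge ei]] : exists e', [/\ hole e', gk e' & fpow i f = d ∙ e'].
  case: (gk_levi Gsub (hp i) hd (gp i) gd _ _ ej); try by apply: big; lia.
    move=> [r [hr gr ed _]]; exists (Var tt); split=> //; rewrite plug_Var.
    have := congr1 (@hdepth _) ed; rewrite hdepth_plug // hdepth_fpow // -/i.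
    have := hdepth_gt0 hf nf; move=> f0 er.
    have r0 : hdepth r = 0 by move: er; nia.
    by rewrite ed (hdepth0 hr r0) plug_Var.
  by move=> [r [hr gr ed _]]; exists r.
have eq : (d ∙ f) ∙ (fpow j.-1 f ∙ z') = (f ∙ d) ∙ (e' ∙ (fpow (j - i.+1) f ∙ z)).
  rewrite !plugA -[f ∙ (fpow _ _ ∙ _)]plugA -[f ∙ fpow _ _]/(fpow j.-1.+1 f) prednK; last by lia.
  rewrite -e -[d ∙ (e' ∙ _)]plugA -ei -[fpow i f ∙ _]plugA -fpowD -plugA.
  by rewrite -[f ∙ fpow _ _]/(fpow (i + (j - i.+1)).+1 f); congr (fpow _ _ ∙ _); lia.
have hdf : hole (d ∙ f) by rewrite hole_plug.
have hfd : hole (f ∙ d) by rewrite hole_plug.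
have com : d ∙ f = f ∙ d.
  have b1 : fpow j.-1 f ∙ z' \notin G by apply: big; lia.
  have b2 : e' ∙ (fpow (j - i.+1) f ∙ z) \notin G.
    by apply: (plug_big Gsub he); apply: big; lia.
  case: (gk_levi Gsub hdf hfd (gk_plug Gsub gd gf hf) (gk_plug Gsub gf gd hd) b1 b2 eq) => [[r [hr _ er _]]|[r [hr _ er _]]].
    have := congr1 (@hdepth _) er; rewrite !hdepth_plug // => eh.
    by rewrite er (hdepth0 hr) ?plug_Var //; lia.
  have := congr1 (@hdepth _) er; rewrite !hdepth_plug // => eh.
  by rewrite er (hdepth0 hr) ?plug_Var //; lia.
split=> //; apply: (plug_injr (hp j)); rewrite e -!plugA; congr (_ ∙ _).
elim: (j) => [|l IH]; first by rewrite plug_Var.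
by rewrite fpowSr -plugA IH !plugA com.
Qed.

Lemma commute_pow d f j : d ∙ f = f ∙ d -> d ∙ fpow j f = fpow j f ∙ d.
Proof.
move=> com; elim: j => [|l IH]; first by rewrite plug_Var.
by rewrite fpowSr -plugA IH !plugA com.
Qed.

(** Cancelling the common prefix of [a] and [b] leads to [pow_shift]; as [d] commutes with [f], the
    equation does not depend on the exponent. *)
Lemma pow_stable f a b z z' j j' : hole f -> gk f -> f != Var tt -> hole a -> gk a ->
  hole b -> gk b -> hdepth a + hdepth b + kG + 2 <= j ->
  a ∙ (fpow j f ∙ z) = b ∙ (fpow j f ∙ z') -> a ∙ (fpow j' f ∙ z) = b ∙ (fpow j' f ∙ z').
Proof.
move=> hf gf nf ha ga hb gb lj e.
have big (w : gterm Om) : fpow j f ∙ w \notin G.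
  by apply: tall_big; apply: leq_trans (leq_height_fpow _ _ hf nf); lia.
case: (gk_levi Gsub ha hb ga gb (big z) (big z') e) => [[d [hd gd eb ez]]|[d [hd gd ea ez]]].
  have l : hdepth d + kG + 2 <= j by move: lj; rewrite eb hdepth_plug //; lia.
  have [com ->] := pow_shift hf gf nf hd gd l ez.
  by rewrite eb plugA -[fpow j' f ∙ (d ∙ z')]plugA -commute_pow // plugA.
have l : hdepth d + kG + 2 <= j by move: lj; rewrite ea hdepth_plug //; lia.
have [com ->] := pow_shift hf gf nf hd gd l ez.
by rewrite ea plugA -[fpow j' f ∙ (d ∙ z)]plugA -commute_pow // plugA.
Qed.

(** Split off [f] while [gk_levi] allows it. This ends when the rest is a prefix of [f] or its value
    at [h] falls into G; in both cases the rest has bounded height. *)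
Lemma pow_split f (k : template Om) h h' : hole f -> gk f -> f != Var tt -> hole k -> gk k -> h' \notin G ->
  f ∙ (k ∙ h) = k ∙ h' ->
  exists j (k0 : template Om), [/\ k = fpow j f ∙ k0, hole k0, gk k0 &
    (exists d, f = k0 ∙ d) \/ k0 ∙ h \in G].
Proof.
move=> hf gf nf; have [n] := ubnP (tsize k); elim: n k => // n IH k; rewrite ltnS => le hk gk' nh e.
have [i|ni] := boolP (k ∙ h \in G); first by exists 0, k; split=> //; right.
case: (gk_levi Gsub hf hk gf gk' ni nh e) => [[r [hr gr ek er]]|[r [hr gr ef er]]]; last first.
  by exists 0, k; split=> //; left; exists r.
have [||j [k0 [er' h0 g0 hk0]]] := IH r _ hr gr nh.
- by apply: leq_trans le; rewrite ek; apply: tsize_plug_lt.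
- by rewrite -er ek plugA.
by exists j.+1, k0; split=> //; rewrite ek er' /= plugA.
Qed.

(* y is taller than every element of R, so it cannot sit inside r. *)
Lemma down_T (Q : pred Om) (g : template Om) y m (r : gterm Om) : gk g -> hole g -> gk m -> ok Q m ->
  y \notin G -> height r < height y -> g ∙ y = m ∙ r ->
  exists e, [/\ hole e, gk e, ok Q e & y = e ∙ r].
Proof.
elim/term_ind2: g m => [[]|F gs IH] m gg hg gm om ny lt e.
  by exists m; split=> //; apply: (@plug_big_hole _ G Gsub _ r) => //; rewrite -e.
case: m gm om e => [[]|F' ms] gm om e.
  by move: lt; rewrite ltnNge -[r]/(Var tt ∙ r) -e height_plugr.
move: e hg => [_] /map_eq_zip [es e]; rewrite holeApp => /hasP [t it ht].
have [u iu] := zip_exl es it; have [/= _ iu'] := mem_zip2 iu.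
apply: (IH t it u) => //; last exact: (e (t, u)).
- exact: gk_in gg it.
- exact: gk_in gm iu'.
by move: om; rewrite okApp => /and3P [_ _ /allP]; apply.
Qed.

End Pumping.

Section BigConstant.
Variables (Om : signature) (G : seq (gterm Om)) (kG kR : nat).
Hypothesis Gsub : forall F ts t, App F ts \in G -> t \in ts -> t \in G.
Hypothesis hG : forall g, g \in G -> height g <= kG.
Implicit Types (m a b d f r s t : template Om) (h y z c : gterm Om).
Let gk := @gk Om G.

(** With [dl = o (D, y)] the equations become [D ∙ c = t' ∙ y]. Either an element of G or a constant
    bounds [y] directly, or [y = k ∙ c1] and an overlap gives [k = fpow j f ∙ k0], where a large [j]
    is lowered to [J]. In [J], [2 * N] covers the hole depths of the two templates of an equation,
    [kG + 2] comes from [pow_stable], and [kR] keeps [y'] taller than R, as [down_T] requires. *)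
Lemma shrink_big (E : set (gterm Om * template Om)) e0 e1 e2 (dl : template Om) y N :
  let J := 2 * N + kG + kR + 2 in
  y \notin G ->
  (forall e, E e \/ e = e0 -> [/\ gk e.2, hole e.2, height e.1 <= N & height e.2 <= N]) ->
  hole dl -> (forall e, E e -> dl ∙ e.1 = e.2 ∙ y) -> dl ∙ e0.1 <> e0.2 ∙ y ->
  E e1 -> E e2 -> e1.1 \notin G -> e1.1 != e2.1 ->
  exists (dl' : template Om) y', [/\ hole dl', y' \notin G, forall e, E e -> dl' ∙ e.1 = e.2 ∙ y' &
     dl' ∙ e0.1 <> e0.2 ∙ y'] /\
   [/\ height y' <= (J + 2) * (N + kG),
     forall Q, (forall g, g \in G -> ok Q g) -> (forall e, E e -> ok Q e.1 && ok Q e.2) -> ok Q y' &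
     y' = y \/ exists g : template Om, [/\ hole g, gk g, y = g ∙ y' & kR < height y']].
Proof.
move=> J ny hE hd sE vE E1 E2 nc1 nc.
have [g1 h1 c1N t1N] := hE e1 (or_introl E1); have [g2 h2 c2N t2N] := hE e2 (or_introl E2).
have fin : height y <= (J + 2) * (N + kG) ->
    (forall Q, (forall g, g \in G -> ok Q g) -> (forall e, E e -> ok Q e.1 && ok Q e.2) -> ok Q y) ->
  exists (dl' : template Om) y', [/\ hole dl', y' \notin G, forall e, E e -> dl' ∙ e.1 = e.2 ∙ y' &
     dl' ∙ e0.1 <> e0.2 ∙ y'] /\
   [/\ height y' <= (J + 2) * (N + kG),
     forall Q, (forall g, g \in G -> ok Q g) -> (forall e, E e -> ok Q e.1 && ok Q e.2) -> ok Q y' &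
     y' = y \/ exists g : template Om, [/\ hole g, gk g, y = g ∙ y' & kR < height y']].
  by move=> l o; exists dl, y; split=> //; split=> //; left.
have lin x : x <= N + kG -> x <= (J + 2) * (N + kG).
  by move=> le; apply: leq_trans le _; rewrite mulnDl mul2n -addnn; lia.
have ga := overlap_abst Gsub ny nc1 nc g1 g2 (sE _ E1) (sE _ E2).
have [o [D [[go io gD hD ed] H]]] := skeleton Gsub ga hd.
have DE c : dl ∙ c = inst o (D ∙ c) y by rewrite {1}ed inst_plug plug_ground of_ground_void.
have Hx e : E e -> D ∙ e.1 \notin G -> exists t', [/\ gk t', hole t', t' ∙ y = D ∙ e.1 & e.2 = inst o t' (Var tt)].
  by move=> Ee nD; have [ge _ _ _] := hE e (or_introl Ee); apply: H => //; rewrite -DE sE.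
have nD1 : D ∙ e1.1 \notin G by apply: plug_big.
have [t1 [gt1 ht1 et1 ee1]] := Hx _ E1 nD1.
have hin t' t : t = inst o t' (Var tt) -> height t' <= height t.
  by move=> ->; apply: (height_subst_in (fun b : bool => if b then t' else Var tt) io).
have oin Q t' t : t = inst o t' (Var tt) -> ok Q t -> ok Q t'.
  by move=> ->; apply: (ok_subst_in (s := fun b : bool => if b then t' else Var tt) io).
(* A value of [D] in G bounds [D], and then [t1 ∙ y = D ∙ c1] bounds [y]. *)
case: (pselect (exists2 e3, E e3 & D ∙ e3.1 \in G)) => [[e3 E3 iD]|nD].
  have lD : height D <= kG := leq_trans (height_plugl D e3.1) (hG iD).
  apply: fin => [|Q QG QE].
    apply: lin; apply: leq_trans (height_plugr y ht1) _; rewrite et1.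
    by apply: leq_trans (height_plug _ _) _; rewrite addnC leq_add.
  apply: (@ok_plugr _ Q _ t1) => //; rewrite et1; apply: ok_plug.
    exact: ok_plugl (QG _ iD).
  by case/andP: (QE _ E1).
have {nD} nD e : E e -> D ∙ e.1 \notin G by move=> Ee; apply/negP => i; apply: nD; exists e.
case: (gk_levi Gsub hD ht1 gD gt1 nc1 ny (esym et1)) => [[r [hr gr er ey]]|[k [hk gk' eD ey]]].
  apply: fin => [|Q QG QE].
    by apply: lin; apply: leq_trans (leq_addr _ _); apply: leq_trans c1N; rewrite ey height_plugr.
  by apply: (@ok_plugr _ Q _ r) => //; rewrite -ey; case/andP: (QE _ E1).
case i2: (k ∙ e2.1 \in G).
  apply: fin => [|Q QG QE]; rewrite ey.
    apply: lin; apply: leq_trans (height_plug _ _) _; rewrite addnC leq_add //.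
    exact: leq_trans (height_plugl k e2.1) (hG i2).
  by apply: ok_plug; [exact: ok_plugl (QG _ i2)|case/andP: (QE _ E1)].
have nk1 : k ∙ e1.1 \notin G by rewrite -ey.
have [t2 [gt2 ht2 et2 ee2]] := Hx _ E2 (nD _ E2).
(* The equations for [e1] and [e2] combine to [t2 ∙ (k ∙ c1) = t1 ∙ (k ∙ c2)]. One of [t1], [t2] is
   a prefix of the other, and [f] is the quotient, so it inherits height and alphabet from them. *)
have [f [h [h' [[hf gf e nh nG'] [hfN okf okh]]]]] : exists f h h', [/\ hole f, gk f, f ∙ (k ∙ h) = k ∙ h', h != h' & (h \notin G) || (h' \notin G)] /\
   [/\ height f <= N, forall Q, (forall e, E e -> ok Q e.1 && ok Q e.2) -> ok Q f & (h' \notin G) || ((h \notin G) && (h' \in G))].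
  have eq : t2 ∙ (k ∙ e1.1) = t1 ∙ (k ∙ e2.1) by rewrite -ey et2 eD plugA.
  case: (gk_levi Gsub ht2 ht1 gt2 gt1 nk1 (negbT i2) eq) => [[f [hf gf ef e]]|[f [hf gf ef e]]].
    exists f, e2.1, e1.1; split; split=> //; rewrite ?nc1 ?orbT //; first by rewrite eq_sym.
      apply: leq_trans t1N; apply: leq_trans (hin _ _ ee1).
      by rewrite ef; apply: height_plugr.
    move=> Q QE; apply: (@ok_plugr _ Q _ t2) => //; rewrite -ef; apply: (oin Q _ _ ee1).
    by case/andP: (QE _ E1).
  exists f, e1.1, e2.1; split; split=> //; rewrite ?nc1 //; last by case: (_ \in _).
    apply: leq_trans t2N; apply: leq_trans (hin _ _ ee2).
    by rewrite ef; apply: height_plugr.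
  move=> Q QE; apply: (@ok_plugr _ Q _ t1) => //; rewrite -ef; apply: (oin Q _ _ ee2).
  by case/andP: (QE _ E2).
have nf : f != Var tt.
  by apply: contraNneq nh => fV; apply/eqP; apply: (plug_injr hk); rewrite -e fV.
have nh' : h' \notin G.
  case/orP: okh => // /andP [bh ih].
  by have := overlap_cnt Gsub hf nf hk bh ih e.
have [j [k0 [ek hk0 gk0 k0c]]] := pow_split Gsub hf gf nf hk gk' nh' e.
have hk0N : height k0 <= N + kG.
  case: k0c => [[d ef]|i]; last by apply: leq_trans (leq_addl _ _); apply: leq_trans (height_plugl k0 h) (hG i).
  by apply: leq_trans (leq_addr _ _); apply: leq_trans hfN; rewrite ef; apply: height_plugl.
have okk0 Q : (forall g, g \in G -> ok Q g) -> (forall e, E e -> ok Q e.1 && ok Q e.2) -> ok Q k0.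
  move=> QG QE; case: k0c => [[d ef]|i]; last exact: ok_plugl (QG _ i).
  by have := okf Q QE; rewrite ef; apply: ok_plugl.
pose Y i := fpow i f ∙ (k0 ∙ e1.1); pose DD i := t1 ∙ (fpow i f ∙ k0).
have hY i : i <= J -> height (Y i) <= (J + 2) * (N + kG).
  move=> le; apply: leq_trans (height_plug _ _) _.
  have l1 : height (fpow i f) <= J * (N + kG).
    apply: leq_trans (height_fpow _ _) _; apply: leq_mul => //.
    exact: leq_trans hfN (leq_addr _ _).
  have l2 : height (k0 ∙ e1.1) <= 2 * (N + kG).
    apply: leq_trans (height_plug _ _) _; rewrite mul2n -addnn leq_add //.
    exact: leq_trans c1N (leq_addr _ _).
  by rewrite mulnDl leq_add.
have okY i Q : (forall g, g \in G -> ok Q g) -> (forall e, E e -> ok Q e.1 && ok Q e.2) -> ok Q (Y i).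
  move=> QG QE; apply: ok_plug; first by apply: ok_fpow; apply: okf.
  by apply: ok_plug; [apply: okk0|case/andP: (QE _ E1)].
have eY : y = Y j by rewrite ey ek /Y plugA.
case: (leqP j J) => lj; first by apply: fin => [|Q]; rewrite eY; [apply: hY|apply: okY].
have eDD : D = DD j by rewrite eD ek.
have stab a b z z' i i' : hole a -> gk a -> hole b -> gk b -> hdepth a + hdepth b <= 2 * N -> J <= i ->
    a ∙ (fpow i f ∙ z) = b ∙ (fpow i f ∙ z') -> a ∙ (fpow i' f ∙ z) = b ∙ (fpow i' f ∙ z').
  move=> ha ga' hb gb l li.
  have l' : hdepth a + hdepth b + kG + 2 <= i by move: l li; rewrite /J; clear; lia.
  move=> eq; exact: (pow_stable Gsub hG i' hf gf nf ha ga' hb gb l' eq).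
have DDE i c : DD i ∙ c = t1 ∙ (fpow i f ∙ (k0 ∙ c)) by rewrite /DD !plugA.
have t1d : hdepth t1 <= N by apply: leq_trans (hdepth_height _) _; apply: leq_trans (hin _ _ ee1) t1N.
have nY : Y J \notin G.
  apply: (tall_big hG); rewrite /Y; apply: leq_trans _ (leq_height_fpow _ _ hf nf).
  by rewrite /J; clear; lia.
have hDD i : hole (DD i) by rewrite /DD !hole_plug ?hole_fpow // hole_plug.
(* The same shape with exponent [J] in place of [j]. By [stab] the equations pass from [j] to [J],
   and [e0], if it held for [J], would hold for [j]. *)
exists (inst o (DD J) (of_ground unit (Y J))), (Y J).
have PE c : inst o (DD J) (of_ground unit (Y J)) ∙ c = inst o (DD J ∙ c) (Y J).
  by rewrite inst_plug plug_ground of_ground_void.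
split; split=> //.
- exact: (hole_subst_in (s := fun b : bool => if b then DD J else of_ground unit (Y J)) io).
- move=> e' Ee; have [t' [gt' ht' et' ee']] := Hx _ Ee (nD _ Ee).
  have [_ _ _ eN] := hE e' (or_introl Ee).
  have S : t' ∙ Y J = DD J ∙ e'.1.
    rewrite DDE; apply: (stab _ _ _ _ j) => //; last by rewrite -DDE -eDD -et' eY.
      rewrite mul2n -addnn leq_add //; apply: leq_trans (hdepth_height _) _.
      exact: leq_trans (hin _ _ ee') eN.
    exact: ltnW.
  by rewrite PE -S [in RHS]ee' inst_plug.
- rewrite PE => e'; apply: vE; have [g0 h0 c0N t0N] := hE e0 (or_intror erefl).
  have nz : DD J ∙ e0.1 \notin G.
    rewrite DDE; apply: (plug_big Gsub ht1); apply: (tall_big hG).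
    by apply: leq_trans _ (leq_height_fpow _ _ hf nf); rewrite /J; clear; lia.
  rewrite DE; case: (factor_split Gsub go g0 nY nz io e') => [[t' [gt' ht' et']]|[r [gr hr nr er rN]]].
    have ee : e0.2 = inst o t' (Var tt).
      apply: (gk_inj Gsub nY g0); first by apply: gk_inst.
      by rewrite inst_plug -e' et'.
    suff -> : D ∙ e0.1 = t' ∙ y by rewrite ee inst_plug.
    rewrite eDD DDE eY; apply/esym; apply: (stab _ _ _ _ J) => //; last by rewrite -DDE -et'.
    rewrite mul2n -addnn leq_add //; apply: leq_trans (hdepth_height _) _.
    exact: leq_trans (hin _ _ ee) t0N.
  have er' : y = r ∙ (D ∙ e0.1).
    rewrite eDD DDE eY -plugA -[Y j]/(Var tt ∙ (fpow j f ∙ (k0 ∙ e1.1))).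
    apply: (stab _ _ _ _ J) => //; last by rewrite plugA -DDE -er.
    - by rewrite hole_plug.
    - exact: gk_plug.
    rewrite /= add0n hdepth_plug // mul2n -addnn leq_add //.
    apply: leq_trans (hdepth_height _) _; apply: leq_trans rN _; apply: leq_trans t1N.
    by rewrite ee1; apply: height_subst.
  have eqr : inst o (Var tt) r = e0.2 ∙ r.
    apply: (gk_inj Gsub nz); [by apply: gk_inst|by apply: gk_plug|].
    by rewrite inst_plug plugA -er.
  by rewrite er' -[e0.2 ∙ (r ∙ _)]plugA -eqr inst_plug.
- by apply: hY.
- by move=> Q; apply: okY.
right; exists (fpow (j - J) f); split; [exact: hole_fpow|exact: gk_fpow| |].
  by rewrite eY /Y -[in RHS]plugA -fpowD subnK // ltnW.
by rewrite /Y; apply: leq_trans _ (leq_height_fpow _ _ hf nf); rewrite /J; clear; lia.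
Qed.

End BigConstant.

(** * Systems whose constants lie in G *)

Section FiniteLists.

Fixpoint seqs (T : Type) k (l : seq T) : seq (seq T) :=
  if k is k'.+1 then flatten [seq [seq x :: s | s <- seqs k' l] | x <- l] else [:: [::]].

Lemma mem_seqs (T : eqType) k (l s : seq T) :
  (s \in seqs k l) = (size s == k) && all [in l] s.
Proof.
elim: k s => [|k IH] [|x s] //=.
  by apply/flattenP => -[_ /mapP [y _ ->] /mapP [z _]].
rewrite eqSS; apply/flattenP/idP => [[_ /mapP [y iy ->] /mapP [z iz [-> ->]]]|].
  by rewrite iy /= -IH.
case/and3P=> es ix a; exists [seq x :: s | s <- seqs k l]; first exact: (map_f (fun x => [seq x :: s | s <- seqs k l])).
by apply: map_f; rewrite IH es.
Qed.

Fixpoint sublists (T : Type) (l : seq T) : seq (seq T) :=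
  if l is x :: l' then [seq x :: s | s <- sublists l'] ++ sublists l' else [:: [::]].

Lemma filter_sublists (T : eqType) (a : pred T) (l : seq T) : filter a l \in sublists l.
Proof.
elim: l => //= x l IH; rewrite mem_cat; case: (a x); last by rewrite IH orbT.
by rewrite map_f.
Qed.

(** The property is monotone in the list, so the finitely many witness lists can be concatenated. *)
Lemma finite_choice (I Y : eqType) (l : seq I) (Q : I -> seq Y -> Prop) :
  (forall i s s', {subset s <= s'} -> Q i s -> Q i s') ->
  (forall i, i \in l -> exists s, Q i s) -> exists s, forall i, i \in l -> Q i s.
Proof.
move=> mono; elim: l => [|i l IH] h; first by exists [::].
have [s hs] := IH (fun j ij => h j (mem_behead (s := i :: l) ij)).
have [s' hs'] := h i (mem_head _ _); exists (s' ++ s) => j; rewrite inE => /predU1P [->|ij].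
  by apply: mono hs' => x ix; rewrite mem_cat ix.
by apply: mono (hs j ij) => x ix; rewrite mem_cat ix orbT.
Qed.

End FiniteLists.

Section Enumeration.
Variable Om : signature.

Fixpoint terms (S : seq Om) h : seq (template Om) :=
  if h is h'.+1 then
    Var tt :: flatten [seq [seq App F ts | ts <- seqs (arity F) (terms S h')] | F <- S]
  else [:: Var tt].

Lemma mem_terms (S : seq Om) h t : (t \in terms S h) = ok [in S] t && (height t <= h).
Proof.
elim: h t => [|h IH] [[]|F ts] //=; first by rewrite inE andbF.
rewrite inE /=; apply/flattenP/idP => [[_ /mapP [F' iF ->] /mapP [ts' + [-> ->]]]|].
  rewrite mem_seqs => /andP [es /allP a]; rewrite iF es /=; apply/andP; split.
    by apply/allP => u /a; rewrite IH => /andP [].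
  rewrite -[_ < _]/(height (App F' ts') <= h.+1) height_leP.
  by apply/allP => u /a; rewrite IH => /andP [].
case/andP=> /and3P [iF es /allP a] lt; exists [seq App F ts | ts <- seqs (arity F) (terms S h)].
  by apply/mapP; exists F.
apply: map_f; rewrite mem_seqs es; apply/allP => u iu; rewrite IH a //=.
by move: lt; rewrite -[_ < _]/(height (App F ts) <= h.+1) height_leP => /allP; apply.
Qed.

Fixpoint symbols V (t : term Om V) : seq Om :=
  if t is App F ts then F :: flatten [seq symbols u | u <- ts] else [::].

Lemma ok_symbols (V : eqType) (t : term Om V) (S : seq Om) :
  wf t -> {subset symbols t <= S} -> ok [in S] t.
Proof.
elim/term_ind2: t => [//|F ts IH] /= /andP [-> /allP w] sub; rewrite sub ?inE ?eqxx //=.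
apply/allP => u iu; apply: IH => // [|f iF]; first exact: w.
by apply: sub; rewrite inE; apply/orP; right; apply/flattenP; exists (symbols u) => //; apply: map_f.
Qed.

Lemma ok_sub (Q Q' : pred Om) (V : eqType) (t : term Om V) : subpred Q Q' -> ok Q t -> ok Q' t.
Proof.
move=> sub; elim/term_ind2: t => [//|F ts IH] /= /and3P [/sub -> -> /allP a] /=.
by apply/allP => u iu; apply: IH => //; apply: a.
Qed.

(** A count rather than a predicate: [m ∙ c] and [m ∙ c'] have to be compared although [m] itself
    may contain foreign symbols. *)
Fixpoint foreign (Q : pred Om) V (t : term Om V) : nat :=
  if t is App F ts then ~~ Q F + sumn [seq foreign Q u | u <- ts] else 0.

Lemma foreign_ok Q (V : eqType) (t : term Om V) : wf t -> (foreign Q t == 0) = ok Q t.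
Proof.
elim/term_ind2: t => [//|F ts IH] /= /andP [-> w] /=; rewrite addn_eq0 eqb0 negbK; congr (_ && _).
elim: (ts) IH w => //= t s IHs IH /andP [wt ws]; rewrite addn_eq0 IH ?inE ?eqxx // IHs //.
by move=> u iu; apply: IH; rewrite inE iu orbT.
Qed.

Lemma foreign_plug Q (m : template Om) (c : gterm Om) :
  foreign Q c = 0 -> foreign Q (m ∙ c) = foreign Q m.
Proof.
move=> c0; elim/term_ind2: m => [//|F ms IH]; rewrite plugApp /=; congr (_ + sumn _).
by rewrite -map_comp; apply/eq_in_map => u /IH.
Qed.

Lemma leq_foreign Q (m : template Om) (u : gterm Om) : hole m ->
  foreign Q m + foreign Q u <= foreign Q (m ∙ u).
Proof.
have X (t : template Om) : foreign Q t <= foreign Q (t ∙ u).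
  elim/term_ind2: t => [//|F ms IH]; rewrite plugApp /= leq_add2l -map_comp.
  elim: (ms) IH => //= t s IHs IH; apply: leq_add; first by apply: IH; rewrite inE eqxx.
  by apply: IHs => v iv; apply: IH; rewrite inE iv orbT.
elim/term_ind2: m => [[]|F ms IH]; first by [].
rewrite holeApp plugApp /= -addnA leq_add2l -map_comp.
elim: (ms) IH => //= t s IHs IH; case/orP=> [ht|hs].
  rewrite addnAC; apply: leq_add; first by apply: IH; rewrite ?inE ?eqxx.
  by elim: (s) => //= v s' IH'; apply: leq_add.
rewrite -addnA; apply: leq_add; first exact: X.
by apply: IHs => // v iv; apply: IH; rewrite inE iv orbT.
Qed.

End Enumeration.

Section SmallConstants.
Variables (Om : signature) (G : seq (gterm Om)) (kG : nat).
Hypothesis Gsub : forall F ts t, App F ts \in G -> t \in ts -> t \in G.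
Hypothesis hG : forall g, g \in G -> height g <= kG.
Hypothesis wG : forall g, g \in G -> wf g.
Implicit Types (m a b d f r t : template Om) (h y z c u : gterm Om).
Let gk := @gk Om G.
Notation pair := (gterm Om * template Om)%type.

Lemma height_gk m : gk m -> height m <= hdepth m + kG.
Proof.
elim/term_ind2: m => [//|F ms IH] g.
case hm: (hole (App F ms)); last first.
  move/negbT/groundP: hm g => [g' ->]; rewrite /gk gk_of_ground // height_of_ground => /hG le.
  exact: leq_trans le (leq_addl _ _).
have d0 : 0 < hdepth (App F ms) by apply: hdepth_gt0.
rewrite -(prednK d0) addSn height_leP; apply/allP => u iu.
have gu := gk_in g iu; case hu: (hole u).
  apply: leq_trans (IH u iu gu) _; rewrite leq_add2r -ltnS prednK //.
  rewrite /=; elim: (ms) iu => //= v s IHs; rewrite inE leq_max => /predU1P [<-|/IHs ->].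
    by rewrite hu leqnn.
  by rewrite orbT.
move/negbT/groundP: hu gu => [g' ->]; rewrite /gk gk_of_ground // height_of_ground => /hG le.
exact: leq_trans le (leq_addl _ _).
Qed.

Let SG : seq Om := flatten [seq symbols g | g <- G].

Lemma okG g : g \in G -> ok [in SG] g.
Proof.
move=> ig; apply: ok_symbols; first exact: wG.
by move=> F iF; apply/flattenP; exists (symbols g) => //; apply: map_f.
Qed.

Let FF := terms SG (kG + kG).

(** As [c] and [c'] lie in G, the values [m ∙ c] and [m ∙ c'] have equally many foreign symbols, and
    their heights differ by at most [kG]. So [t] has no foreign symbol and hole depth at most [kG];
    the second [kG] in [FF] allows for its ground subterms. *)
Lemma component m y t c c' : y \notin G -> c \in G -> c' \in G -> m ∙ c = y -> m ∙ c' = t ∙ y ->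
  gk t -> wf t -> t \in FF.
Proof.
move=> ny ic ic' e e' gt wt; rewrite mem_terms.
case ht: (hole t); last first.
  move/negbT/groundP: ht gt => [g ->]; rewrite /gk gk_of_ground // => ig.
  by rewrite ok_of_ground okG // height_of_ground; apply: leq_trans (hG ig) (leq_addr _ _).
case hm: (hole m); last first.
  suff -> : t = Var tt by [].
  by apply: plug_eqVar (y) ht _; rewrite -e' -e; apply: ground_plug; rewrite hm.
apply/andP; split.
  rewrite -foreign_ok // -leqn0 -(leq_add2r (foreign [in SG] y)) add0n.
  have F0 g : g \in G -> foreign [in SG] g = 0.
    by move=> ig; apply/eqP; rewrite foreign_ok ?okG // wG.
  apply: leq_trans (leq_foreign _ _ ht) _.
  by rewrite -e' (foreign_plug _ (F0 _ ic')) -e (foreign_plug _ (F0 _ ic)).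
apply: leq_trans (height_gk gt) _; rewrite leq_add2r -(leq_add2r (height y)).
apply: leq_trans (height_hdepth y ht) _; rewrite -e' addnC -e.
apply: leq_trans (height_swap m c c') _; rewrite leq_add2l; exact: hG.
Qed.

Definition solv (S : set pair) m y := forall p, S p -> m ∙ p.1 = p.2 ∙ y.
Definition small (S : set pair) := forall p, S p -> [/\ p.1 \in G, gk p.2 & wf p.2].

Definition children (S : set pair) k : set pair :=
  [set p | exists F ts, [/\ S (p.1, App F ts), k < size ts & p.2 = nth (Var tt) ts k]].

Lemma small_children S k : small S -> small (children S k).
Proof.
move=> sS [c t] [F [ts [/sS [/= ic gt wt] lk ->]]]; split=> //; first exact: gk_in gt (mem_nth _ lk).
by move: wt => /= /andP [_ /allP]; apply; apply: mem_nth.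
Qed.

(** By [component], these finitely many lists represent all small systems that contain an equation
    [m ∙ c = y] and are solvable at some big [y]. *)
Let tests : seq (seq pair) := sublists [seq (c, t) | c <- G, t <- FF].

Lemma App_solv S F ds y c F' ts : solv S (App F ds) y -> S (c, App F' ts) ->
  F = F' /\ size ds = size ts /\ forall k, k < size ts -> nth (Var tt) ds k ∙ c = nth (Var tt) ts k ∙ y.
Proof.
move=> sl /sl /= [-> e]; split=> //; have := congr1 size e; rewrite !size_map => es; split=> // k lk.
by have := congr1 (fun s => nth y s k) e; rewrite !(nth_map (Var tt)) // es.
Qed.

Lemma children_solv S F ds y k : solv S (App F ds) y -> solv (children S k) (nth (Var tt) ds k) y.
Proof. by move=> sl [c t] [F' [ts [/= /(App_solv sl) [_ [_ h]] lk ->]]]; apply: h. Qed.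

Lemma test_of S m y c : y \notin G -> small S -> solv S m y -> S (c, Var tt) ->
  exists2 s, s \in tests & forall p, p \in s <-> S p.
Proof.
move=> ny sS sl S0; exists [seq p <- [seq (c, t) | c <- G, t <- FF] | `[< S p >]].
  exact: filter_sublists.
move=> p; rewrite mem_filter; split=> [/andP [/asboolP] //|Sp].
have [ic gt wt] := sS p Sp; have [ic0 _ _] := sS _ S0.
apply/andP; split; first exact/asboolP.
apply/allpairsP; exists (p.1, p.2); split=> //; last by case: (p).
exact: (component ny ic0 ic (sl _ S0) (sl _ Sp) gt wt).
Qed.

Definition covers y y' := forall s, s \in tests ->
  (exists m, solv [set` s] m y) -> exists m, solv [set` s] m y'.

(** Descend into [m] until some equation reads [m ∙ c = y]: the system is then a test, and [covers]
    supplies a solution at [y']. Above such positions the right-hand sides share the root of [m],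
    and solutions for the arguments are put together under it. *)
Lemma transfer y y' : y \notin G -> y' \notin G -> covers y y' ->
  forall m S, small S -> solv S m y -> exists m', solv S m' y'.
Proof.
move=> ny ny' cv; elim/term_ind2 => [[]|F ds IH] S sS sl;
    (case: (pselect (exists c, S (c, Var tt))) => [[c Sc]|nV];
    [have [s it es] := test_of ny sS sl Sc;
     have [|m' sl'] := cv s it;
     [by eexists => p /es; apply: sl|by exists m' => p /es; apply: sl']|]).
  exists (Var tt) => p Sp; have [ic gt wt] := sS p Sp; rewrite (sl p Sp).
  apply: ground_plug; apply/negP => ht.
  have e : p.1 = p.2 ∙ y := sl p Sp.
  by case/negP: ny; apply: (plug_inG Gsub ht); rewrite -e.
have /choice [g hg] k : exists m', k < size ds -> solv (children S k) m' y'.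
  case: (ltnP k (size ds)) => [lk|]; last by exists (Var tt).
  have [m' sl'] := IH _ (mem_nth (Var tt) lk) _ (@small_children S k sS) (children_solv (k := k) sl).
  by exists m'.
exists (App F (mkseq g (size ds))) => -[c [[]|F' ts]] Sp; first by case: nV; exists c.
have [<- [es h]] := App_solv sl Sp; rewrite !plugApp; congr App.
apply: (@eq_from_nth _ y'); rewrite !size_map ?size_iota // => k lk.
rewrite !(nth_map (Var tt)) ?size_mkseq -?es // nth_mkseq //.
have ch : children S k (c, nth (Var tt) ts k) by exists F', ts; rewrite -es.
exact: (hg k lk _ ch).
Qed.

(** The roles are exchanged: a template with a value acts as the equality, and an equation [(c, t)]
    as the point. A basis is thus a finite set of models that refutes every query refuted by some
    model. *)
Definition sat_query (x : template Om * gterm Om) (q : pair) := x.1 ∙ q.1 = q.2 ∙ x.2.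
Definition queries : set pair := [set q | q.1 \notin G /\ gk q.2].

(** For ground [m] a query says that [t] is the hole. For nonground [m] outside [gk] every query
    fails, by [overlap_abst] together with [m ∙ c = y]. For the rest, primary ends lead to word
    equations: one model fixes the end, and 9 is enough for the words. *)
Lemma basis_queries (X : set (template Om * gterm Om)) c : c \in G ->
  (forall x, X x -> x.2 \notin G /\ x.1 ∙ c = x.2) -> exists k, basis sat_query k X queries.
Proof.
move=> ic hX; exists (1 + (1 + 10)).
pose X1 := [set x | X x /\ ~~ hole x.1]; pose X2 := [set x | X x /\ hole x.1 && ~~ gk x.1].
pose X3 := [set x | X x /\ hole x.1 && gk x.1].
have -> : X = X1 `|` (X2 `|` X3).
  apply/seteqP; split=> [x Xx|x [[]|[[]|[]]] //]; rewrite /X1 /X2 /X3 /setU /mkset.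
  by case: (hole _); case: (gk _); [right; right|right; left|left|left].
apply: basisUl; last apply: basisUl.
- case: (pselect (exists x, X1 x)) => [[x Xx]|n]; last by apply: basis0 => p _ e Ee; case: n; exists e.
  exists [:: x]; split=> // [e|[c' t] [/= nc gt] h [m y] [Xm /= hm]]; first by rewrite inE => /eqP ->.
  have /(_ _ _) E z m' : ~~ hole m' -> m' ∙ c' = m' ∙ z by move=> h'; apply: ground_plug.
  have e : x.1 ∙ c' = t ∙ x.2 := h x (mem_head _ _).
  have [nx ex] := hX _ (proj1 Xx); have [ny ey] := hX _ Xm.
  have e' : t ∙ x.2 = x.2 by rewrite -e -ex; apply: ground_plug; case: Xx.
  have ht : hole t by apply: (@plug_big_hole _ G Gsub _ x.2) => //; rewrite e'.
  by rewrite /sat_query (plug_eqVar ht e') /= -[RHS]ey; apply: E.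
- case: (pselect (exists x, X2 x)) => [[x [Xx /andP [hx /negP nx]]]|n]; last by apply: basis0 => p _ e Ee; case: n; exists e.
  apply: (@basis_unsat _ _ _ _ _ _ [:: x]) => // [e|[c' t] [/= nc gt] h].
    by rewrite inE => /eqP ->; split=> //; apply/andP; split=> //; apply/negP.
  have e : x.1 ∙ c' = t ∙ x.2 := h x (mem_head _ _).
  have [ny ey] := hX _ Xx; apply: nx.
  have nc' : c' != c by apply: contraNneq nc => ->.
  have ga := overlap_abst Gsub ny nc nc' gt (gkVar G tt) e ey.
  move: ga; rewrite abst_noocc; first by apply: gk_substK.
  apply/negPn/negP => no; have [_ /(_ hx)] := noocc_size c no.
  by rewrite ey ltnn.
case: (pselect (exists x, X3 x)) => [[x X3x]|n]; last by apply: basis0 => p _ e Ee; case: n; exists e.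
have [Xx /andP [hx gx]] := X3x; have [ny ey] := hX _ Xx.
have [q0 [u [gq0 hq0 pu eu]]] := primary_ex Gsub ny; have [nu _] := pu.
have R (p : pair) : queries p -> sat_query x p -> exists n, [/\ gk n, hole n, p.1 = n ∙ u & hole p.2].
  move=> [nc gt] e; have [n [u' [gn hn pu' ec]]] := primary_ex Gsub nc.
  have ht : hole p.2 by apply: (@plug_big_hole _ G Gsub _ x.2) => //; rewrite -e; apply: plug_big.
  exists n; split=> //; rewrite ec; congr (_ ∙ _).
  apply: (@primary_uniq _ _ Gsub (x.1 ∙ n) (p.2 ∙ q0)); rewrite ?hole_plug //; try exact: gk_plug.
  by rewrite !plugA -ec e eu.
case: (pselect (exists2 x1, X3 x1 & ~ exists q, [/\ gk q, hole q & x1.2 = q ∙ u])) => [[x1 X1x nq]|nn].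
  apply: (@basis_unsat _ _ _ _ _ _ [:: x; x1]) => // [e|p Qp h].
    by rewrite !inE => /orP [] /eqP ->.
  have [n [gn hn ec ht]] := R p Qp (h x (mem_head _ _)).
  have e : x1.1 ∙ p.1 = p.2 ∙ x1.2 by apply: h; rewrite !inE eqxx orbT.
  have [Xx1 /andP [hx1 gx1]] := X1x; have [ny1 ey1] := hX _ Xx1; apply: nq.
  apply: (@primary_right _ _ Gsub p.2 _ (x1.1 ∙ n)) => //; rewrite ?hole_plug //.
  - by case: Qp.
  - exact: gk_plug.
  by rewrite plugA -ec e.
apply: (@basis_cond _ _ _ 9 _ _ [:: x]); first by move=> e; rewrite inE => /eqP ->.
apply: (@basis_words _ _ _ _ _ _ (fun x w => w.1 = x.1 /\ [/\ gk w.2, hole w.2 & x.2 = w.2 ∙ u])) => // [[m y] Xm|p [Qp hp]].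
  have [q [gq hq eq]] : exists q, [/\ gk q, hole q & y = q ∙ u].
    by apply: contrapT => nq; apply: nn; exists (m, y).
  by exists (m, q) => //; split=> //; case: Xm => _ /andP [].
have [n [gn hn ec ht]] := R p Qp (hp x (mem_head _ _)).
exists ((Var tt, n), (p.2, Var tt)) => // [[m y]] [s q] Xm [/= -> [gq hq ->]].
have [_ /andP [/= hm gm]] := Xm; have [_ gt] := Qp.
rewrite /sat_query /word_sat /= ec plug_Var -!plugA.
have -> : Var tt ∙ m = m by [].
by split=> [/(gk_inj Gsub nu)|->] //; apply; apply: gk_plug.
Qed.

Variable Dom : set (gterm Om).
Hypothesis DomG : forall y, Dom y -> y \notin G.

(** Only a lower bound on the solvable tests, which is what [covers] asks for; [type] is the exact
    set. *)
Let class (ta : seq (seq pair)) : set (gterm Om) :=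
  [set y | Dom y /\ forall s, s \in ta -> exists m, solv [set` s] m y].
Let type y := [seq s <- tests | `[< exists m, solv [set` s] m y >]].

Lemma class_covers y y' : class (type y) y' -> covers y y'.
Proof. by move=> [_ h] s it ex; apply: h; rewrite mem_filter it andbT; apply/asboolP. Qed.

Lemma class_type y : Dom y -> class (type y) y.
Proof. by move=> Dy; split=> // s; rewrite mem_filter => /andP [/asboolP]. Qed.

(** The clauses match the ways in which a violation is preserved: equal types serve constants in G,
    where solutions are transferred in both directions; the second serves a fixed left-hand value;
    the third serves big constants at a test and rests on [basis_queries]. *)
Lemma representatives : exists Ys : seq (gterm Om), forall y, Dom y ->
  [/\ exists2 y', y' \in Ys & Dom y' /\ type y' = type y,
      forall t c, t ∙ y <> c -> exists2 y', y' \in Ys & class (type y) y' /\ t ∙ y' <> c &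
      forall s m c t (d : gterm Om), s \in tests -> d \in G -> (d, Var tt) \in s -> solv [set` s] m y ->
        c \notin G -> gk t -> m ∙ c <> t ∙ y ->
        exists y' m', [/\ y' \in Ys, class (type y) y', solv [set` s] m' y' & m' ∙ c <> t ∙ y']].
Proof.
pose types := sublists tests.
have [Y1 h1] : exists Ys : seq (gterm Om), forall ta, ta \in types ->
    forall y, Dom y -> type y = ta -> exists2 y', y' \in Ys & Dom y' /\ type y' = ta.
  apply: (@finite_choice _ _ _ (fun ta Ys => forall y, Dom y -> type y = ta -> exists2 y', y' \in Ys & Dom y' /\ type y' = ta)).
    by move=> ta s s' sub h y Dy ey; have [y' iy' ?] := h y Dy ey; exists y' => //; apply: sub.
  move=> ta _; case: (pselect (exists y, Dom y /\ type y = ta)) => [[y [Dy ey]]|n].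
    by exists [:: y] => y' _ _; exists y; rewrite ?inE.
  by exists [::] => y Dy ey; case: n; exists y.
have [Y2 h2] : exists Ys : seq (gterm Om), forall ta, ta \in types ->
    forall y t c, class ta y -> t ∙ y <> c -> exists2 y', y' \in Ys & class ta y' /\ t ∙ y' <> c.
  apply: (@finite_choice _ _ _ (fun ta Ys => forall y t c, class ta y -> t ∙ y <> c -> exists2 y', y' \in Ys & class ta y' /\ t ∙ y' <> c)).
    by move=> ta s s' sub h y t c Cy n; have [y' iy' ?] := h y t c Cy n; exists y' => //; apply: sub.
  move=> ta _; case: (pselect (exists y1, class ta y1)) => [[y1 C1]|n]; last first.
    by exists [::] => y t c Cy; case: n; exists y.
  (* Two members of the class suffice: a nonground [t] takes the value [c] at no more than one of
     them, and the value of a ground [t] is the same at all. *)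
  case: (pselect (exists y2, class ta y2 /\ y2 <> y1)) => [[y2 [C2 ne]]|n]; last first.
    exists [:: y1] => y t c Cy nt; exists y1; rewrite ?inE //; split=> //.
    suff -> : y1 = y by [].
    by apply: contrapT => ne; apply: n; exists y; split=> // e; apply: ne.
  exists [:: y1; y2] => y t c Cy nt.
  case: (pselect (t ∙ y1 = c)) => [e1|n1]; last by exists y1; rewrite ?inE ?eqxx.
  exists y2; rewrite ?inE ?eqxx ?orbT //; split=> // e2; case ht: (hole t).
    by apply: ne; apply: (plug_injr ht); rewrite e1 e2.
  by apply: nt; rewrite -e1; apply: ground_plug; rewrite ht.
have [Y3 h3] : exists Ys : seq (gterm Om), forall ts : seq (seq pair) * seq pair, ts \in [seq (ta, s) | ta <- types, s <- tests] ->
    forall y m c t (d : gterm Om), d \in G -> (d, Var tt) \in ts.2 -> class ts.1 y -> solv [set` ts.2] m y ->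
        c \notin G -> gk t -> m ∙ c <> t ∙ y ->
        exists y' m', [/\ y' \in Ys, class ts.1 y', solv [set` ts.2] m' y' & m' ∙ c <> t ∙ y'].
  apply: (@finite_choice _ _ _ (fun (ts : seq (seq pair) * seq pair) (Ys : seq (gterm Om)) => forall y m c t (d : gterm Om), d \in G -> (d, Var tt) \in ts.2 -> class ts.1 y -> solv [set` ts.2] m y ->
        c \notin G -> gk t -> m ∙ c <> t ∙ y ->
        exists y' m', [/\ y' \in Ys, class ts.1 y', solv [set` ts.2] m' y' & m' ∙ c <> t ∙ y'])).
    move=> ts s s' sub h y m c t d id ids Cy sl nc gt n.
    have [y' [m' [iy' ? ? ?]]] := h y m c t d id ids Cy sl nc gt n.
    by exists y', m'; split=> //; apply: sub.
  move=> [ta s] _ /=; case: (pselect (exists2 d : gterm Om, d \in G & (d, Var tt) \in s)) => [[d id ids]|n]; last first.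
    by exists [::] => y m c t d id ids; case: n; exists d.
  pose X : set (template Om * gterm Om) := [set x | class ta x.2 /\ solv [set` s] x.1 x.2].
  have [|k [xs [xX _ hx]]] := @basis_queries X d id.
    by move=> x [[Dx _] sl]; split; [exact: DomG|exact: (sl _ ids)].
  exists [seq x.2 | x <- xs] => y m c t _ _ _ Cy sl nc gt n; apply: contrapT => nex; apply: n.
  apply: (hx (c, t) _ _ (m, y)) => // x ix; apply: contrapT => nx; apply: nex.
  by have [Cx sx] := xX x ix; exists x.2, x.1; split=> //; apply: map_f.
exists (Y1 ++ (Y2 ++ Y3)) => y Dy.
have it : type y \in types by apply: filter_sublists.
have Cy := class_type Dy; split.
- by have [y' iy' ?] := h1 _ it y Dy erefl; exists y'; rewrite ?mem_cat ?iy'.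
- move=> t c n; have [y' iy' ?] := h2 _ it y t c Cy n; exists y' => //.
  by rewrite !mem_cat iy' orbT.
move=> s m c t d its id ids sl nc gt n.
have [|y' [m' [iy' ? ? ?]]] := h3 (type y, s) _ y m c t d id ids Cy sl nc gt n.
  by apply/allpairsP; exists (type y, s).
by exists y', m'; split=> //; rewrite !mem_cat iy' !orbT.
Qed.

Section Violation.
Variables (Ys : seq (gterm Om)) (y : gterm Om).
Hypothesis Dy : Dom y.
Hypothesis rep1 : exists2 y', y' \in Ys & Dom y' /\ type y' = type y.
Hypothesis rep2 : forall t c, t ∙ y <> c -> exists2 y', y' \in Ys & class (type y) y' /\ t ∙ y' <> c.
Hypothesis rep3 : forall s m c t (d : gterm Om), s \in tests -> d \in G -> (d, Var tt) \in s -> solv [set` s] m y ->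
  c \notin G -> gk t -> m ∙ c <> t ∙ y ->
  exists y' m', [/\ y' \in Ys, class (type y) y', solv [set` s] m' y' & m' ∙ c <> t ∙ y'].

(** Descend as in [transfer], along an argument where the violation persists. At a test the third
    clause applies; where all right-hand sides of [S] are ground, [m] is kept and the second clause
    applies. *)
Lemma violate_big m (S : set pair) c t : small S -> (exists p, S p) -> solv S m y -> c \notin G -> gk t ->
  m ∙ c <> t ∙ y ->
  exists y' m', [/\ y' \in Ys, class (type y) y', solv S m' y' & m' ∙ c <> t ∙ y'].
Proof.
have ny := DomG Dy.
have rep : exists2 y', y' \in Ys & class (type y) y'.
  have [y' iy' [Dy' ey]] := rep1; exists y' => //; rewrite -ey; exact: class_type.
have gnd m' (S' : set pair) t' : (forall p, S' p -> ~~ hole p.2) -> solv S' m' y -> m' ∙ c <> t' ∙ y ->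
    exists y' m', [/\ y' \in Ys, class (type y) y', solv S' m' y' & m' ∙ c <> t' ∙ y'].
  move=> gr sl vi; have [y' iy' [Cy' vi']] := rep2 (fun e => vi (esym e)).
  exists y', m'; split=> // [p Sp|e]; last exact: vi' (esym e).
  by rewrite (sl p Sp); apply: ground_plug; apply: gr.
elim/term_ind2: m S t => [[]|F ds IH] S t sS [p0 Sp0] sl nc gt vi;
  (case: (pselect (exists c, S (c, Var tt))) => [[d Sd]|nV];
    [have [s it es] := test_of ny sS sl Sd; have [id _ _] := sS _ Sd;
     have [||y' [m' [iy' Cy' sl' vi']]] := rep3 it id _ _ nc gt vi;
     [by apply/es|by move=> p /es; apply: sl|by exists y', m'; split=> // p /es; apply: sl']|]);
  (case: (pselect (forall p, S p -> ~~ hole p.2)) => [gr|];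
    [by apply: gnd gr sl vi|]);
  move=> /existsNP [p1] /not_implyP [Sp1 /negP]; rewrite negbK => h1.
  by case/negP: ny; apply: (plug_inG Gsub h1); rewrite -(sl p1 Sp1); have [] := sS _ Sp1.
have [p1c p1t] : exists c1 t1, p1 = (c1, t1) by case: (p1) => c1 t1; exists c1, t1.
case: p1t => t1 ep1; rewrite {}ep1 in Sp1 h1.
case: t1 Sp1 h1 => [[]|F1 ts1] Sp1 h1; first by case: nV; exists p1c.
have [i1 g1 w1] := sS _ Sp1.
have root y' m' : Dom y' -> solv S m' y' -> exists ds', m' = App F ds' /\ size ds' = size ds.
  move=> Dy' sl'; have [eF [es _]] := App_solv sl Sp1.
  case: m' sl' => [[]|F' ds'] sl'.
    by case/negP: (DomG Dy'); apply: (plug_inG Gsub h1); rewrite -(sl' _ Sp1).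
  by have [eF' [es' _]] := App_solv sl' Sp1; exists ds'; rewrite eF eF' es es'.
(* If [t] is the hole, every solution violates it: otherwise [App F1 ts1 ∙ (m' ∙ c) = m' ∙ p1c] with
   [c] big and [p1c] in G, which [overlap_cnt] excludes when [m'] has a hole, and size when it has
   none. *)
case: t gt vi => [[]|F' es] gt vi.
  have [y' iy' Cy'] := rep; have Dy' := proj1 Cy'.
  have [m' sl'] := transfer ny (DomG Dy') (class_covers Cy') sS sl.
  exists y', m'; split=> // e.
  have e1 : App F1 ts1 ∙ (m' ∙ c) = m' ∙ p1c by rewrite e; apply/esym/(sl' _ Sp1).
  case hm: (hole m'); first by have := overlap_cnt Gsub h1 isT hm nc i1 e1.
  have e2 : App F1 ts1 ∙ (m' ∙ c) = m' ∙ c by rewrite e1; apply: ground_plug; rewrite hm.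
  by have := plug_eqVar h1 e2.
case: (pselect (F' = F /\ size es = size ds)) => [[eF ez]|nm]; last first.
  have [y' iy' Cy'] := rep; have Dy' := proj1 Cy'.
  have [m' sl'] := transfer ny (DomG Dy') (class_covers Cy') sS sl.
  exists y', m'; split=> //; have [ds' [-> es']] := root y' m' Dy' sl'.
  rewrite !plugApp => -[eF e]; apply: nm; split=> //.
  by have := congr1 size e; rewrite !size_map es'.
have [k lk vk] : exists2 k, k < size ds & nth (Var tt) ds k ∙ c <> nth (Var tt) es k ∙ y.
  apply: contrapT => n; apply: vi; rewrite !plugApp eF; congr App.
  apply: (@eq_from_nth _ y); rewrite !size_map // => k lk.
  rewrite !(nth_map (Var tt)) ?ez //; apply: contrapT => nk; apply: n.
  by exists k.
have [||y' [dk [iy' Cy' slk vik]]] := IH _ (mem_nth (Var tt) lk) (children S k) (nth (Var tt) es k)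
   (small_children (k := k) sS) _ (children_solv (k := k) sl) nc _ vk.
- have [_ [es1 _]] := App_solv sl Sp1.
  by exists (p1c, nth (Var tt) ts1 k); exists F1, ts1; rewrite -es1.
- by apply: gk_in gt _; apply: mem_nth; rewrite ez.
have Dy' := proj1 Cy'.
have /choice [g hg] j : exists m', solv (children S j) m' y'.
  exact: (transfer ny (DomG Dy') (class_covers Cy') (small_children (k := j) sS) (children_solv (k := j) sl)).
exists y', (App F (mkseq (fun j => if j == k then dk else g j) (size ds))); split=> //.
  move=> [c' [[]|F2 ts]] Sp; first by case: nV; exists c'.
  have [<- [es2 h]] := App_solv sl Sp; rewrite !plugApp; congr App.
  apply: (@eq_from_nth _ y'); rewrite !size_map ?size_iota // => j lj.
  rewrite !(nth_map (Var tt)) ?size_mkseq -?es2 // nth_mkseq //.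
  have ch : children S j (c', nth (Var tt) ts j) by exists F2, ts; rewrite -es2.
  by case: eqP => [ej|_]; [subst j; apply: (slk _ ch)|apply: (hg j _ ch)].
rewrite !plugApp => -[_] /(congr1 (fun s => nth y' s k)).
by rewrite !(nth_map (Var tt)) ?size_mkseq ?ez // nth_mkseq // eqxx.
Qed.

(** Here [(c, t)] may join the system. If it held at [y'], the enlarged system could be transferred
    back to [y], where two equations determine the template; so [(c, t)] would hold for [m]. *)
Lemma violate_small m (S : set pair) c t p1 p2 : small S -> S p1 -> S p2 -> p1.1 != p2.1 ->
  solv S m y -> c \in G -> gk t -> wf t -> m ∙ c <> t ∙ y ->
  exists y' m', [/\ y' \in Ys, Dom y', solv S m' y' & m' ∙ c <> t ∙ y'].
Proof.
move=> sS S1 S2 nc sl ic gt wt vi; have ny := DomG Dy.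
have [y' iy' [Dy' ey]] := rep1.
have C1 : covers y y' by apply: class_covers; rewrite -ey; apply: class_type.
have C2 : covers y' y by apply: class_covers; rewrite ey; apply: class_type.
have [m' sl'] := transfer ny (DomG Dy') C1 sS sl.
exists y', m'; split=> // e; apply: vi.
pose S' := S `|` [set (c, t)].
have sS' : small S' by move=> p [/sS //|->].
have sl2 : solv S' m' y' by move=> p [/sl' //|->].
have [m2 sl3] := transfer (DomG Dy') ny C2 sS' sl2.
have -> : m = m2.
  apply: (plug_injl2 nc); [rewrite (sl _ S1)|rewrite (sl _ S2)]; apply/esym/sl3; by left.
by apply: (sl3 (c, t)); right.
Qed.

End Violation.

Lemma shrink_small : exists Ys : seq (gterm Om), forall y, Dom y ->
  forall m (S : set pair) c t p1 p2, small S -> S p1 -> S p2 -> p1.1 != p2.1 -> solv S m y ->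
  gk t -> wf t -> m ∙ c <> t ∙ y ->
  exists y' m', [/\ y' \in Ys, Dom y', solv S m' y' & m' ∙ c <> t ∙ y'].
Proof.
have [Ys h] := representatives; exists Ys => y Dy m S c t p1 p2 sS S1 S2 nc sl gt wt vi.
have [r1 r2 r3] := h y Dy.
case ic: (c \in G); first exact: (violate_small Dy r1 sS S1 S2 nc sl ic gt wt vi).
have [|y' [m' [iy' [Dy' _] sl' vi']]] := violate_big Dy r1 r2 r3 sS _ sl (negbT ic) gt vi.
  by exists p1.
by exists y', m'.
Qed.

End SmallConstants.

(** * Small models *)

Section Monadic.
Variable Om : signature.
Implicit Types (m a b d r t : template Om).

(** The dividing line: a symbol of arity at least 2 allows a single equality with incomparable [A]
    and [B]; over unary symbols and constants one equality makes them comparable. *)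
Definition monadic := forall F : Om, arity F <= 1.

Lemma monadic_hole (V : eqType) F (ts : seq (term Om V)) : monadic -> wf (App F ts) -> hole (App F ts) ->
  exists t : term Om V, [/\ ts = [:: t], arity F = 1, wf t & hole t].
Proof.
move=> mo /= /andP [/eqP es w]; rewrite holeApp; have := mo F; rewrite -es.
case: ts es w => [|t [|? ?]] //= es /andP [wt _] _; rewrite orbF => ht.
by exists t.
Qed.

Lemma monadic_gk G m : monadic -> wf m -> hole m -> gk G m.
Proof.
move=> mo; elim/term_ind2: m => [//|F ts IH] w h; rewrite gk_hole //.
have [t [ets _ wt ht]] := monadic_hole mo w h.
by apply/allP => u iu; move: (iu); rewrite ets inE => /eqP eu; apply: IH => //; rewrite eu.
Qed.

Lemma monadic_pow k m : monadic -> (forall F : Om, arity F = 1 -> F = k) -> wf m -> hole m ->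
  exists j, m = fpow j (App k [:: Var tt]).
Proof.
move=> mo one; elim/term_ind2: m => [[]|F ts IH] w h; first by exists 0.
have [t [ets aF wt ht]] := monadic_hole mo w h.
have [|j ej] := IH t _ wt ht; first by rewrite ets inE.
by exists j.+1; rewrite ets ej (one F aF).
Qed.

End Monadic.

(** * Violations of bounded height over a bounded alphabet *)

Section SmallModel.
Variables (Om : signature) (n : nat) (P : program Om n).
Implicit Types (m a b r s t A B : template Om) (g c d h x y z u : gterm Om).
Let G := setG P.
Let R := setR P.
Let gk := @gk Om G.
Notation pair := (gterm Om * template Om)%type.
Let Gsub := @setG_sub Om n P.

Lemma wf_rhs (t : term Om 'I_n) : t \in rhs P -> wf t.
Proof. by move=> /flattenP [_ /mapP [i _ ->] it]; have /andP [] := programP it. Qed.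

Lemma wf_subterms (V : eqType) (t u : term Om V) : wf t -> u \in subterms t -> wf u.
Proof.
elim/term_ind2: t => [v|F ts IH] w; first by rewrite inE => /eqP ->.
rewrite [subterms _]/= inE => /predU1P [-> //|/flattenP [_ /mapP [t it ->] iu]].
have wt : wf t by move: w => /= /andP [_ /allP]; apply.
exact: IH wt iu.
Qed.

Lemma wf_setR g : g \in R -> wf g.
Proof.
rewrite mem_pmap => /mapP [t /wf_rhs w e]; move: w.
by rewrite (to_groundK (esym e)) !wf_ok ok_of_ground.
Qed.

Lemma wf_setG g : g \in G -> wf g.
Proof.
move=> /flattenP [_ /mapP [t +->]]; rewrite mem_filter => /andP [_ /wf_rhs w].
rewrite mem_pmap => /mapP [u /(wf_subterms w) wu e]; move: wu.
by rewrite (to_groundK (esym e)) !wf_ok ok_of_ground.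
Qed.

(** In a nonground term over unary symbols every subterm contains the variable. *)
Lemma monadic_setG : monadic Om -> forall g, g \notin G.
Proof.
move=> mo g; apply/negP => /flattenP [_ /mapP [t +->]]; rewrite mem_filter => /andP [ht /wf_rhs w].
have X (u : term Om 'I_n) : u \in subterms t -> hole u.
  elim/term_ind2: t w ht => [v|F ts IH] w ht; first by rewrite inE => /eqP ->.
  have [t [ets _ wt ht']] := monadic_hole mo w ht.
  rewrite [subterms _]/= inE => /predU1P [-> //|]; rewrite ets /= cats0.
  by apply: IH => //; rewrite ets inE.
rewrite mem_pmap => /mapP [u /X hu e]; move: hu; rewrite (to_groundK (esym e)).
by rewrite /hole of_groundK.
Qed.

Lemma setT_plug m z : gk m -> hole m -> wf m -> setT_ P z -> setT_ P (m ∙ z).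
Proof.
move=> gm hm wm [m' [r [/setMGE [wm' hm' gm'] ir ->]]]; exists (m ∙ m'), r; split=> //.
  apply/setMGE; split; [|by rewrite hole_plug|exact: (gk_plug Gsub)].
  by rewrite !wf_ok in wm wm' *; apply: ok_plug.
by rewrite plugA.
Qed.

Lemma wf_setT z : setT_ P z -> wf z.
Proof.
move=> [m [r [/setMGE [wm _ _] /wf_setR wr ->]]]; rewrite !wf_ok in wm wr *; exact: ok_plug.
Qed.

(** The big values in T. In contrast to L, elements of R outside G are included. *)
Definition Dom : set (gterm Om) := [set y | setT_ P y /\ y \notin G].

Lemma Dom_plug m z : gk m -> hole m -> wf m -> Dom z -> Dom (m ∙ z).
Proof. by move=> gm hm wm [Tz nz]; split; [exact: setT_plug|exact: (plug_big Gsub)]. Qed.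

Lemma exists_bound (T : eqType) (f : T -> nat) (s : seq T) : exists k, forall x : T, x \in s -> f x <= k.
Proof.
elim: s => [|x s [k h]]; first by exists 0.
exists (maxn (f x) k) => z; rewrite inE leq_max => /predU1P [->|/h ->]; rewrite ?leqnn ?orbT //.
Qed.

Variable x0 : gterm Om.
Hypothesis Lx0 : setL P x0.

Lemma Dom_x0 : Dom x0.
Proof. by split; [case: Lx0|exact: setL_big]. Qed.

Lemma positive_arity : exists F : Om, 0 < arity F.
Proof.
case: Lx0 => -[m [r [/setMGE [wm hm _] ir ->]]]; rewrite mem_setS.
case: m wm hm => [[]|F ts] wm hm; first by have -> : Var tt ∙ r = r by []; rewrite ir orbT.
move=> _; exists F; move: wm hm => /= /andP [/eqP <- _]; rewrite holeApp.
by case: ts.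
Qed.

Variables (kG kR kY : nat) (S0 : seq Om) (Ys : seq (gterm Om)).
Hypothesis hG : forall g, g \in G -> height g <= kG.
Hypothesis hR : forall g, g \in R -> height g <= kR.
Hypothesis hY : forall y, y \in Ys -> height y <= kY.
Hypothesis hx0 : height x0 <= kY.
Variable F1 : Om.
Hypothesis aF1 : 0 < arity F1.
Hypothesis SG : forall g, g \in G -> ok [in S0] g.
Hypothesis SY : forall y, y \in Ys -> ok [in S0] y.
Hypothesis Sx0 : ok [in S0] x0.
Hypothesis SF1 : F1 \in S0.
Hypothesis S2 : ~ monadic Om -> exists2 F, F \in S0 & 1 < arity F.
(** Whenever there are two unary symbols, [S0] keeps two: [monadic_swap] needs a letter different
    from the root of a given template. *)
Hypothesis S1 : forall F F' : Om, arity F = 1 -> arity F' = 1 -> F <> F' ->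
  exists H H' : Om, [/\ H \in S0, H' \in S0, H <> H', arity H = 1 & arity H' = 1].
Hypothesis hYs : forall y, Dom y ->
  forall m (S : set pair) c t p1 p2, small G S -> S p1 -> S p2 -> p1.1 != p2.1 -> solv S m y ->
  gk t -> wf t -> m ∙ c <> t ∙ y ->
  exists y' m', [/\ y' \in Ys, Dom y', solv S m' y' & m' ∙ c <> t ∙ y'].

Variable Q : pred Om.
Hypothesis SQ : forall F, F \in S0 -> Q F.

Lemma okS (V : eqType) (t : term Om V) : ok [in S0] t -> ok Q t.
Proof. exact: ok_sub. Qed.

Lemma violate_none c d : exists A B,
  [/\ hole A, hole B, ok Q A & ok Q B] /\ [/\ height A <= 1, height B <= 1 & A ∙ c <> B ∙ d].
Proof.
case: (eqVneq c d) => [<-|/eqP ne]; last by exists (Var tt), (Var tt).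
pose A : template Om := App F1 (nseq (arity F1) (Var tt)).
have hA : hole A by rewrite holeApp has_nseq aF1.
exists A, (Var tt); split; split=> //.
- by rewrite okApp SQ // size_nseq eqxx all_nseq orbT.
- by rewrite height_leP all_nseq orbT.
by move=> e; have := tsize_plug_lt c hA isT; rewrite e ltnn.
Qed.

(** [A = F (•, d, ..., d)] and [B = F (c, •, ..., •)] agree at [c] and [d] and, comparing arguments,
    at no other pair. *)
Lemma violate_one c d c0 d0 : ~ monadic Om -> ok Q c -> ok Q d -> (c, d) <> (c0, d0) ->
  exists A B, [/\ hole A, hole B, ok Q A & ok Q B] /\
   [/\ height A <= (height d).+1, height B <= (height c).+1, A ∙ c = B ∙ d & A ∙ c0 <> B ∙ d0].
Proof.
move=> nm oc od ne; have [F iF] := S2 nm; case ar: (arity F) => [|[|k]] // _.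
pose A : template Om := App F (Var tt :: nseq k.+1 (of_ground unit d)).
pose B : template Om := App F (of_ground unit c :: nseq k.+1 (Var tt)).
have EA z : A ∙ z = App F (z :: nseq k.+1 d).
  by rewrite plugApp /= map_nseq plug_ground of_ground_void.
have EB z : B ∙ z = App F (c :: nseq k.+1 z).
  by rewrite plugApp /= map_nseq plug_ground of_ground_void.
exists A, B; rewrite !EA !EB; split; split=> //.
- by rewrite holeApp /= ?orbT.
- by rewrite okApp SQ //= size_nseq ar eqxx /= !ok_of_ground od /= all_nseq ok_of_ground od orbT.
- by rewrite okApp SQ //= size_nseq ar eqxx /= !ok_of_ground oc /= all_nseq orbT.
- by rewrite height_leP /= height_of_ground leqnn /= all_nseq height_of_ground leqnn orbT.
- by rewrite height_leP /= height_of_ground leqnn /= all_nseq orbT.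
by move=> [e1 e2 _]; apply: ne; rewrite e1 e2.
Qed.

Lemma comparable_monadic A B c d : monadic Om -> wf A -> wf B -> hole A -> hole B -> A ∙ c = B ∙ d ->
  (exists2 dl, hole dl & A = B ∙ dl) \/ (exists2 dl, hole dl & B = A ∙ dl).
Proof.
move=> mo wA wB hA hB e; have nG := monadic_setG mo.
case: (gk_levi Gsub hA hB (monadic_gk G mo wA hA) (monadic_gk G mo wB hB) (nG c) (nG d) e) => [[r [hr _ -> _]]|[r [hr _ -> _]]].
  by right; exists r.
by left; exists r.
Qed.

Lemma wf_plugl m u : wf (m ∙ u) -> wf m.
Proof. by rewrite !wf_ok; apply: ok_plugl. Qed.

(* A template that commutes with every one-letter word
   commutes with every word. *)
Lemma monadic_swap c0 t0 c1 t1 r : monadic Om -> hole t0 -> hole t1 -> hole r -> wf r ->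
  ok Q t0 -> ok Q t1 -> t1 ∙ (r ∙ c0) <> t0 ∙ (r ∙ c1) ->
  exists r', [/\ hole r', ok Q r', height r' <= 1 & t1 ∙ (r' ∙ c0) <> t0 ∙ (r' ∙ c1)].
Proof.
move=> mo h0 h1 hr wr o0 o1 ne; apply: contrapT => nex.
have nG := monadic_setG mo; have gm m : ok Q m -> hole m -> gk m.
  by move=> om hm; apply: monadic_gk => //; apply: ok_wf om.
have gr : gk r by apply: monadic_gk.
have H r' : hole r' -> ok Q r' -> height r' <= 1 -> t1 ∙ (r' ∙ c0) = t0 ∙ (r' ∙ c1).
  by move=> h o l; apply: contrapT => n'; apply: nex; exists r'.
suff X t t' c c' : hole t -> hole t' -> ok Q t -> ok Q t' ->
    (forall r', hole r' -> ok Q r' -> height r' <= 1 -> t ∙ (r' ∙ c) = t' ∙ (r' ∙ c')) ->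
    (exists d : template Om, [/\ hole d, gk d, t' = t ∙ d & c = d ∙ c']) -> t ∙ (r ∙ c) = t' ∙ (r ∙ c').
  have e0 : t1 ∙ c0 = t0 ∙ c1 := H (Var tt) isT isT isT.
  case: (gk_levi Gsub h1 h0 (gm _ o1 h1) (gm _ o0 h0) (nG c0) (nG c1) e0) => ex.
    by apply: ne; apply: X.
  by apply: ne; apply/esym; apply: X => // r' a b c; apply/esym; apply: H.
move=> ht ht' ot ot' Ht [d [hd gd et ec]].
have com r' : hole r' -> ok Q r' -> height r' <= 1 -> r' ∙ d = d ∙ r'.
  move=> hr' or' lr'; have := Ht r' hr' or' lr'; rewrite et ec plugA => /(plug_injr ht).
  rewrite -plugA -[d ∙ (r' ∙ c')]plugA => /(gk_inj Gsub (nG c')); apply.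
    by apply: (gk_plug Gsub) => //; apply: gm.
  by apply: (gk_plug Gsub) => //; apply: gm.
suff dr : r ∙ d = d ∙ r by rewrite et ec plugA -[d ∙ (r ∙ c')]plugA -dr plugA.
have od : ok Q d by apply: (ok_plugr ht); rewrite -et.
case: d hd gd et ec com od => [[]|k ds] hd gd et ec com od; first by rewrite plug_Var.
have wd := ok_wf od; have [d' [eds ak wd' hd']] := monadic_hole mo wd hd.
case: (pselect (forall F, arity F = 1 -> F = k)) => [one|].
  have [i ->] := monadic_pow mo one wr hr; have [j ->] := monadic_pow mo one wd hd.
  by rewrite -!fpowD addnC.
move=> /existsNP [F] /not_implyP [aF nF].
have [F2 [iF2 nF2 aF2]] : exists F2, [/\ F2 \in S0, F2 <> k & arity F2 = 1].
  have [H1 [H2 [i1 i2 n12 a1 a2]]] := S1 aF ak nF.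
  case: (pselect (H1 = k)) => [e1|n1]; last by exists H1.
  by exists H2; split=> // e2; apply: n12; rewrite e1 e2.
have := com (App F2 [:: Var tt]); rewrite holeApp /= SQ // aF2 => /(_ isT isT isT).
by rewrite plugApp => -[].
Qed.

(** If [A = B ∙ dl], the pair [(dl, •)] can replace [(A, B)], and any equation [dl ∙ c = d] bounds
    [dl]. Comparability comes from two equalities or from a monadic signature; in the remaining
    cases [violate_none] or [violate_one] gives templates, at the price of one more level. *)
Lemma bound_templates (C : set (gterm Om * gterm Om)) c0 d0 A B H :
  (forall e, C e -> [/\ ok Q e.1, ok Q e.2, height e.1 <= H & height e.2 <= H]) ->
  hole A -> hole B -> wf A -> wf B -> (forall e, C e -> A ∙ e.1 = B ∙ e.2) -> A ∙ c0 <> B ∙ d0 ->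
  exists A' B', [/\ hole A', hole B', ok Q A' & ok Q B'] /\
    [/\ height A' <= H.+1, height B' <= H.+1, forall e, C e -> A' ∙ e.1 = B' ∙ e.2 & A' ∙ c0 <> B' ∙ d0].
Proof.
move=> hC hA hB wA wB sC vi.
case: (pselect (exists e, C e)) => [[e1 C1]|nC]; last first.
  have [A' [B' [h [l1 l2 v]]]] := violate_none c0 d0; exists A', B'; split=> //; split=> //.
  - exact: leq_trans l1 _.
  - exact: leq_trans l2 _.
  by move=> e Ce; case: nC; exists e.
have [oc od lc ld] := hC _ C1.
have fin : (exists2 dl, hole dl & A = B ∙ dl) \/ (exists2 dl, hole dl & B = A ∙ dl) ->
   exists A' B', [/\ hole A', hole B', ok Q A' & ok Q B'] /\
    [/\ height A' <= H.+1, height B' <= H.+1, forall e, C e -> A' ∙ e.1 = B' ∙ e.2 & A' ∙ c0 <> B' ∙ d0].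
  case=> [[dl hd eA]|[dl hd eB]].
    have S e : C e -> dl ∙ e.1 = e.2 by move=> Ce; apply: (plug_injr hB); rewrite -sC // eA plugA.
    exists dl, (Var tt); split; split=> //.
    - by apply: (@ok_plugl _ _ _ _ e1.1); rewrite S.
    - by apply: leqW; apply: leq_trans (height_plugl dl e1.1) _; rewrite S.
    by move=> e; apply: vi; rewrite eA plugA e.
  have S e : C e -> e.1 = dl ∙ e.2 by move=> Ce; apply: (plug_injr hA); rewrite sC // eB plugA.
  exists (Var tt), dl; split; split=> //.
  - by apply: (@ok_plugl _ _ _ _ e1.2); rewrite -S.
  - by apply: leqW; apply: leq_trans (height_plugl dl e1.2) _; rewrite -S.
  by move=> e; apply: vi; rewrite eB plugA -e.
case: (pselect (monadic Om)) => [mo|nm].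
  by apply: fin; apply: (comparable_monadic mo wA wB hA hB (sC _ C1)).
case: (pselect (forall e, C e -> e = e1)) => [one|].
  have [|A' [B' [h [l1 l2 s v]]]] := @violate_one e1.1 e1.2 c0 d0 nm oc od.
    by move=> e; apply: vi; have := sC _ C1; case: e => -> ->.
  exists A', B'; split=> //; split=> // [||e /one -> //].
    by apply: leq_trans l1 _.
  by apply: leq_trans l2 _.
move=> /existsNP [e2] /not_implyP [C2 ne]; apply: fin.
have nc : e1.1 != e2.1.
  apply/eqP => ec; apply: ne; rewrite (surjective_pairing e1) (surjective_pairing e2) ec; congr (_, _).
  by apply: (plug_injr hB); rewrite -(sC _ C1) -(sC _ C2) ec.
case: (levi2 hA hB nc (sC _ C1) (sC _ C2)) => [[dl hd [eB _ _]]|[dl hd [eA _ _]]].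
  by right; exists dl.
by left; exists dl.
Qed.

(** The product is the bound [(J + 2) * (N + kG)] of [shrink_big]; [kY] is for [x0] and the
    representatives, and [N.+1] for a constant under one more letter in the monadic case. *)
Definition bnd N := (2 * N + kG + kR + 4) * (N + kG) + (kY + N.+1).

Lemma bnd_N N : N <= bnd N.
Proof. by apply: leq_trans (leq_addl _ _); rewrite addnS leqW // leq_addl. Qed.

Lemma bnd_Y N : kY <= bnd N.
Proof. exact: leq_trans (leq_addr _ _) (leq_addl _ _). Qed.

(** The last clause is for monadic signatures, where the new value of [y] may be built on the
    constant of an equality and has to lie in T. *)
Definition eqC N (e : pair) := [/\ gk e.2, hole e.2, ok Q e.2 & height e.2 <= N] /\
  [/\ ok Q e.1, height e.1 <= N & monadic Om -> setT_ P e.1].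

(** If [B] extends [A], then [y] is part of a constant and short already. If [A = B ∙ dl], the new
    pair is [(dl', •)], obtained from [shrink_big] when some constant is big and from the
    representatives otherwise. A single equality is left to [violate_one] or [monadic_swap]. *)
Lemma small_value_const N (E : set pair) e0 A B y :
  (forall e, E e \/ e = e0 -> eqC N e) -> hole A -> hole B -> wf A -> wf B -> Dom y ->
  (forall e, E e -> A ∙ e.1 = B ∙ (e.2 ∙ y)) -> A ∙ e0.1 <> B ∙ (e0.2 ∙ y) ->
  exists A' B' y', [/\ hole A', hole B', wf A', wf B' & Dom y'] /\
    [/\ forall e, E e -> A' ∙ e.1 = B' ∙ (e.2 ∙ y'), A' ∙ e0.1 <> B' ∙ (e0.2 ∙ y'),
       ok Q y' & height y' <= bnd N].
Proof.
move=> hE hA hB wA wB Dy sE vi; have [Ty ny] := Dy; have [Tx nx] := Dom_x0.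
have hxN : height x0 <= bnd N by apply: leq_trans hx0 (bnd_Y N).
have ox : ok Q x0 := okS Sx0.
have [[g0 h0 o0 l0] [oc0 lc0 Tc0]] := hE e0 (or_intror erefl).
case: (pselect (exists e, E e)) => [[e1 E1]|nE]; last first.
  have [A' [B' [[hA' hB' oA oB] [_ _ v]]]] := violate_none e0.1 (e0.2 ∙ x0).
  exists A', B', x0; split; split=> //; try exact: (ok_wf oA); try exact: (ok_wf oB); try exact: Dom_x0.
  by move=> e Ee; case: nE; exists e.
have [[g1 h1 o1 l1] [oc1 lc1 Tc1]] := hE e1 (or_introl E1).
have S1' := sE _ E1.
have two e : E e -> e <> e1 -> e.1 != e1.1.
  move=> Ee ne; apply/eqP => ec; apply: ne; have [[ge _ _ _] _] := hE e (or_introl Ee).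
  rewrite (surjective_pairing e) (surjective_pairing e1) ec; congr (_, _).
  by apply: (gk_inj Gsub ny ge g1); apply: (plug_injr hB); rewrite -S1' -(sE _ Ee) ec.
have cmp : (exists2 e2, E e2 & e2 <> e1) \/ monadic Om ->
    (exists2 dl, hole dl & A = B ∙ dl) \/ (exists2 dl, hole dl & B = A ∙ dl).
  case=> [[e2 E2 n2]|mo].
    have nc := two _ E2 n2.
    case: (levi2 hA hB nc (sE _ E2) S1') => [[dl hd [eB _ _]]|[dl hd [eA _ _]]].
      by right; exists dl.
    by left; exists dl.
  have nG := monadic_setG mo.
  have hBt : hole (B ∙ e1.2) by rewrite hole_plug.
  have gA := monadic_gk G mo wA hA.
  have gBt : gk (B ∙ e1.2) by apply: (gk_plug Gsub) => //; apply: monadic_gk.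
  have := S1'; rewrite -plugA => e; case: (gk_levi Gsub hA hBt gA gBt (nG _) ny e) => [[r [hr gr er _]]|[r [hr gr er _]]].
    case: (levi hB hA h1 hr er) => [[s hs [es _]]|[s hs [es _]]]; [left|right]; by exists s.
  by left; exists (e1.2 ∙ r); rewrite ?hole_plug // er plugA.
case: (pselect (exists2 e2, E e2 & e2 <> e1)) => [ex2|n2]; last first.
  have one e : E e -> e = e1 by move=> Ee; apply: contrapT => ne; apply: n2; exists e.
  case: (pselect (monadic Om)) => [mo|nm]; last first.
    have [||A' [B' [[hA' hB' oA oB] [_ _ s v]]]] := @violate_one e1.1 (e1.2 ∙ x0) e0.1 (e0.2 ∙ x0) nm oc1.
    - exact: ok_plug.
    - move=> [ec et]; apply: vi; rewrite -ec.
      by have -> : e0.2 = e1.2 by apply: (gk_inj Gsub nx).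
    exists A', B', x0; split; split=> //; try exact: (ok_wf oA); try exact: (ok_wf oB); try exact: Dom_x0.
    by move=> e /one ->.
  have nG := monadic_setG mo; have Tc := Tc1 mo.
  case: (cmp (or_intror mo)) => [[dl hd eA]|[dl hd eB]]; last first.
    have ec : e1.1 = dl ∙ (e1.2 ∙ y) by apply: (plug_injr hA); rewrite S1' eB plugA.
    exists A, B, y; split; split=> //.
      by apply: (ok_plugr h1); apply: (ok_plugr hd); rewrite -ec.
    apply: leq_trans (bnd_N N); apply: leq_trans lc1; rewrite ec.
    exact: leq_trans (height_plugr y h1) (height_plugr _ hd).
  have ec : dl ∙ e1.1 = e1.2 ∙ y by apply: (plug_injr hB); rewrite -S1' eA plugA.
  have wd : wf dl by move: wA; rewrite eA !wf_ok; apply: ok_plugr.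
  have gd := monadic_gk G mo wd hd.
  case: (gk_levi Gsub hd h1 gd g1 (nG e1.1) ny ec) => [[r [hr gr er ey]]|[r [hr gr er ey]]].
    exists A, B, y; split; split=> //.
      by apply: (ok_plugr hr); rewrite -ey.
    by apply: leq_trans (bnd_N N); apply: leq_trans lc1; rewrite ey height_plugr.
  have wr : wf r by move: wd; rewrite er !wf_ok; apply: ok_plugr.
  have vr : e1.2 ∙ (r ∙ e0.1) <> e0.2 ∙ (r ∙ e1.1).
    by move=> e; apply: vi; rewrite eA er !plugA e ey.
  have [r' [hr' or' lr' vr']] := monadic_swap mo h0 h1 hr wr o0 o1 vr.
  have wr' := ok_wf or'.
  exists (e1.2 ∙ r'), (Var tt), (r' ∙ e1.1); split; split=> //.
  - by rewrite hole_plug.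
  - by apply: (@ok_wf _ Q); apply: ok_plug.
  - exact: (@Dom_plug r' e1.1 (monadic_gk G mo wr' hr') hr' wr' (conj Tc (nG e1.1))).
  - by move=> e /one ->; rewrite plugA.
  - by rewrite plugA.
  - exact: ok_plug.
  apply: leq_trans (height_plug _ _) _; apply: (@leq_trans (1 + N)); first exact: leq_add.
  by apply: leq_trans (leq_addl _ _); rewrite add1n leq_addl.
have [e2 E2 n2] := ex2; have nc := two _ E2 n2.
case: (cmp (or_introl ex2)) => [[dl hd eA]|[dl hd eB]]; last first.
  have ec : e1.1 = dl ∙ (e1.2 ∙ y) by apply: (plug_injr hA); rewrite S1' eB plugA.
  exists A, B, y; split; split=> //.
    by apply: (ok_plugr h1); apply: (ok_plugr hd); rewrite -ec.
  apply: leq_trans (bnd_N N); apply: leq_trans lc1; rewrite ec.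
  exact: leq_trans (height_plugr y h1) (height_plugr _ hd).
have sd e : E e -> dl ∙ e.1 = e.2 ∙ y by move=> Ee; apply: (plug_injr hB); rewrite -sE // eA plugA.
have vd : dl ∙ e0.1 <> e0.2 ∙ y by move=> e; apply: vi; rewrite eA plugA e.
have wfin dl' y' : wf y' -> dl' ∙ e1.1 = e1.2 ∙ y' -> wf dl'.
  move=> wy e; apply: (@wf_plugl _ e1.1); rewrite e !wf_ok in wy *; apply: ok_plug wy.
  by rewrite -wf_ok; apply: ok_wf o1.
case: (pselect (exists2 e, E e & e.1 \notin G)) => [[e E3 nc3]|allG].
  have [e' E4 nc4] : exists2 e', E e' & e.1 != e'.1.
    case: (eqVneq e.1 e1.1) => [ee|ne]; last by exists e1.
    by exists e2; rewrite // ee eq_sym.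
  have [|dl' [y' [[hd' ny' sd' vd'] [ly' oy' hy']]]] :=
      @shrink_big _ G kG kR Gsub hG E e0 e e' dl y N ny _ hd sd vd E3 E4 nc3 nc4.
    by move=> e'' /hE [[? ? ? ?] [? ? ?]].
  have Dy' : Dom y'.
    (* [y'] is a part of [y = m ∙ r]; being taller than all of R, it still has [r] below it, hence
       it lies in T. *)
    case: hy' => [->//|[g [hg gg ey lt]]]; split=> //.
    have [m [r [/setMGE [wm hm gm] ir em]]] := Ty.
    have [|||e'' [h'' g'' o'' ey'']] := @down_T _ G Gsub predT g y' m r gg hg gm _ ny'.
    - by rewrite -wf_ok.
    - by apply: leq_ltn_trans lt; apply: hR.
    - by rewrite -ey em.
    by exists e'', r; split=> //; apply/setMGE; rewrite wf_ok.
  exists dl', (Var tt), y'; split; split=> //.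
  - by apply: (wfin _ y'); [apply: wf_setT; case: Dy'|apply: sd'].
  - apply: oy' => [g ig|e'' Ee]; first by apply: okS; apply: SG.
    by have [[_ _ -> _] [-> _ _]] := hE e'' (or_introl Ee).
  have eb : 2 * N + kG + kR + 4 = 2 * N + kG + kR + 2 + 2 by rewrite -[RHS]addnA.
  by apply: leq_trans ly' _; rewrite /bnd eb; apply: leq_addr.
have sS : small G E.
  move=> e Ee; have [[ge he oe _] _] := hE e (or_introl Ee); split=> //; last exact: ok_wf oe.
  by apply: contrapT => /negP ne; apply: allG; exists e.
have [y' [dl' [iy' Dy' sd' vd']]] := hYs Dy sS E2 E1 nc sd g0 (ok_wf o0) vd.
have nt : e2.2 <> e1.2.
  move=> et; case/eqP: nc; apply: (plug_injr hd); by rewrite (sd _ E1) (sd _ E2) et.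
(* A ground [dl'] would give two different templates of M_G the same value at the big term [y']. *)
have hd' : hole dl'.
  apply: contraT => nh; case: nt.
  have [[ge2 _ _ _] _] := hE e2 (or_introl E2).
  apply: (gk_inj Gsub (proj2 Dy') ge2 g1); rewrite -(sd' _ E1) -(sd' _ E2).
  exact: ground_plug.
exists dl', (Var tt), y'; split; split=> //.
- by apply: (wfin _ y'); [apply: wf_setT; case: Dy'|apply: sd'].
- by apply: okS; apply: SY.
by apply: leq_trans (hY iy') (bnd_Y N).
Qed.

Notation vpair := (template Om * template Om)%type.
Definition eqV N (e : vpair) := [/\ gk e.1, hole e.1, ok Q e.1 & height e.1 <= N] /\
  [/\ gk e.2, hole e.2, ok Q e.2 & height e.2 <= N].
Definition bnd2 N := bnd (N + kY) + N.

Lemma bnd2_N N : N + kY <= bnd2 N.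
Proof. by apply: leq_trans (bnd_N _) (leq_addr _ _). Qed.

(** [same] stands for the two variables being equal. If [x = r ∙ y], then [r] is a factor of the
    short [t1], and [y] may be replaced by [x0]. If [y = r ∙ x], then [r] may be long: with [x0] for
    [x] the left-hand sides become constants, and [small_value_const] shortens [r ∙ x0]. For equal
    variables [r] is the hole. *)
Lemma small_value_vars_half N (E : set vpair) e0 e1 A B dl x y (same : Prop) :
  (forall e, E e \/ e = e0 -> eqV N e) -> E e1 -> hole A -> hole B -> wf A -> wf B -> Dom x -> Dom y ->
  (same -> x = y) -> (exists2 e2, E e2 & e2 <> e1) \/ monadic Om -> hole dl -> A = B ∙ dl ->
  (forall e, E e -> A ∙ (e.1 ∙ x) = B ∙ (e.2 ∙ y)) -> A ∙ (e0.1 ∙ x) <> B ∙ (e0.2 ∙ y) ->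
  exists A' B' x' y', [/\ hole A', hole B', wf A', wf B' & Dom x'] /\ [/\ Dom y', same -> x' = y',
    forall e, E e -> A' ∙ (e.1 ∙ x') = B' ∙ (e.2 ∙ y'), A' ∙ (e0.1 ∙ x') <> B' ∙ (e0.2 ∙ y') &
       [/\ ok Q x', ok Q y', height x' <= bnd2 N & height y' <= bnd2 N]].
Proof.
move=> hE E1 hA hB wA wB Dx Dy sxy ex2 hd eA sE vi.
have [Tx nx] := Dx; have [Ty ny] := Dy; have [Tx0 nx0] := Dom_x0.
have ox : ok Q x0 := okS Sx0.
have hxN : height x0 <= bnd2 N by apply: leq_trans hx0 _; apply: leq_trans (bnd2_N N); apply: leq_addl.
have [[gs1 hs1 os1 ls1] [gt1 ht1 ot1 lt1]] := hE e1 (or_introl E1).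
have [[gs0 hs0 os0 ls0] [gt0 ht0 ot0 lt0]] := hE e0 (or_intror erefl).
have sd e : E e -> dl ∙ (e.1 ∙ x) = e.2 ∙ y by move=> Ee; apply: (plug_injr hB); rewrite -sE // eA plugA.
have vd : dl ∙ (e0.1 ∙ x) <> e0.2 ∙ y by move=> e; apply: vi; rewrite eA plugA e.
have [o [D [[go io gD hD ed] H]]] : exists o (D : template Om), [/\ gk o, true \in vars o, gk D, hole D &
    dl = inst o D (of_ground unit y)] /\ forall e, E e -> exists t', [/\ gk t', hole t', t' ∙ y = D ∙ (e.1 ∙ x) & e.2 = inst o t' (Var tt)].
  case: ex2 => [[e2 E2 n2]|mo]; last first.
    exists (Var true), dl; split=> [|e Ee].
      split=> //; apply: monadic_gk => //.
      by move: wA; rewrite eA !wf_ok; apply: ok_plugr.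
    have [_ [gt ht _ _]] := hE e (or_introl Ee); exists e.2; split=> //.
    by rewrite sd.
  have [[gs2 hs2 _ _] [gt2 ht2 _ _]] := hE e2 (or_introl E2).
  have nc : e1.1 ∙ x != e2.1 ∙ x.
    apply/eqP => es; apply: n2; rewrite (surjective_pairing e1) (surjective_pairing e2); congr (_, _).
      by apply: (gk_inj Gsub nx).
    by apply: (gk_inj Gsub ny gt2 gt1); rewrite -(sd _ E2) -(sd _ E1) es.
  have nc1 : e1.1 ∙ x \notin G by apply: (plug_big Gsub).
  have ga := overlap_abst Gsub ny nc1 nc gt1 gt2 (sd _ E1) (sd _ E2).
  have [o [D [[go io gD hD ed] H]]] := skeleton Gsub ga hd.
  exists o, D; split=> // e Ee; have [[gs hs _ _] [gt ht _ _]] := hE e (or_introl Ee).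
  apply: H => //; first by apply: (plug_big Gsub hD); apply: (plug_big Gsub hs).
  by rewrite -(sd _ Ee) [in RHS]ed inst_plug plug_ground of_ground_void.
have DE c : dl ∙ c = inst o (D ∙ c) y by rewrite {1}ed inst_plug plug_ground of_ground_void.
have [t1 [g1 h1 et1 ee1]] := H _ E1.
have l1 : height t1 <= N.
  apply: leq_trans lt1; rewrite [in X in _ <= X]ee1.
  exact: (height_subst_in (fun b : bool => if b then t1 else Var tt) io).
have o1 : ok Q t1.
  by move: ot1; rewrite ee1; apply: (ok_subst_in (s := fun b : bool => if b then t1 else Var tt) io).
pose dl' y' := inst o D (of_ground unit y').
have DE' y' c : dl' y' ∙ c = inst o (D ∙ c) y' by rewrite inst_plug plug_ground of_ground_void.
have hd' y' : hole (dl' y').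
  exact: (hole_subst_in (s := fun b : bool => if b then D else of_ground unit y') io).
have wfin x' y' : wf y' -> dl' y' ∙ (e1.1 ∙ x') = e1.2 ∙ y' -> wf (dl' y').
  move=> wy e; apply: (@wf_plugl _ (e1.1 ∙ x')); rewrite e !wf_ok in wy *; apply: ok_plug wy.
  by rewrite -wf_ok; apply: ok_wf ot1.
have hDs : hole (D ∙ e1.1) by rewrite hole_plug.
have gDs : gk (D ∙ e1.1) by apply: (gk_plug Gsub).
have eq : (D ∙ e1.1) ∙ x = t1 ∙ y by rewrite plugA et1.
case: (gk_levi Gsub hDs h1 gDs g1 nx ny eq) => [[r [hr gr er ey]]|[r [hr gr er ey]]].
  have orr : ok Q r by apply: (ok_plugr hDs); rewrite -er.
  have Dx' : Dom (r ∙ x0) by apply: Dom_plug => //; exact: ok_wf orr.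
  have S' e : E e -> dl' x0 ∙ (e.1 ∙ (r ∙ x0)) = e.2 ∙ x0.
    move=> Ee; have [t' [gt' ht' et' ee']] := H _ Ee; have [[gs hs _ _] _] := hE e (or_introl Ee).
    suff q : D ∙ (e.1 ∙ (r ∙ x0)) = t' ∙ x0 by rewrite DE' q [in RHS]ee' inst_plug.
    have -> : t' = D ∙ (e.1 ∙ r); last by rewrite !plugA.
    apply: (gk_inj Gsub ny gt'); last by rewrite et' ey !plugA.
    by apply: (gk_plug Gsub) => //; [apply: (gk_plug Gsub)|rewrite hole_plug].
  exists (dl' x0), (Var tt), (r ∙ x0), x0; split; split=> //.
  - by apply: (wfin (r ∙ x0)); [apply: wf_setT|apply: S'].
  - move=> /sxy exy; have := plug_eqVar hr (etrans (esym ey) exy).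
    by move=> ->.
  - rewrite DE' => e; apply: vd; rewrite DE ey.
    have E0 : inst o (D ∙ (e0.1 ∙ r)) (Var tt) = e0.2.
      apply: (gk_inj Gsub nx0) => //; last by rewrite inst_plug !plugA.
      apply: gk_inst => //; last by rewrite !hole_plug.
      by apply: (gk_plug Gsub) => //; [apply: (gk_plug Gsub)|rewrite hole_plug].
    by rewrite -E0 inst_plug !plugA.
  split=> //; first exact: ok_plug.
  apply: leq_trans (height_plug _ _) _; apply: leq_trans (bnd2_N N); apply: leq_add => //.
  by apply: leq_trans l1; rewrite er height_plugr.
have wr : wf r.
  by apply: (@wf_plugl _ x); rewrite -ey; apply: wf_setT.
have Dy' : Dom (r ∙ x0) by apply: Dom_plug => //; exact: Dom_x0.
have S' e : E e -> dl' (r ∙ x0) ∙ (e.1 ∙ x0) = e.2 ∙ (r ∙ x0).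
  move=> Ee; have [t' [gt' ht' et' ee']] := H _ Ee; have [[gs hs _ _] _] := hE e (or_introl Ee).
  suff q : D ∙ (e.1 ∙ x0) = t' ∙ (r ∙ x0) by rewrite DE' q [in RHS]ee' inst_plug.
  have et : t' ∙ r = D ∙ e.1; last by rewrite -!plugA et.
  apply: (gk_inj Gsub nx); [exact: (gk_plug Gsub)|exact: (gk_plug Gsub)|].
  by rewrite !plugA -ey et'.
have V' : dl' (r ∙ x0) ∙ (e0.1 ∙ x0) <> e0.2 ∙ (r ∙ x0).
  rewrite DE' => e; apply: vd; rewrite DE ey.
  have E0 : inst o (D ∙ e0.1) r = e0.2 ∙ r.
    apply: (gk_inj Gsub nx0); last by rewrite inst_plug !plugA.
      by apply: gk_inst => //; [apply: (gk_plug Gsub)|rewrite hole_plug].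
    exact: (gk_plug Gsub).
  by rewrite -[RHS]plugA -E0 inst_plug plugA.
have wd' : wf (dl' (r ∙ x0)) by apply: (wfin x0); [apply: wf_setT; case: Dy'|apply: S'].
case: (pselect same) => [ss|ns].
  have rV : r = Var tt by have := ey; rewrite -{1}(sxy ss) => /esym /(plug_eqVar hr).
  exists (dl' (r ∙ x0)), (Var tt), x0, (r ∙ x0); split; split=> //; try exact: Dom_x0.
  - by rewrite rV.
  by rewrite rV.
pose E' : set pair := [set e | exists2 e', E e' & e = (e'.1 ∙ x0, e'.2)].
have [|||A' [B' [y' [[hA' hB' wA' wB' Dy''] [s' v' oy' ly']]]]] :=
    @small_value_const (N + kY) E' (e0.1 ∙ x0, e0.2) (dl' (r ∙ x0)) (Var tt) (r ∙ x0) _ (hd' _) isT wd' isT Dy'.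
- have X e : eqV N e -> eqC (N + kY) (e.1 ∙ x0, e.2).
    move=> [[gs hs os ls] [gt ht ot lt]]; split; split=> //=.
    - exact: leq_trans lt (leq_addr _ _).
    - exact: ok_plug.
    - by apply: leq_trans (height_plug _ _) _; apply: leq_add.
    by move=> _; apply: setT_plug => //; apply: ok_wf os.
  by move=> e [[e' Ee ->]|->]; apply: X; [apply: hE; left|apply: hE; right].
- by move=> e [e' Ee ->]; apply: S'.
- exact: V'.
exists A', B', x0, y'; split; split=> //; try exact: Dom_x0.
- by move=> e Ee; apply: (s' (e.1 ∙ x0, e.2)); exists e.
split=> //; apply: leq_trans ly' _; exact: leq_addr.
Qed.

Lemma small_value_vars N (E : set vpair) e0 A B x y (same : Prop) :
  (forall e, E e \/ e = e0 -> eqV N e) -> hole A -> hole B -> wf A -> wf B -> Dom x -> Dom y ->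
  (same -> x = y) ->
  (forall e, E e -> A ∙ (e.1 ∙ x) = B ∙ (e.2 ∙ y)) -> A ∙ (e0.1 ∙ x) <> B ∙ (e0.2 ∙ y) ->
  exists A' B' x' y', [/\ hole A', hole B', wf A', wf B' & Dom x'] /\ [/\ Dom y', same -> x' = y',
    forall e, E e -> A' ∙ (e.1 ∙ x') = B' ∙ (e.2 ∙ y'), A' ∙ (e0.1 ∙ x') <> B' ∙ (e0.2 ∙ y') &
       [/\ ok Q x', ok Q y', height x' <= bnd2 N & height y' <= bnd2 N]].
Proof.
move=> hE hA hB wA wB Dx Dy sxy sE vi.
have [Tx nx] := Dx; have [Ty ny] := Dy; have [Tx0 nx0] := Dom_x0.
have ox : ok Q x0 := okS Sx0.
have hxN : height x0 <= bnd2 N by apply: leq_trans hx0 _; apply: leq_trans (bnd2_N N); apply: leq_addl.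
have [[gs0 hs0 os0 ls0] [gt0 ht0 ot0 lt0]] := hE e0 (or_intror erefl).
case: (pselect (exists e, E e)) => [[e1 E1]|nE]; last first.
  have [A' [B' [[hA' hB' oA oB] [_ _ v]]]] := violate_none (e0.1 ∙ x0) (e0.2 ∙ x0).
  exists A', B', x0, x0; split; split=> //; try exact: (ok_wf oA); try exact: (ok_wf oB); try exact: Dom_x0.
  by move=> e Ee; case: nE; exists e.
have [[gs1 hs1 os1 ls1] [gt1 ht1 ot1 lt1]] := hE e1 (or_introl E1).
have S1' := sE _ E1.
case: (pselect ((exists2 e2, E e2 & e2 <> e1) \/ monadic Om)) => [ex2|n2]; last first.
  have one e : E e -> e = e1.
    by move=> Ee; apply: contrapT => ne; apply: n2; left; exists e.
  have nm : ~ monadic Om by move=> mo; apply: n2; right.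
  have [|A' [B' [[hA' hB' oA oB] [_ _ s v]]]] :=
      @violate_one (e1.1 ∙ x0) (e1.2 ∙ x0) (e0.1 ∙ x0) (e0.2 ∙ x0) nm (ok_plug os1 ox) (ok_plug ot1 ox).
    move=> [es et]; apply: vi.
    have -> : e0.1 = e1.1 by apply: (gk_inj Gsub nx0).
    by have -> : e0.2 = e1.2 by apply: (gk_inj Gsub nx0).
  exists A', B', x0, x0; split; split=> //; try exact: (ok_wf oA); try exact: (ok_wf oB); try exact: Dom_x0.
  by move=> e /one ->.
have cmp : (exists2 dl, hole dl & A = B ∙ dl) \/ (exists2 dl, hole dl & B = A ∙ dl).
  case: ex2 => [[e2 E2 n2]|mo].
    have [[gs2 hs2 _ _] [gt2 ht2 _ _]] := hE e2 (or_introl E2).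
    have nc : e1.1 ∙ x != e2.1 ∙ x.
      apply/eqP => es; apply: n2; rewrite (surjective_pairing e1) (surjective_pairing e2); congr (_, _).
        by apply: (gk_inj Gsub nx).
      by apply: (gk_inj Gsub ny gt2 gt1); apply: (plug_injr hB); rewrite -(sE _ E2) -S1' es.
    case: (levi2 hA hB nc S1' (sE _ E2)) => [[dl hd [eB _ _]]|[dl hd [eA _ _]]].
      by right; exists dl.
    by left; exists dl.
  have hAs : hole (A ∙ e1.1) by rewrite hole_plug.
  have hBt : hole (B ∙ e1.2) by rewrite hole_plug.
  have gAs : gk (A ∙ e1.1) by apply: (gk_plug Gsub) => //; apply: monadic_gk.
  have gBt : gk (B ∙ e1.2) by apply: (gk_plug Gsub) => //; apply: monadic_gk.
  have := S1'; rewrite -!plugA => e; case: (gk_levi Gsub hAs hBt gAs gBt nx ny e) => [[r [hr gr er _]]|[r [hr gr er _]]].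
    rewrite plugA in er; have hsr : hole (e1.1 ∙ r) by rewrite hole_plug.
    case: (levi hB hA ht1 hsr er) => [[s hs [es _]]|[s hs [es _]]]; [left|right]; by exists s.
  rewrite plugA in er; have htr : hole (e1.2 ∙ r) by rewrite hole_plug.
  case: (levi hA hB hs1 htr er) => [[s hs [es _]]|[s hs [es _]]]; [right|left]; by exists s.
case: cmp => [[dl hd eA]|[dl hd eB]].
  exact: (small_value_vars_half hE E1 hA hB wA wB Dx Dy sxy ex2 hd eA sE vi).
pose sw (e : vpair) : vpair := (e.2, e.1).
have swK e : sw (sw e) = e by case: e.
have [||||||A' [B' [x' [y' [[hA' hB' wA' wB' Dx'] [Dy' sxy' s' v' [oa ob la lb]]]]]]] :=
  @small_value_vars_half N [set e | E (sw e)] (sw e0) (sw e1) B A dl y x same _ _ hB hA wB wA Dy Dx _ _ hd eB.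
- move=> e he; have [h1 h2] : eqV N (sw e); last by split.
  by apply: hE; case: he => [|->]; [left|right; rewrite swK].
- by rewrite /mkset swK.
- by move=> /sxy.
- case: ex2 => [[e2 E2 n2]|]; [left|by right].
  by exists (sw e2); rewrite /mkset ?swK // => e; apply: n2; rewrite -(swK e2) e swK.
- by move=> [s t] /= Ee; apply/esym/(sE (t, s)).
- by move=> e; apply: vi.
exists B', A', y', x'; split; split=> //.
- by move=> /sxy'.
- by move=> [s t] Ee; apply/esym/(s' (t, s)).
by move=> e; apply: v'.
Qed.

(** A side of a two-variable equality has at most one variable, so one value for each side describes
    an assignment. *)
Definition eval u (t : term Om 'I_n) : gterm Om := subst (fun=> u) t.

Lemma eval_plug u m (x : 'I_n) : eval u (m ∙ Var x) = m ∙ u.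
Proof. by rewrite /eval /plug subst_comp. Qed.

Lemma eval_ground u g : eval u (of_ground _ g) = g.
Proof. by rewrite /eval subst_of_ground of_ground_void. Qed.

Lemma ok_eval u (t : term Om 'I_n) : ok Q t -> ok Q u -> ok Q (eval u t).
Proof.
move=> ot ou; rewrite /eval; elim/term_ind2: t ot => [//|F ts IH].
rewrite [subst _ _]/= !okApp size_map all_map => /and3P [-> -> /allP a]; apply/allP => t it.
by apply: IH => //; apply: a.
Qed.

Lemma height_eval u (t : term Om 'I_n) : height (eval u t) <= height t + height u.
Proof.
rewrite /eval; elim/term_ind2: t => [//|F ts IH].
rewrite [subst _ _]/= [height _ + _]addSn.
have X := @height_in Om _ F ts; rewrite height_leP all_map; apply/allP => t it /=.
by apply: leq_trans (IH t it) _; rewrite leq_add2r -ltnS; apply: X.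
Qed.

(** [u] belongs to the left-hand sides, [v] to the right-hand sides; for the formats F_{x,x} the
    condition [u = v] is stated separately. *)
Definition violation (E : set (equality Om n)) e0 A B u v :=
  [/\ hole A, hole B, wf A & wf B] /\
  ((forall e, E e -> A ∙ eval u e.1 = B ∙ eval v e.2) /\ A ∙ eval u e0.1 <> B ∙ eval v e0.2).

Lemma violation_swap (E : set (equality Om n)) e0 A B u v :
  violation E e0 A B u v -> violation [set e | E (e.2, e.1)] (e0.2, e0.1) B A v u.
Proof.
move=> [[hA hB wA wB] [s vi]]; split=> //; split=> [e /s /= -> //|e]; exact: vi.
Qed.

Lemma violation_eval (E : set (equality Om n)) e0 A B u v u' v' :
  (forall e, E e \/ e = e0 -> eval u' e.1 = eval u e.1 /\ eval v' e.2 = eval v e.2) ->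
  violation E e0 A B u v -> violation E e0 A B u' v'.
Proof.
move=> h [hw [s vi]]; split=> //; split=> [e Ee|].
  by have [-> ->] := h e (or_introl Ee); apply: s.
by have [-> ->] := h e0 (or_intror erefl).
Qed.

Definition value u := setT_ P u \/ u \in setS P.

Lemma setR_setT g : g \in R -> setT_ P g.
Proof. by move=> ig; exists (Var tt), g; split=> //; apply/setMGE. Qed.

Lemma value_Dom u : value u -> u \notin G -> Dom u.
Proof. by move=> [|]; rewrite ?mem_setS => // /orP [->//|/setR_setT]. Qed.

Lemma Dom_value u : Dom u -> value u.
Proof. by case; left. Qed.

Lemma setG_value u : u \in G -> value u.
Proof. by move=> iu; right; rewrite mem_setS iu. Qed.

Definition const_side N u (t : term Om 'I_n) :=
  [/\ ok Q (eval u t), height (eval u t) <= N & monadic Om -> setT_ P (eval u t)].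
Definition var_side N (t : term Om 'I_n) :=
  exists m (z : 'I_n), [/\ t = m ∙ Var z, setMG P m, ok Q m & height m <= N].

Lemma const_value N (E : set (equality Om n)) e0 A B u y :
  (forall e, E e \/ e = e0 -> const_side N u e.1 /\ var_side N e.2) ->
  violation E e0 A B u y -> Dom y ->
  exists A' B' y', [/\ violation E e0 A' B' u y', Dom y', ok Q y' & height y' <= bnd N].
Proof.
move=> hE [[hA hB wA wB] [sE vi]] Dy.
have [[o0 l0 T0] [t0 [z0 [e0E /setMGE [_ h0 g0] ot0 lt0]]]] := hE e0 (or_intror erefl).
pose E' : set pair := [set p | exists e (z : 'I_n),
  [/\ E e, p.1 = eval u e.1, e.2 = p.2 ∙ Var z & [/\ setMG P p.2, ok Q p.2 & height p.2 <= N]]].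
have [|||A' [B' [y' [[hA' hB' wA' wB' Dy'] [s' v' oy ly]]]]] :=
    @small_value_const N E' (eval u e0.1, t0) A B y _ hA hB wA wB Dy.
- move=> p [[e [z [Ee p1 p2 [/setMGE [_ h g] ot lt]]]]|->] //.
  by have [[o l T] _] := hE e (or_introl Ee); split; rewrite ?p1.
- by move=> p [e [z [Ee -> p2 _]]]; rewrite sE // p2 eval_plug.
- by move: vi; rewrite e0E eval_plug.
exists A', B', y'; split=> //; split=> //; split=> [e Ee|].
  have [_ [t [z [eE gt ot lt]]]] := hE e (or_introl Ee).
  by rewrite eE eval_plug; apply: (s' (eval u e.1, t)); exists e, z.
by rewrite e0E eval_plug.
Qed.

Hypothesis leGY : kG <= kY.

Definition bounded N (e : equality Om n) := [/\ ok Q e.1, ok Q e.2, height e.1 <= N & height e.2 <= N].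
Definition good N u := [/\ value u, ok Q u & height u <= bnd2 N].

Lemma leGbnd N : kG <= bnd2 N.
Proof. by apply: leq_trans leGY (leq_trans (leq_addl _ _) (bnd2_N N)). Qed.

Lemma leYbnd N : bnd (N + kY) <= bnd2 N.
Proof. exact: leq_addr. Qed.

Lemma good_setG N u : u \in G -> good N u.
Proof.
move=> iu; split; [exact: setG_value|exact/okS/SG|exact: leq_trans (hG iu) (leGbnd N)].
Qed.

Lemma good_x0 N : good N x0.
Proof.
split; [exact/Dom_value/Dom_x0|exact: okS|].
by apply: leq_trans hx0 (leq_trans (leq_addl _ _) (bnd2_N N)).
Qed.

Lemma good_Dom N y : Dom y -> ok Q y -> height y <= bnd (N + kY) -> good N y.
Proof. by move=> Dy oy ly; split=> //; [exact: Dom_value|exact: leq_trans ly (leYbnd N)]. Qed.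

Lemma var_side_plug N m (z : 'I_n) : setMG P m -> ok Q (m ∙ Var z) -> height (m ∙ Var z) <= N -> var_side (N + kY) (m ∙ Var z).
Proof.
move=> gm om lm; exists m, z; split=> //; first exact: ok_plugl om.
by apply: leq_trans (height_plugl m (Var z)) (leq_trans lm (leq_addr _ _)).
Qed.

Lemma const_side_setG N u m (z : 'I_n) : u \in G -> ok Q (m ∙ Var z) -> height (m ∙ Var z) <= N -> const_side (N + kY) u (m ∙ Var z).
Proof.
move=> iu om lm; split.
- by apply: ok_eval => //; exact/okS/SG.
- by apply: leq_trans (height_eval _ _) (leq_add lm (leq_trans (hG iu) leGY)).
by move=> mo; have := monadic_setG mo u; rewrite iu.
Qed.

Lemma const_side_ground N u (s : gterm Om) : value s -> ok Q (of_ground 'I_n s) -> height (of_ground 'I_n s) <= N ->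
  const_side (N + kY) u (of_ground 'I_n s).
Proof.
rewrite ok_of_ground height_of_ground => vs os ls; split; rewrite eval_ground //.
  exact: leq_trans ls (leq_addr _ _).
by move=> mo; have [] := value_Dom vs (monadic_setG mo s).
Qed.

Lemma model_const N (E : set (equality Om n)) e0 A B u v :
  (forall e, E e \/ e = e0 -> (forall u, const_side (N + kY) u e.1) /\
     (exists2 s : gterm Om, e.1 = of_ground _ s & value s) /\ exists m (z : 'I_n), [/\ e.2 = m ∙ Var z, setMG P m, ok Q e.2 & height e.2 <= N]) ->
  violation E e0 A B u v -> value v ->
  exists A' B' u' v', [/\ violation E e0 A' B' u' v', good N u' & good N v'].
Proof.
move=> hE V Vv.
have V0 : violation E e0 A B x0 v.
  by apply: violation_eval V => e /hE [_ [[s -> _] _]]; rewrite !eval_ground.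
case iv: (v \in G); first by exists A, B, x0, v; split=> //; [exact: good_x0|exact: good_setG].
have [|A' [B' [y' [V' Dy' oy ly]]]] := @const_value (N + kY) _ _ _ _ _ _ _ V0 (value_Dom Vv (negbT iv)).
  move=> e /hE [c [_ [m [z [em gm om lm]]]]]; split; first exact: c.
  by rewrite em in om lm *; exact: var_side_plug.
by exists A', B', x0, y'; split=> //; [exact: good_x0|exact: good_Dom].
Qed.

(** A side whose variable has a value in G is a constant, so [const_value] can shorten the other
    one; with both values big, [small_value_vars] applies. The other formats have a constant side
    from the start, up to exchanging the sides. *)
Lemma model N (F : format Om n) (E : set (equality Om n)) e0 A B u v :
  (forall e, E e \/ e = e0 -> of_format P F e /\ bounded N e) ->
  violation E e0 A B u v -> value u -> value v -> (forall x : 'I_n, F = FVV Om x x -> u = v) ->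
  exists A' B' u' v', [/\ violation E e0 A' B' u' v', good N u', good N v' & forall x : 'I_n, F = FVV Om x x -> u' = v'].
Proof.
have con (Y : 'I_n) (C : term Om 'I_n -> Prop) (E' : set (equality Om n)) e' A' B' u' v' :
    (forall t : term Om 'I_n, C t -> exists2 s : gterm Om, t = of_ground _ s & value s) ->
    (forall e, E' e \/ e = e' -> [/\ C e.1, exists2 m, setMG P m & e.2 = m ∙ Var Y & bounded N e]) ->
    violation E' e' A' B' u' v' -> value v' ->
    exists A' B' u' v', [/\ violation E' e' A' B' u' v', good N u' & good N v'].
  move=> hC hE' V' Vv'; apply: (model_const _ V' Vv') => e /hE' [/hC [s es vs] [m gm em] [o1 o2 l1 l2]].
  split; first by move=> u''; rewrite es; apply: const_side_ground; rewrite -?es.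
  by split; [exists s|exists m, Y].
have valL (s : gterm Om) : setL P s -> value s by case; left.
have valS (s : gterm Om) : s \in setS P -> value s by right.
have sw (E' : set (equality Om n)) e' : 
    (exists A' B' u' v', [/\ violation [set e | E' (e.2, e.1)] (e'.2, e'.1) A' B' u' v', good N u' & good N v']) ->
    exists A' B' u' v', [/\ violation E' e' A' B' u' v', good N u' & good N v'].
  move=> [A' [B' [u' [v' [/violation_swap V' gu gv]]]]]; exists B', A', v', u'; split=> //.
  have eE : [set e | [set e0 | E' (e0.2, e0.1)] (e.2, e.1)] = E'.
    by rewrite predeqE => -[].
  by rewrite eE in V'; case: (e') V'.
case: F => [x y|y|s0 y|x|x s0] hE V Vu Vv hs.
- have side e : E e \/ e = e0 -> exists s t, [/\ setMG P s, setMG P t, e = (s ∙ Var x, t ∙ Var y) & bounded N e].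
    by move=> /hE [[s [t [gs gt ee]]] be]; exists s, t.
  case iu: (u \in G); case iv: (v \in G).
  + exists A, B, u, v; split=> //; exact: good_setG.
  + have [|A' [B' [y' [V' Dy' oy ly]]]] := @const_value (N + kY) _ _ _ _ _ _ _ V (value_Dom Vv (negbT iv)).
      move=> e /side [s [t [gs gt -> [/= o1 o2 l1 l2]]]]; split; first exact: const_side_setG.
      exact: var_side_plug.
    exists A', B', u, y'; split=> //; [exact: good_setG|exact: good_Dom|].
    by move=> z /hs uv; move: iu; rewrite uv iv.
  + have [|A' [B' [y' [V' Dy' oy ly]]]] := @const_value (N + kY) _ _ _ _ _ _ _ (violation_swap V) (value_Dom Vu (negbT iu)).
      move=> [e2 e1] he; have /side [s [t [gs gt [-> ->] [/= o1 o2 l1 l2]]]] : E (e1, e2) \/ (e1, e2) = e0.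
        by case: he => [|[-> ->]]; [left|right; case: (e0)].
      split; first exact: const_side_setG.
      exact: var_side_plug.
    have [|A2 [B2 [u2 [v2 [V2 gu gv]]]]] := sw E e0.
      by exists A', B', v, y'; split=> //; [exact: good_setG|exact: good_Dom].
    exists B', A', y', v; split=> //; [|exact: good_Dom|exact: good_setG|].
      have := violation_swap V'; rewrite /violation /= => -[h [s' v']]; split=> //; split=> // e Ee.
      by apply: s'; rewrite /mkset -surjective_pairing.
    by move=> z /hs uv; move: iv; rewrite -uv iu.
  have [[hA hB wA wB] [sE vi]] := V.
  pose E' : set vpair := [set p | [/\ E (p.1 ∙ Var x, p.2 ∙ Var y), setMG P p.1 & setMG P p.2]].
  have [s0 [t0 [gs0 gt0 ee0 [os0 ot0 ls0 lt0]]]] := side e0 (or_intror erefl).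
  have [||||A' [B' [x' [y' [[hA' hB' wA' wB' Dx'] [Dy' sxy s' v' [ox oy lx ly]]]]]]] :=
    @small_value_vars N E' (s0, t0) A B u v (x = y) _ hA hB wA wB (value_Dom Vu (negbT iu)) (value_Dom Vv (negbT iv)).
  + have X p : setMG P p.1 -> setMG P p.2 -> bounded N (p.1 ∙ Var x, p.2 ∙ Var y) -> eqV N p.
      move=> /setMGE [_ h1 g1] /setMGE [_ h2 g2] [/ok_plugl o1 /ok_plugl o2 l1 l2]; split; split=> //.
        exact: leq_trans (height_plugl _ _) l1.
      exact: leq_trans (height_plugl _ _) l2.
    move=> p [[Ep g1 g2]|->]; apply: X => //; first by have [] := hE _ (or_introl Ep).
    by rewrite /= -ee0; split.
  + by move=> exy; apply: (hs x); rewrite exy.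
  + by move=> p [/sE Ep _ _]; move: Ep; rewrite !eval_plug.
  + by move: vi; rewrite ee0 !eval_plug.
  exists A', B', x', y'; split; [|split=> //; exact: Dom_value|split=> //; exact: Dom_value|].
    split=> //; split=> [e Ee|]; last by rewrite ee0 !eval_plug.
    have [s1 [t1 [gs1 gt1 ee1 _]]] := side e (or_introl Ee); rewrite ee1 !eval_plug.
    by apply: (s' (s1, t1)); split=> //; rewrite -ee1.
  by move=> z [exz eyz]; apply: sxy; rewrite exz eyz.
- have [||A' [B' [u' [v' [V' gu gv]]]]] := con y (fun t : term Om 'I_n => exists2 s : gterm Om, t = of_ground _ s & setL P s) _ _ _ _ _ _ _ _ V Vv.
    by move=> t [s -> /valL]; exists s.
    by move=> e /hE [[s [t [Ls gt ->]]] be]; split=> //; [exists s|exists t].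
  by exists A', B', u', v'.
- have [||A' [B' [u' [v' [V' gu gv]]]]] := con y (fun t : term Om 'I_n => exists2 s : gterm Om, t = of_ground _ s & s \in setS P) _ _ _ _ _ _ _ _ V Vv.
    by move=> t [s -> /valS]; exists s.
    by move=> e /hE [[t [Ls gt ->]] be]; split=> //; [exists s0|exists t].
  by exists A', B', u', v'.
- have [|A' [B' [u' [v' [V' gu gv]]]]] := sw E e0; last by exists A', B', u', v'.
  apply: (con x (fun t : term Om 'I_n => exists2 s : gterm Om, t = of_ground _ s & setL P s) _ _ _ _ _ _ _ _ (violation_swap V) Vu).
    by move=> t [s -> /valL]; exists s.
  move=> [e2 e1] he; have /hE [[t [s [gt Ls [-> ->]]]] [/= ? ? ? ?]] : E (e1, e2) \/ (e1, e2) = e0.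
    by case: he => [|[-> ->]]; [left|right; case: (e0)].
  by split=> //; [exists s|exists t].
have [|A' [B' [u' [v' [V' gu gv]]]]] := sw E e0; last by exists A', B', u', v'.
apply: (con x (fun t : term Om 'I_n => exists2 s : gterm Om, t = of_ground _ s & s \in setS P) _ _ _ _ _ _ _ _ (violation_swap V) Vu).
  by move=> t [s -> /valS]; exists s.
move=> [e2 e1] he; have /hE [[t [gt Ls [-> ->]]] [/= ? ? ? ?]] : E (e1, e2) \/ (e1, e2) = e0.
  by case: he => [|[-> ->]]; [left|right; case: (e0)].
by split=> //; [exists s0|exists t].
Qed.

(** First the values, then the templates, whose bound depends on the heights of the values. *)
Lemma model_bounded N (F : format Om n) (E : set (equality Om n)) e0 A B u v :
  (forall e, E e \/ e = e0 -> of_format P F e /\ bounded N e) ->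
  violation E e0 A B u v -> value u -> value v -> (forall x : 'I_n, F = FVV Om x x -> u = v) ->
  exists A' B' u' v', [/\ violation E e0 A' B' u' v', good N u', good N v' & forall x : 'I_n, F = FVV Om x x -> u' = v'] /\
   [/\ ok Q A', ok Q B', height A' <= (N + bnd2 N).+1 & height B' <= (N + bnd2 N).+1].
Proof.
move=> hE V Vu Vv hs; have [A1 [B1 [u' [v' [[[hA hB wA wB] [s' vi']] gu gv hs']]]]] := model hE V Vu Vv hs.
have [_ ou lu] := gu; have [_ ov lv] := gv.
have [|e [e' Ee ->]|A' [B' [[hA' hB' oA oB] [lA lB s'' v'']]]] :=
    @bound_templates [set p | exists2 e, E e & p = (eval u' e.1, eval v' e.2)] (eval u' e0.1) (eval v' e0.2) A1 B1
      (N + bnd2 N) _ hA hB wA wB _ vi'.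
- move=> p [e Ee ->] /=; have [_ [o1 o2 l1 l2]] := hE e (or_introl Ee).
  split; try exact: ok_eval; apply: leq_trans (height_eval _ _) _; exact: leq_add.
- exact: s'.
exists A', B', u', v'; split=> //; split=> //; split; first by split=> //; [exact: ok_wf oA|exact: ok_wf oB].
by split=> // e Ee; apply: (s'' (eval u' e.1, eval v' e.2)); exists e.
Qed.

End SmallModel.

(** * Approximate subsumption as the absence of violations *)

Section Violations.
Variables (Om : signature) (n : nat) (P : program Om n).

Lemma format_assignment (F : format Om n) (u v : gterm Om) : (forall x : 'I_n, F = FVV Om x x -> u = v) ->
  exists X : 'I_n -> gterm Om, (forall z, X z = u \/ X z = v) /\
    forall e, of_format P F e -> subst X e.1 = eval u e.1 /\ subst X e.2 = eval v e.2.
Proof.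
have pl (X : 'I_n -> gterm Om) m x : subst X (m ∙ Var x) = m ∙ X x by rewrite /plug subst_comp.
have gr (X : 'I_n -> gterm Om) (g : gterm Om) : subst X (of_ground _ g) = g.
  by rewrite subst_of_ground of_ground_void.
case: F => [x y|y|s0 y|x|x s0] h.
- exists (fun z => if z == x then u else v); split=> [z|e [s [t [_ _ ->]]]]; first by case: eqP; [left|right].
  by rewrite !pl !eval_plug eqxx; split=> //; case: eqP => // exy; rewrite (h x) // exy.
- by exists (fun=> v); split=> [z|e [s [t [_ _ ->]]]]; [right|rewrite pl gr eval_plug eval_ground].
- by exists (fun=> v); split=> [z|e [t [_ _ ->]]]; [right|rewrite pl gr eval_plug eval_ground].
- by exists (fun=> u); split=> [z|e [s [t [_ _ ->]]]]; [left|rewrite pl gr eval_plug eval_ground].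
- by exists (fun=> u); split=> [z|e [t [_ _ ->]]]; [left|rewrite pl gr eval_plug eval_ground].
Qed.

Lemma format_values (F : format Om n) (X : 'I_n -> gterm Om) : (forall z, value P (X z)) ->
  (exists e, of_format P F e) ->
  exists u v, [/\ value P u, value P v, forall x : 'I_n, F = FVV Om x x -> u = v &
    forall e, of_format P F e -> subst X e.1 = eval u e.1 /\ subst X e.2 = eval v e.2].
Proof.
move=> hX [e0].
have pl m x : subst X (m ∙ Var x) = m ∙ X x by rewrite /plug subst_comp.
have gr (g : gterm Om) : subst X (of_ground _ g) = g by rewrite subst_of_ground of_ground_void.
case: F => [x y|y|s0 y|x|x s0] _.
- exists (X x), (X y); split=> // [z [-> ->] //|e [s [t [_ _ ->]]]].
  by rewrite !pl !eval_plug.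
- by exists (X y), (X y); split=> // e [s [t [_ _ ->]]]; rewrite pl gr eval_plug eval_ground.
- by exists (X y), (X y); split=> // e [t [_ _ ->]]; rewrite pl gr eval_plug eval_ground.
- by exists (X x), (X x); split=> // e [s [t [_ _ ->]]]; rewrite pl gr eval_plug eval_ground.
- by exists (X x), (X x); split=> // e [t [_ _ ->]]; rewrite pl gr eval_plug eval_ground.
Qed.

(** Values in T and S are realized by a substitution that takes over the small ones, followed by an
    assignment into L for the rest; the variables substituted away receive the arbitrary element
    [x0] of L. *)
Lemma approx_violation (x0 : gterm Om) (E E' : set (equality Om n)) : setL P x0 ->
  approx_subsumes P E E' <->
  forall F e0 A B u v, E' e0 -> of_format P F e0 -> value P u -> value P v ->
    (forall x : 'I_n, F = FVV Om x x -> u = v) -> ~ violation (E `&` of_format P F) e0 A B u v.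
Proof.
move=> Lx0; split=> [ap F e0 A B u v E0 F0 Vu Vv h [[hA hB wA wB] [sE vi]]|nv].
  have [X [hX eX]] := format_assignment h.
  have VX z : value P (X z) by case: (hX z) => ->.
  pose s z : term Om 'I_n := if X z \in setS P then of_ground _ (X z) else Var z.
  pose b := Assignment A B (fun z => if X z \in setS P then x0 else X z).
  have Es t : subst (valX b) (subst s t) = subst X t.
    rewrite subst_comp; apply: eq_subst => z; rewrite /s; case: ifP => iz.
      by rewrite subst_of_ground of_ground_void.
    by rewrite /= iz.
  have sats e : sat b (subst_eq s e) <-> A ∙ subst X e.1 = B ∙ subst X e.2.
    by rewrite /sat /= !Es.
  have tA : is_template A by rewrite /is_template wA -hole_vars.
  have tB : is_template B by rewrite /is_template wB -hole_vars.
  have inL : assignment_in (setL P) b.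
    split=> // z /=; case: ifPn => // nz; split=> //.
    by case: (VX z) => // iz; rewrite iz in nz.
  have sm : small_subst P s.
    by move=> z; rewrite /s; case: ifP => iz; [right; exists (X z)|left].
  have [all _] := ap s F sm b inL.
  apply: vi; have [<- <-] := eX _ F0; apply/sats; apply: all.
    move=> _ [e [Ee Fe] <-]; apply/sats; have [-> ->] := eX _ Fe; exact: sE.
  by right; exists e0.
apply: approx_subsumesI => F a tA tB hX sa e [E'e Fe].
have [|u [v [Vu Vv h eX]]] := @format_values F _ hX; first by exists e.
apply: contrapT => ns; apply: (nv F e (valA a) (valB a) u v E'e Fe Vu Vv h).
move: tA tB; rewrite /is_template -!hole_vars => /andP [wA hA] /andP [wB hB].
split=> //; split=> [e' [Ee' Fe']|].
  by have [<- <-] := eX _ Fe'; apply: sa.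
by have [<- <-] := eX _ Fe.
Qed.

(** [S0] and [K] depend on the program only. Their existence is classical, which is enough because
    the procedure is chosen after the program. *)
Lemma small_model (x0 : gterm Om) : setL P x0 ->
  exists (S0 : seq Om) K, forall (S : seq Om) N (F : format Om n) (E : set (equality Om n)) e0 A B u v,
    {subset S0 <= S} -> (forall e, E e \/ e = e0 -> of_format P F e /\ bounded [in S] N e) ->
    violation E e0 A B u v -> value P u -> value P v -> (forall x : 'I_n, F = FVV Om x x -> u = v) ->
    exists A' B' u' v', [/\ violation E e0 A' B' u' v', value P u', value P v' &
        forall x : 'I_n, F = FVV Om x x -> u' = v'] /\
      let D := (N + K) ^ 3 in
      [/\ ok [in S] A' && (height A' <= D), ok [in S] B' && (height B' <= D),
          ok [in S] u' && (height u' <= D) & ok [in S] v' && (height v' <= D)].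
Proof.
move=> Lx0.
have [kG hG] := exists_bound (@height Om void) (setG P).
have [kR hR] := exists_bound (@height Om void) (setR P).
have DG y : Dom P y -> y \notin setG P by case.
have [Ys hYs] := shrink_small (@setG_sub Om n P) hG (@wf_setG Om n P) DG.
have [kY hY] := exists_bound (@height Om void) (x0 :: [seq y <- Ys | wf y]).
have [F1 aF1] := positive_arity Lx0.
have [s2 hs2] : exists s2 : seq Om, ~ monadic Om -> exists2 F, F \in s2 & 1 < arity F.
  case: (pselect (monadic Om)) => [mo|/existsNP [F /negP]]; first by exists [::].
  by rewrite -ltnNge => aF; exists [:: F] => _; exists F; rewrite ?inE.
have [s1 hs1] : exists s1 : seq Om, forall F F' : Om, arity F = 1 -> arity F' = 1 -> F <> F' ->
    exists H H' : Om, [/\ H \in s1, H' \in s1, H <> H', arity H = 1 & arity H' = 1].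
  case: (pselect (exists F F' : Om, [/\ arity F = 1, arity F' = 1 & F <> F'])) => [[F [F' [a1 a2 ne]]]|nex].
    by exists [:: F; F'] => _ _ _ _ _; exists F, F'; split; rewrite ?inE ?eqxx ?orbT.
  by exists [::] => F F' a1 a2 ne; case: nex; exists F, F'.
pose gs := x0 :: setG P ++ [seq y <- Ys | wf y].
pose S0 := F1 :: (s2 ++ s1) ++ flatten [seq symbols g | g <- gs].
have wx0 : wf x0 by case: Lx0 => /wf_setT.
have okg g : g \in gs -> ok [in S0] g.
  move=> ig; apply: ok_symbols.
    move: ig; rewrite inE mem_cat mem_filter => /predU1P [-> //|/orP [/wf_setG //|/andP []//]].
  move=> F iF; rewrite inE mem_cat; apply/orP; right; apply/orP; right.
  by apply/flattenP; exists (symbols g) => //; apply: map_f.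
pose kY' := kG + kY.
pose K := 2 * kY' + 2 * kG + 2 * kR + 4.
exists S0, K => S N F E e0 A B u v sub hE V Vu Vv h.
have i1 g : g \in setG P -> g \in gs by move=> ig; rewrite inE mem_cat ig orbT.
have i2 g : g \in [seq y <- Ys | wf y] -> g \in gs by move=> ig; rewrite inE mem_cat ig !orbT.
have i3 F' : F' \in s2 ++ s1 -> F' \in S0 by move=> iF; rewrite inE mem_cat iF orbT.
have lY y : y \in [seq y <- Ys | wf y] -> height y <= kY'.
  by move=> iy; apply: leq_trans (leq_addl kG kY); apply: hY; rewrite inE iy orbT.
have l0 : height x0 <= kY'.
  by apply: leq_trans (leq_addl kG kY); apply: hY; rewrite inE eqxx.
have [||||||||A' [B' [u' [v' [[V' gu gv h'] [oA oB lA lB]]]]]] :=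
  @model_bounded Om n P x0 Lx0 kG kR kY' S0 [seq y <- Ys | wf y] hG hR lY l0 F1 aF1 _ _ _ _ _ _ _
    [in S] _ (leq_addr _ _) N F E e0 A B u v hE V Vu Vv h.
- by move=> g /i1; apply: okg.
- by move=> g /i2; apply: okg.
- by apply: okg; rewrite inE eqxx.
- by rewrite inE eqxx.
- by move=> /hs2 [F' iF' a]; exists F' => //; apply: i3; rewrite mem_cat iF'.
- move=> F' F'' a a' ne; have [H [H' [iH iH' ? ? ?]]] := hs1 _ _ a a' ne.
  by exists H, H'; split=> //; apply: i3; rewrite mem_cat ?iH ?iH' orbT.
- move=> y Dy m T c t p1 p2 sT T1 T2 nc sl gt wt vi.
  have [y' [m' [iy' Dy' sl' vi']]] := hYs y Dy m T c t p1 p2 sT T1 T2 nc sl gt wt vi.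
  exists y', m'; split=> //; rewrite mem_filter iy' andbT; apply: (@wf_setT _ _ P); exact: proj1 Dy'.
- exact: sub.
have [vu ou lu] := gu; have [vv ov lv] := gv.
exists A', B', u', v'; split=> // D.
(* The bound is quadratic with several constants. With [s = N + K] it is at most
   [2 * s ^ 2 + 4 * s], and the single cube [s ^ 3] exceeds this, as [s] is at least 4. *)
have le : (N + bnd2 kG kR kY' N).+1 <= D.
  rewrite /D /bnd2 /bnd.
  pose s := N + K; have s4 : 4 <= s by rewrite /s /K; clear; lia.
  have b1 : 2 * (N + kY') + kG + kR + 4 <= 2 * s by rewrite /s /K; clear; lia.
  have b2 : N + kY' + kG <= s by rewrite /s /K; clear; lia.
  have b3 : N + (kY' + (N + kY').+1 + N) < 3 * s + 0 by rewrite /s /K; clear; lia.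
  have b4 := leq_mul b1 b2.
  have b5 : 2 * s * s + 4 * s <= s ^ 3.
    rewrite !expnS expn0 muln1 mulnA -!mulnDl; have := leq_mul s4 (leqnn s); clear; nia.
  rewrite -/s; move: b3 b4 b5; set p := (2 * (N + kY') + _ + _ + _) * _; clear; lia.
have le2 : bnd2 kG kR kY' N <= D by apply: leq_trans le; rewrite leqW // leq_addl.
split; apply/andP; split=> //; try exact: leq_trans le; exact: leq_trans le2.
Qed.

End Violations.

(** * Combinators compiled to LISP *)

Definition dtrue : data := DCons DNil DNil.
Definition dbool (b : bool) : data := if b then dtrue else DNil.

Fixpoint deq (x y : data) : bool :=
  match x, y with
  | DNil, DNil => true
  | DCons a b, DCons c d => if deq a c then deq b d else false
  | _, _ => false
  end.

Lemma deqP x y : reflect (x = y) (deq x y).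
Proof.
elim: x y => [|a IHa b IHb] [|c d] /=; try by constructor.
case: IHa => [->|n]; last by constructor => -[].
by case: IHb => [->|n]; constructor => // -[].
Qed.

Fixpoint drec (b : data) (s : data -> data -> data -> data -> data) (t : data) : data :=
  if t is DCons h l then s h l (drec b s h) (drec b s l) else b.

(* Unary first-order combinators: an intermediate language between functions on
   trees and the LISP of the statement. *)
Inductive comb : Type :=
| CId
| CNil
| CCons of comb & comb
| CHead of comb
| CTail of comb
| CIf of comb & comb & comb
| CComp of comb & comb
| CEq
| CRec of comb & comb.

Definition dcond (c a b : data) : data := if c is DCons _ _ then a else b.

(* [CRec b s] recurses on the tail of its argument, the head being a parameter. *)
Fixpoint sem (c : comb) (x : data) : data :=
  match c with
  | CId => x
  | CNil => DNil
  | CCons a b => DCons (sem a x) (sem b x)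
  | CHead a => dhead (sem a x)
  | CTail a => dtail (sem a x)
  | CIf c a b => dcond (sem c x) (sem a x) (sem b x)
  | CComp a b => sem a (sem b x)
  | CEq => dbool (deq (dhead x) (dtail x))
  | CRec b s => drec (sem b (dhead x))
      (fun h l rh rl => sem s (DCons (dhead x) (DCons h (DCons l (DCons rh rl))))) (dtail x)
  end.

Definition call (i : nat) (e : expr) : expr := ECall i [:: e].

(* One function per node of the combinator; the code of the subterms is laid out
   after the root, from position [o] on. *)
Fixpoint compile (o : nat) (c : comb) : seq expr :=
  let x := Arg 0 in
  match c with
  | CId => [:: x]
  | CNil => [:: ENil]
  | CCons a b => let p := compile o.+1 a in let o' := o.+1 + size p in
      ECons (call o.+1 x) (call o' x) :: p ++ compile o' b
  | CHead a => EHead (call o.+1 x) :: compile o.+1 a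
  | CTail a => ETail (call o.+1 x) :: compile o.+1 a
  | CIf c a b => let p := compile o.+1 c in let o' := o.+1 + size p in
      let q := compile o' a in let o'' := o' + size q in
      EIf (call o.+1 x) (call o' x) (call o'' x) :: p ++ q ++ compile o'' b
  | CComp a b => let p := compile o.+1 a in let o' := o.+1 + size p in
      call o.+1 (call o' x) :: p ++ compile o' b
  | CEq => let l := EHead x in let r := ETail x in
      [:: EIf l
            (EIf r (EIf (call o (ECons (EHead l) (EHead r)))
                      (call o (ECons (ETail l) (ETail r))) ENil) ENil)
            (EIf r ENil (ECons ENil ENil))]
  | CRec b s => let p := compile o.+1 b in let o' := o.+1 + size p in
      let e := EHead x in let t := ETail x in
      EIf t (call o' (ECons e (ECons (EHead t) (ECons (ETail t)
               (ECons (call o (ECons e (EHead t))) (call o (ECons e (ETail t))))))))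
            (call o.+1 e) :: p ++ compile o' s
  end.

(** All sufficiently large depths are required, so that the bounds of subevaluations combine by a
    maximum. *)
Definition evals (p : seq expr) (x : data) (e : expr) (v : data) : Prop :=
  exists k0, forall k, k0 <= k -> run k p [:: x] e = Some v.

(** Calls in compiled code use absolute positions, so a fragment is correct only inside a program
    that contains it at its own offset. *)
Definition loaded (p : seq expr) (o : nat) (q : seq expr) : Prop :=
  forall i, i < size q -> nth ENil p (o + i) = nth ENil q i.

Section Compile.
Variable p : seq expr.

Lemma evals_arg x : evals p x (Arg 0) x.
Proof. by exists 1 => -[]. Qed.

Lemma evals_nil x : evals p x ENil DNil.
Proof. by exists 1 => -[]. Qed.

Lemma evals_cons x a b u v : evals p x a u -> evals p x b v -> evals p x (ECons a b) (DCons u v).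
Proof.
move=> [i hi] [j hj]; exists (maxn i j).+1 => -[//|k].
by rewrite ltnS geq_max => /andP [li lj] /=; rewrite hi // hj.
Qed.

Lemma evals_head x a u : evals p x a u -> evals p x (EHead a) (dhead u).
Proof. by move=> [i hi]; exists i.+1 => -[//|k] lk /=; rewrite hi. Qed.

Lemma evals_tail x a u : evals p x a u -> evals p x (ETail a) (dtail u).
Proof. by move=> [i hi]; exists i.+1 => -[//|k] lk /=; rewrite hi. Qed.

Lemma evals_if x c a b w u : evals p x c w ->
  (if w is DCons _ _ then evals p x a u else evals p x b u) -> evals p x (EIf c a b) u.
Proof.
move=> [i hi]; case: w hi => [|h l] hi [j hj]; exists (maxn i j).+1 => -[//|k];
  by rewrite ltnS geq_max => /andP [li lj] /=; rewrite hi // hj.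
Qed.

Lemma evals_call x i e w u : evals p x e w -> evals p w (nth ENil p i) u -> evals p x (call i e) u.
Proof.
move=> [j hj] [k hk]; exists (maxn j k).+1 => -[//|l].
by rewrite ltnS geq_max => /andP [lj lk] /=; rewrite hj //= hk.
Qed.

Lemma loaded_cons o e q : loaded p o (e :: q) -> nth ENil p o = e /\ loaded p o.+1 q.
Proof.
move=> h; split; first by have := h 0 isT; rewrite addn0.
by move=> i li; have := h i.+1 li; rewrite addSnnS.
Qed.

Lemma loaded_cat o q r : loaded p o (q ++ r) -> loaded p o q /\ loaded p (o + size q) r.
Proof.
move=> h; split=> i li.
  by rewrite h ?size_cat ?ltn_addr // nth_cat li.
by rewrite -addnA h ?size_cat ?ltn_add2l // nth_cat ltnNge leq_addr /= addKn.
Qed.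

(** [CEq] and [CRec] compile to functions that call themselves; these two cases need an inner
    induction on the argument, stated as [X]. *)
Lemma compileP c o x : loaded p o (compile o c) -> evals p x (nth ENil p o) (sem c x).
Proof.
elim: c o x => [||a IHa b IHb|a IHa|a IHa|c IHc a IHa b IHb|a IHa b IHb||b IHb s IHs] o x /=;
  move=> /loaded_cons [eo l].
- by rewrite eo; apply: evals_arg.
- by rewrite eo; apply: evals_nil.
- rewrite eo; have [la lb] := loaded_cat l.
  by apply: evals_cons; apply: evals_call (evals_arg x) _; [apply: IHa|apply: IHb].
- by rewrite eo; apply: evals_head; apply: evals_call (evals_arg x) _; apply: IHa.
- by rewrite eo; apply: evals_tail; apply: evals_call (evals_arg x) _; apply: IHa.
- rewrite eo; have [lc lab] := loaded_cat l; have [la lb] := loaded_cat lab.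
  apply: (@evals_if _ _ _ _ (sem c x)); first by apply: evals_call (evals_arg x) _; apply: IHc.
  by case: (sem c x) => [|? ?] /=; apply: evals_call (evals_arg x) _; [apply: IHb|apply: IHa].
- rewrite eo; have [la lb] := loaded_cat l.
  apply: (@evals_call _ _ _ (sem b x)); last exact: IHa.
  by apply: evals_call (evals_arg x) _; apply: IHb.
- suff X u v : evals p (DCons u v) (nth ENil p o) (dbool (deq u v)).
    case: x => [|u v]; last exact: X.
    rewrite eo; apply: evals_if (evals_head (evals_arg _)) _ => /=.
    apply: evals_if (evals_tail (evals_arg _)) _ => /=.
    by apply: evals_cons; apply: evals_nil.
  elim: u v => [|u1 IH1 u2 IH2] v; rewrite eo; set x' := DCons _ v;
    have Hl := evals_head (evals_arg x'); have Hr := evals_tail (evals_arg x');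
    apply: (evals_if Hl) => /=; apply: (evals_if Hr) => /=;
    case: v @x' Hl Hr => [|v1 v2] x' Hl Hr /=; try exact: evals_nil.
    by apply: evals_cons; apply: evals_nil.
  apply: (@evals_if _ _ _ _ (dbool (deq u1 v1))).
    by apply: evals_call (IH1 v1); apply: evals_cons (evals_head Hl) (evals_head Hr).
  case: (deq u1 v1) => /=; last exact: evals_nil.
  by apply: evals_call (IH2 v2); apply: evals_cons (evals_tail Hl) (evals_tail Hr).
have [lb ls] := loaded_cat l.
suff X e t : evals p (DCons e t) (nth ENil p o) (drec (sem b e)
      (fun h l rh rl => sem s (DCons e (DCons h (DCons l (DCons rh rl))))) t).
  case: x => [|e t]; last exact: X.
  rewrite eo; apply: evals_if (evals_tail (evals_arg _)) _ => /=.
  by apply: evals_call (evals_head (evals_arg _)) _; apply: IHb.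
elim: t => [|h IHh t IHt]; rewrite eo; set x' := DCons e _;
  have He := evals_head (evals_arg x'); have Ht := evals_tail (evals_arg x');
  apply: (evals_if Ht) => /=.
  by apply: evals_call He _; apply: IHb.
apply: (evals_call _ (IHs _ _ ls)); apply: (evals_cons He).
apply: (evals_cons (evals_head Ht)); apply: (evals_cons (evals_tail Ht)).
by apply: evals_cons; [apply: evals_call IHh|apply: evals_call IHt];
  apply: (evals_cons He); [apply: evals_head Ht|apply: evals_tail Ht].
Qed.

End Compile.

Lemma computes_compile c x : computes (compile 0 c) x (sem c x).
Proof. by have [//|k h] := @compileP (compile 0 c) c 0 x; exists k; apply: h. Qed.

(** * Computable functions *)

(** The functions are total, as combinators always terminate; the closure lemmas below take the
    place of writing programs. *)
Definition cmp X Y (eX : X -> data) (eY : Y -> data) (f : X -> Y) :=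
  exists c, forall x, sem c (eX x) = eY (f x).

Definition epair X Y (eX : X -> data) (eY : Y -> data) (p : X * Y) := DCons (eX p.1) (eY p.2).

Section Closure.
Variables (X : Type) (eX : X -> data).
Notation "'C' eY f" := (cmp eX eY f) (at level 10, eY at level 9, f at level 9).

Lemma cmp_id : C eX id.
Proof. by exists CId. Qed.

Lemma cmp_ext Y (eY : Y -> data) f g : (forall x, f x = g x) -> C eY f -> C eY g.
Proof. by move=> e [c h]; exists c => x; rewrite h e. Qed.

Fixpoint cconst d := if d is DCons a b then CCons (cconst a) (cconst b) else CNil.
Lemma cconstE d x : sem (cconst d) x = d.
Proof. by elim: d => //= a -> b ->. Qed.

Lemma cmp_const Y (eY : Y -> data) y : C eY (fun=> y).
Proof. by exists (cconst (eY y)) => x; rewrite cconstE. Qed.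

Lemma cmp_comp Y (eY : Y -> data) Z (eZ : Z -> data) f g : cmp eY eZ g -> C eY f -> C eZ (fun x => g (f x)).
Proof. by move=> [c hc] [d hd]; exists (CComp c d) => x /=; rewrite hd hc. Qed.

Lemma cmp_pair Y (eY : Y -> data) Z (eZ : Z -> data) f g : C eY f -> C eZ g ->
  C (epair eY eZ) (fun x => (f x, g x)).
Proof. by move=> [c hc] [d hd]; exists (CCons c d) => x /=; rewrite hd hc. Qed.

Lemma cmp_fst Y (eY : Y -> data) Z (eZ : Z -> data) f : C (epair eY eZ) f -> C eY (fun x => (f x).1).
Proof. by move=> [c hc]; exists (CHead c) => x /=; rewrite hc. Qed.

Lemma cmp_snd Y (eY : Y -> data) Z (eZ : Z -> data) f : C (epair eY eZ) f -> C eZ (fun x => (f x).2).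
Proof. by move=> [c hc]; exists (CTail c) => x /=; rewrite hc. Qed.

Lemma cmp_if Y (eY : Y -> data) b f g : C dbool b -> C eY f -> C eY g ->
  C eY (fun x => if b x then f x else g x).
Proof. by move=> [c hc] [d hd] [e he]; exists (CIf c d e) => x /=; rewrite hc hd he; case: (b x). Qed.

Lemma cmp_eq (Y : eqType) (eY : Y -> data) f g : injective eY -> C eY f -> C eY g ->
  C dbool (fun x => f x == g x).
Proof.
move=> inj [c hc] [d hd]; exists (CComp CEq (CCons c d)) => x /=; rewrite hc hd.
by congr dbool; apply/deqP/eqP => [/inj|->].
Qed.

(** The source of all recursion on lists and, numerals being lists of [DNil], of iteration. *)
Lemma cmp_foldr Y (eY : Y -> data) Z (eZ : Z -> data) (s : X -> seq Y) (b : X -> Z) (g : X * (Y * Z) -> Z) :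
  C (enc_seq eY) s -> C eZ b -> cmp (epair eX (epair eY eZ)) eZ g ->
  C eZ (fun x => foldr (fun y z => g (x, (y, z))) (b x) (s x)).
Proof.
move=> [cs hs] [cb hb] [cg hg].
exists (CComp (CRec cb (CComp cg (CCons (CHead CId)
   (CCons (CHead (CTail CId)) (CTail (CTail (CTail (CTail CId)))))))) (CCons CId cs)) => x /=.
rewrite hs; elim: (s x) => [|y l IH] /=; first exact: hb.
by rewrite IH; apply: (hg (x, (y, _))).
Qed.

End Closure.

Local Notation enat := enc_nat.
Local Notation eseq := enc_seq.

Section Lists.
Variables (X : Type) (eX : X -> data) (Y : Type) (eY : Y -> data).

Lemma cmp_cons (f : X -> Y) (g : X -> seq Y) : cmp eX eY f -> cmp eX (eseq eY) g ->
  cmp eX (eseq eY) (fun x => f x :: g x).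
Proof. exact: cmp_pair. Qed.

Lemma cmp_var1 : cmp (epair eX eY) eX fst. Proof. exact: (cmp_fst (cmp_id _)). Qed.
Lemma cmp_var2 : cmp (epair eX eY) eY snd. Proof. exact: (cmp_snd (cmp_id _)). Qed.

End Lists.

Ltac proj := repeat first [exact: cmp_id | apply: cmp_fst | apply: cmp_snd].

Section Lists2.
Variables (X : Type) (eX : X -> data) (Y : Type) (eY : Y -> data) (Z : Type) (eZ : Z -> data).

Lemma cmp_cat (f g : X -> seq Y) : cmp eX (eseq eY) f -> cmp eX (eseq eY) g ->
  cmp eX (eseq eY) (fun x => f x ++ g x).
Proof.
move=> hf hg.
apply: (cmp_ext _ (@cmp_foldr _ _ _ eY _ (eseq eY) f g (fun p => p.2.1 :: p.2.2) hf hg _)) => [x|].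
  by elim: (f x) => //= y l ->.
by apply: cmp_cons; proj.
Qed.

Lemma cmp_map (s : X -> seq Y) (f : X * Y -> Z) : cmp eX (eseq eY) s -> cmp (epair eX eY) eZ f ->
  cmp eX (eseq eZ) (fun x => [seq f (x, y) | y <- s x]).
Proof.
move=> hs hf.
apply: (cmp_ext _ (@cmp_foldr _ _ _ eY _ (eseq eZ) s (fun=> [::]) (fun p => f (p.1, p.2.1) :: p.2.2) hs _ _)) => //.
- exact: cmp_const.
have v2 := cmp_var2 eX (epair eY (eseq eZ)).
apply: cmp_cons; last exact: (cmp_snd v2).
apply: (cmp_comp hf); apply: cmp_pair; [exact: cmp_var1|exact: (cmp_fst v2)].
Qed.

Lemma cmp_filter (s : X -> seq Y) (f : X * Y -> bool) : cmp eX (eseq eY) s -> cmp (epair eX eY) dbool f ->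
  cmp eX (eseq eY) (fun x => [seq y <- s x | f (x, y)]).
Proof.
move=> hs hf.
apply: (cmp_ext _ (@cmp_foldr _ _ _ eY _ (eseq eY) s (fun=> [::])
   (fun p => if f (p.1, p.2.1) then p.2.1 :: p.2.2 else p.2.2) hs _ _)) => //.
- exact: cmp_const.
have v2 := cmp_var2 eX (epair eY (eseq eY)).
apply: cmp_if; last exact: (cmp_snd v2); last by apply: cmp_cons; [apply: cmp_fst v2|apply: cmp_snd v2].
apply: (cmp_comp hf); apply: cmp_pair; [exact: cmp_var1|exact: (cmp_fst v2)].
Qed.

Lemma cmp_all (s : X -> seq Y) (f : X * Y -> bool) : cmp eX (eseq eY) s -> cmp (epair eX eY) dbool f ->
  cmp eX dbool (fun x => all (fun y => f (x, y)) (s x)).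
Proof.
move=> hs hf.
apply: (cmp_ext _ (@cmp_foldr _ _ _ eY _ dbool s (fun=> true)
   (fun p => if f (p.1, p.2.1) then p.2.2 else false) hs _ _)) => //.
- exact: cmp_const.
have v2 := cmp_var2 eX (epair eY dbool).
apply: cmp_if; [|exact: (cmp_snd v2)|exact: cmp_const].
apply: (cmp_comp hf); apply: cmp_pair; [exact: cmp_var1|exact: (cmp_fst v2)].
Qed.

Lemma enat_eseq k : enat k = eseq (fun=> DNil) (nseq k tt).
Proof. by elim: k => //= k ->. Qed.

Lemma cmp_iter (k : X -> nat) (b : X -> Z) (f : X * Z -> Z) : cmp eX enat k -> cmp eX eZ b ->
  cmp (epair eX eZ) eZ f -> cmp eX eZ (fun x => iter (k x) (fun z => f (x, z)) (b x)).
Proof.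
move=> [ck hk] hb hf.
have hk' : cmp eX (eseq (fun=> DNil)) (fun x => nseq (k x) tt).
  by exists ck => x; rewrite hk enat_eseq.
apply: (cmp_ext _ (@cmp_foldr _ _ _ (fun=> DNil) _ eZ _ b (fun p => f (p.1, p.2.2)) hk' hb _)).
  by move=> x; elim: (k x) => //= i ->.
apply: (cmp_comp hf); apply: cmp_pair; [exact: cmp_var1|exact: (cmp_snd (cmp_var2 _ _))].
Qed.

Lemma cmp_size (s : X -> seq Y) : cmp eX (eseq eY) s -> cmp eX enat (fun x => size (s x)).
Proof.
move=> hs.
apply: (cmp_ext _ (@cmp_foldr _ _ _ eY _ enat s (fun=> 0) (fun p => p.2.2.+1) hs _ _)) => [x||].
- by elim: (s x) => //= y l ->.
- exact: cmp_const.
have [c hc] := cmp_snd (cmp_var2 eX (epair eY enat)).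
by exists (CCons CNil c) => x /=; rewrite hc.
Qed.

Lemma cmp_nilp (s : X -> seq Y) : cmp eX (eseq eY) s -> cmp eX dbool (fun x => ~~ nilp (s x)).
Proof.
by move=> [c hc]; exists (CIf c (cconst dtrue) CNil) => x /=; rewrite hc; case: (s x).
Qed.

Lemma cmp_take1 (s : X -> seq Y) : cmp eX (eseq eY) s -> cmp eX (eseq eY) (fun x => take 1 (s x)).
Proof.
by move=> [c hc]; exists (CIf c (CCons (CHead c) CNil) CNil) => x /=; rewrite hc; case: (s x) => //= y l; rewrite take0.
Qed.

Lemma cmp_succ (k : X -> nat) : cmp eX enat k -> cmp eX enat (fun x => (k x).+1).
Proof. by move=> [c hc]; exists (CCons CNil c) => x /=; rewrite hc. Qed.

Lemma cmp_implb (a b : X -> bool) : cmp eX dbool a -> cmp eX dbool b -> cmp eX dbool (fun x => a x ==> b x).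
Proof.
move=> ha hb; apply: cmp_ext (cmp_if ha hb (cmp_const eX dbool true)) => x.
by case: (a x).
Qed.

Lemma cmp_andb (a b : X -> bool) : cmp eX dbool a -> cmp eX dbool b -> cmp eX dbool (fun x => a x && b x).
Proof. by move=> ha hb; apply: cmp_ext (cmp_if ha hb (cmp_const eX dbool false)). Qed.

End Lists2.

Lemma cmp_flatten X (eX : X -> data) Y (eY : Y -> data) (s : X -> seq (seq Y)) :
  cmp eX (eseq (eseq eY)) s -> cmp eX (eseq eY) (fun x => flatten (s x)).
Proof.
move=> hs.
apply: (cmp_ext _ (@cmp_foldr _ _ _ (eseq eY) _ (eseq eY) s (fun=> [::]) (fun p => p.2.1 ++ p.2.2) hs _ _)) => //.
  exact: cmp_const.
by apply: cmp_cat; proj.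
Qed.

Lemma cmp_addn X (eX : X -> data) (k l : X -> nat) : cmp eX enat k -> cmp eX enat l -> cmp eX enat (fun x => k x + l x).
Proof.
move=> hk hl; apply: (cmp_ext _ (@cmp_iter _ _ _ enat k l (fun p => p.2.+1) hk hl _)) => [x|].
  by elim: (k x) => //= i ->.
by apply: cmp_succ; proj.
Qed.

Lemma cmp_muln X (eX : X -> data) (k l : X -> nat) : cmp eX enat k -> cmp eX enat l -> cmp eX enat (fun x => k x * l x).
Proof.
move=> hk hl; apply: (cmp_ext _ (@cmp_iter _ _ _ enat k (fun=> 0) (fun p => l p.1 + p.2) hk _ _)) => [x||].
- by elim: (k x) => //= i ->; rewrite mulSn.
- exact: cmp_const.
by apply: cmp_addn; [apply: (cmp_comp hl)|]; proj.
Qed.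

Lemma cmp_cube X (eX : X -> data) (k : X -> nat) : cmp eX enat k -> cmp eX enat (fun x => k x ^ 3).
Proof.
move=> hk; apply: (cmp_ext _ (cmp_muln hk (cmp_muln hk hk))) => x.
by rewrite !expnS expn0 muln1.
Qed.

Lemma enat_inj : injective enat.
Proof. by elim=> [|k IH] [|l] //= [/IH ->]. Qed.

Lemma eseq_inj Y (eY : Y -> data) : injective eY -> injective (eseq eY).
Proof. by move=> inj; elim=> [|x s IH] [|y t] //= [/inj -> /IH ->]. Qed.

Lemma epair_inj X Y (eX : X -> data) (eY : Y -> data) : injective eX -> injective eY -> injective (epair eX eY).
Proof. by move=> iX iY [x y] [x' y'] [/= /iX -> /iY ->]. Qed.

Section Terms.
Variables (Om : signature) (code : Om -> nat).

Section Encoding.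
Variables (V : Type) (eV : V -> data).
Fixpoint eterm (t : term Om V) : data :=
  match t with
  | Var x => DCons DNil (eV x)
  | App f ts => DCons (DCons DNil DNil) (DCons (enc_nat (code f)) (enc_seq eterm ts))
  end.
End Encoding.

(** The arity is carried along, since it need not be computable from [code]; [cmp_symbols] reads it
    off a well-formed term as the number of arguments. *)
Definition esym (F : Om) := DCons (enc_nat (code F)) (enc_nat (arity F)).

Fixpoint tfold V Z (v : V -> Z) (a : Om -> seq Z -> Z) (t : term Om V) : Z :=
  match t with
  | Var x => v x
  | App f ts => a f [seq tfold v a u | u <- ts]
  end.

Section Fold.
Variables (X : Type) (eX : X -> data) (V : eqType) (eV : V -> data) (Z : Type) (eZ : Z -> data).

(* [eterm] does not tell lists from terms: for each tree the recursion returns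
   its value as a term, as a list of terms, and that of its tail. *)
Lemma cmp_tfold (w : bool) (t : X -> term Om V) (v : X * V -> Z) (a : X -> Om -> seq Z -> Z) :
  (w -> forall x, wf (t x)) -> cmp eX (eterm eV) t -> cmp (epair eX eV) eZ v ->
  (exists c, forall x f zs, (w -> size zs = arity f) ->
     sem c (DCons (eX x) (DCons (enc_nat (code f)) (eseq eZ zs))) = eZ (a x f zs)) ->
  cmp eX eZ (fun x => tfold (fun y => v (x, y)) (a x) (t x)).
Proof.
move=> wt [ct ht] [cv hv] [ca ha].
pose e := CHead CId; pose r := CTail CId; pose h := CHead r; pose l := CHead (CTail r).
pose rh := CHead (CTail (CTail r)); pose rl := CTail (CTail (CTail r)).
pose step := CCons (CIf h (CComp ca (CCons e (CCons (CHead l) (CTail (CTail rl))))) (CComp cv (CCons e l)))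
   (CCons (CCons (CHead rh) (CHead (CTail rl))) (CHead (CTail rl))).
exists (CHead (CComp (CRec CNil step) (CCons CId ct))) => x.
rewrite [sem _ _]/= ht; set st := (fun h l rh rl => _).
have: w -> wf (t x) by move/wt.
elim/term_ind2: (t x) => [y|f ts IH] wx.
  exact: (hv (x, y)).
pose R := drec DNil st.
have L us : {subset us <= ts} -> dhead (dtail (R (enc_seq (eterm eV) us))) =
    eseq eZ [seq tfold (fun y => v (x, y)) (a x) u | u <- us].
  elim: us => [//|u us IHu] sub; rewrite /= IHu => [|z iz]; last by apply: sub; rewrite inE iz orbT.
  rewrite IH //; first by apply: sub; rewrite inE eqxx.
  by move=> /wx /= /andP [_ /allP]; apply; apply: sub; rewrite inE eqxx.
have := ha x f [seq tfold (fun y => v (x, y)) (a x) u | u <- ts]; rewrite -L // => <- //.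
by rewrite size_map => /wx /= /andP [/eqP].
Qed.

Lemma eterm_inj : injective code -> injective eV -> injective (eterm eV).
Proof.
move=> ic iV; elim/term_ind2=> [x|f ts IH] [y|g us] //=; first by move=> [/iV ->].
move=> [/enat_inj/ic -> e]; congr App.
elim: ts us IH e => [|t ts IHt] [|u us] IH //= [et es].
congr cons; first by apply: IH => //; rewrite inE eqxx.
by apply: IHt es => z iz; apply: IH; rewrite inE iz orbT.
Qed.

End Fold.
End Terms.

(** * The decision procedure *)

Section ComputeTerms.
Variables (Om : signature) (code : Om -> nat).
Notation eterm := (eterm code).
Notation esym := (esym code).

Lemma cmp_subst X (eX : X -> data) (V W : eqType) (eV : V -> data) (eW : W -> data)
    (t : X -> term Om V) (s : X * V -> term Om W) :
  cmp eX (eterm eV) t -> cmp (epair eX eV) (eterm eW) s ->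
  cmp eX (eterm eW) (fun x => subst (fun v => s (x, v)) (t x)).
Proof.
move=> ht hs.
apply: cmp_ext (@cmp_tfold Om code X eX V eV _ (eterm eW) false t s (fun=> @App Om W) _ ht hs _) => //.
  by move=> x; elim/term_ind2: (t x) => //= f ts IH; congr App; apply/eq_in_map.
by exists (CCons (cconst dtrue) (CTail CId)).
Qed.

Lemma cmp_vars X (eX : X -> data) (V : eqType) (eV : V -> data) (t : X -> term Om V) :
  cmp eX (eterm eV) t -> cmp eX (eseq eV) (fun x => vars (t x)).
Proof.
move=> ht.
apply: cmp_ext (@cmp_tfold Om code X eX V eV _ (eseq eV) false t (fun p => [:: p.2]) (fun _ _ => flatten) _ ht _ _) => //.
- by move=> x; elim/term_ind2: (t x) => //= f ts IH; congr flatten; apply/eq_in_map.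
- by apply: cmp_cons; [proj|exact: cmp_const].
have [c hc] := cmp_flatten (cmp_id (eseq (eseq eV))).
by exists (CComp c (CTail (CTail CId))) => x f zs _ /=; rewrite hc.
Qed.

Lemma cmp_symbols X (eX : X -> data) (V : eqType) (eV : V -> data) (t : X -> term Om V) :
  (forall x, wf (t x)) -> cmp eX (eterm eV) t -> cmp eX (eseq esym) (fun x => symbols (t x)).
Proof.
move=> wt ht.
apply: cmp_ext (@cmp_tfold Om code X eX V eV _ (eseq esym) true t (fun=> [::]) (fun _ f zs => f :: flatten zs) _ ht _ _) => //.
- by move=> x; elim/term_ind2: (t x) => //= f ts IH; congr (_ :: flatten _); apply/eq_in_map.
- exact: cmp_const.
have [c hc] := cmp_flatten (cmp_id (eseq (eseq esym))).
have [d hd] := cmp_size (cmp_id (eseq (eseq esym))).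
exists (CCons (CCons (CHead (CTail CId)) (CComp d (CTail (CTail CId)))) (CComp c (CTail (CTail CId)))).
by move=> x f zs /(_ isT) es /=; rewrite hc hd es.
Qed.

Lemma cmp_App X (eX : X -> data) (V : Type) (eV : V -> data) (F : X -> Om) (ts : X -> seq (term Om V)) :
  cmp eX esym F -> cmp eX (eseq (eterm eV)) ts -> cmp eX (eterm eV) (fun x => App (F x) (ts x)).
Proof.
by move=> [c hc] [d hd]; exists (CCons (cconst dtrue) (CCons (CHead c) d)) => x /=; rewrite hc hd.
Qed.

Lemma cmp_arity X (eX : X -> data) (F : X -> Om) : cmp eX esym F -> cmp eX enat (fun x => arity (F x)).
Proof. by move=> [c hc]; exists (CTail c) => x /=; rewrite hc. Qed.

Lemma cmp_seqs X (eX : X -> data) Y (eY : Y -> data) (k : X -> nat) (l : X -> seq Y) :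
  cmp eX enat k -> cmp eX (eseq eY) l -> cmp eX (eseq (eseq eY)) (fun x => seqs (k x) (l x)).
Proof.
move=> hk hl.
apply: (cmp_ext _ (@cmp_iter _ _ _ (eseq (eseq eY)) k (fun=> [:: [::]])
   (fun p => flatten [seq [seq y :: s | s <- p.2] | y <- l p.1]) hk _ _)) => [x||].
- by elim: (k x) => //= i ->.
- exact: cmp_const.
apply: cmp_flatten; apply: (@cmp_map _ _ _ eY _ _ _ (fun q => [seq q.2 :: s | s <- q.1.2])).
  by apply: (cmp_comp hl); proj.
apply: (@cmp_map _ _ _ (eseq eY) _ _ _ (fun q => q.1.2 :: q.2)); first by proj.
by apply: cmp_cons; proj.
Qed.

Lemma cmp_apps X (eX : X -> data) V (eV : V -> data) (S : X -> seq Om) (l : X -> seq (term Om V)) :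
  cmp eX (eseq esym) S -> cmp eX (eseq (eterm eV)) l ->
  cmp eX (eseq (eterm eV)) (fun x => flatten [seq [seq App F ts | ts <- seqs (arity F) (l x)] | F <- S x]).
Proof.
move=> hS hl; apply: cmp_flatten.
apply: (@cmp_map _ _ _ esym _ _ _ (fun q => [seq App q.2 ts | ts <- seqs (arity q.2) (l q.1)])) => //.
apply: (@cmp_map _ _ _ (eseq (eterm eV)) _ _ _ (fun q => App q.1.2 q.2)).
  by apply: cmp_seqs; [apply: cmp_arity; proj|apply: (cmp_comp hl); proj].
by apply: cmp_App; proj.
Qed.

Notation eunit := (fun _ : unit => DNil).
Notation etemp := (eterm eunit).

Lemma cmp_terms X (eX : X -> data) (S : X -> seq Om) (h : X -> nat) :
  cmp eX (eseq esym) S -> cmp eX enat h -> cmp eX (eseq etemp) (fun x => terms (S x) (h x)).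
Proof.
move=> hS hh.
apply: (cmp_ext _ (@cmp_iter _ _ _ (eseq etemp) h (fun=> [:: Var tt])
   (fun p => Var tt :: flatten [seq [seq App F ts | ts <- seqs (arity F) p.2] | F <- S p.1]) hh _ _)) => [x||].
- by elim: (h x) => //= i ->.
- exact: cmp_const.
apply: cmp_cons; first exact: cmp_const.
by apply: cmp_apps; [apply: (cmp_comp hS)|]; proj.
Qed.

Lemma cmp_hole X (eX : X -> data) (V : eqType) (eV : V -> data) (t : X -> term Om V) :
  cmp eX (eterm eV) t -> cmp eX dbool (fun x => hole (t x)).
Proof. by move=> /cmp_vars /cmp_nilp; apply: cmp_ext => x; rewrite -hole_vars. Qed.

Section Kernel.
Variable G : seq (gterm Om).
Hypothesis Gsub : forall F ts t, App F ts \in G -> t \in ts -> t \in G.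

(* Ground subterms are taken from [G], so [hole] only filters the rest: the result
   contains every template of M_G over [S] of height at most [h]. *)
Fixpoint kernel (S : seq Om) h : seq (template Om) :=
  (Var tt :: [seq of_ground _ g | g <- G]) ++
  (if h is h'.+1 then
    [seq t <- flatten [seq [seq App F ts | ts <- seqs (arity F) (kernel S h')] | F <- S] | hole t]
   else [::]).

Lemma kernel_gk S h t :
  t \in kernel S h -> gk G t.
Proof.
have base t' : t' \in Var tt :: [seq of_ground _ g | g <- G] -> gk G t'.
  by rewrite inE => /predU1P [->//|/mapP [g ig ->]]; rewrite (gk_of_ground Gsub).
elim: h t => [|h IH] t; rewrite mem_cat => /orP [/base //|] //.
rewrite mem_filter => /andP [ht /flattenP [_ /mapP [F iF ->] /mapP [ts]]].
rewrite mem_seqs => /andP [_ /allP a] et; rewrite et in ht *; rewrite gk_hole //.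
by apply/allP => u iu; apply: IH; apply: a.
Qed.

Lemma kernel_ok (wG : forall g, g \in G -> wf g) S h t : t \in kernel S h -> wf t.
Proof.
have base t' : t' \in Var tt :: [seq of_ground unit g | g <- G] -> wf t'.
  by rewrite inE => /predU1P [->//|/mapP [g /wG + ->]]; rewrite !wf_ok ok_of_ground.
elim: h t => [|h IH] t; rewrite mem_cat => /orP [/base //|] //.
rewrite mem_filter => /andP [ht /flattenP [_ /mapP [F iF ->] /mapP [ts]]].
by rewrite mem_seqs => /andP [es /allP a] -> /=; rewrite es; apply/allP => u iu; apply: IH; apply: a.
Qed.

Lemma mem_kernel S h t : gk G t -> ok [in S] t -> height t <= h -> t \in kernel S h.
Proof.
elim: h t => [|h IH] t gt ot lt; rewrite mem_cat; apply/orP.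
  by left; case: t gt ot lt => [[]|F ts]; rewrite ?inE.
case ht: (hole t); last first.
  left; rewrite inE; apply/orP; right; have [g eg] : exists g, t = of_ground unit g.
    by move: ht; rewrite /hole; case e: (to_ground t) => [g|] // _; exists g; apply: to_groundK.
  by move: gt; rewrite eg (gk_of_ground Gsub) => ig; apply: map_f.
case: t gt ot lt ht => [[]|F ts] gt ot lt ht; first by left; rewrite inE.
right; rewrite mem_filter ht /=; apply/flattenP; exists [seq App F ts | ts <- seqs (arity F) (kernel S h)].
  by apply: (map_f (fun F => [seq App F ts | ts <- seqs (arity F) (kernel S h)])); move: ot; rewrite okApp => /and3P [].
apply: map_f; rewrite mem_seqs; move: ot; rewrite okApp => /and3P [_ -> /allP ao] /=.
apply/allP => u iu; apply: IH; [exact: gk_in gt iu|exact: ao|].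
by move: lt; rewrite height_leP => /allP; apply.
Qed.

Lemma cmp_kernel X (eX : X -> data) (S : X -> seq Om) (h : X -> nat) :
  cmp eX (eseq esym) S -> cmp eX enat h -> cmp eX (eseq etemp) (fun x => kernel (S x) (h x)).
Proof.
move=> hS hh; pose b := Var tt :: [seq of_ground unit g | g <- G].
apply: (cmp_ext _ (@cmp_iter _ _ _ (eseq etemp) h (fun=> b)
   (fun p => b ++ [seq t <- flatten [seq [seq App F ts | ts <- seqs (arity F) p.2] | F <- S p.1] | hole t]) hh _ _)) => [x||].
- by elim: (h x) => [|i IH] /=; [rewrite cats0|rewrite IH].
- exact: cmp_const.
apply: cmp_cat; first exact: cmp_const.
apply: (@cmp_filter _ _ _ etemp _ (fun q => hole q.2)); last by apply: cmp_hole; proj.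
by apply: cmp_apps; [apply: (cmp_comp hS)|]; proj.
Qed.

End Kernel.
End ComputeTerms.

(** * Computable recognition of formats *)

Section Kinds.
Variables (Om : signature) (n : nat) (P : program Om n).
Implicit Types (t : term Om 'I_n) (e : equality Om n).

(** Data that identify the format of a two-variable equality: the variable of a side, or the
    constant if it is small; a large constant is a side with neither. In [m ∙ Var x] all variables
    coincide, so the first one is enough. *)
Definition kind t : seq 'I_n * seq (term Om 'I_n) :=
  (take 1 (vars t), [seq s <- [seq of_ground _ g | g <- setS P] | s == t]).

Definition format_kind (F : format Om n) :=
  let c x : seq 'I_n * seq (term Om 'I_n) := ([:: x], [::]) in
  let s g : seq 'I_n * seq (term Om 'I_n) := ([::], [:: of_ground _ g]) in
  match F with
  | FVV x y => (c x, c y)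
  | FLV y => (([::], [::]), c y)
  | FSV g y => (s g, c y)
  | FVL x => (c x, ([::], [::]))
  | FVS x g => (c x, s g)
  end.

Lemma format_kind_inj : injective format_kind.
Proof.
by case=> [x y|x|g x|x|x g] [x' y'|x'|g' x'|x'|x' g'] //= [] *; subst=> //;
  congr FSV + congr FVS; apply: (@of_ground_inj Om 'I_n).
Qed.

Lemma vars_plug (m : template Om) (x : 'I_n) : vars (m ∙ Var x) = [seq x | _ <- vars m].
Proof.
rewrite /plug; elim/term_ind2: m => [//|F ts IH] /=.
rewrite map_flatten -!map_comp; congr flatten; apply/eq_in_map => u /IH //.
Qed.

Lemma vars_of_ground (g : gterm Om) : vars (of_ground 'I_n g) = [::].
Proof. by apply/nilP; rewrite -[nilp _]negbK -hole_vars /hole of_groundK. Qed.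

Lemma kind_plug (m : template Om) (x : 'I_n) : setMG P m -> kind (m ∙ Var x) = ([:: x], [::]).
Proof.
move=> /setMGE [_ hm _]; rewrite /kind vars_plug; congr (_, _).
  by move: hm; rewrite hole_vars; case: (vars m) => //= a l; rewrite take0.
apply/eqP; rewrite -size_eq0 size_filter eqn0Ngt -has_count; apply/hasPn => _ /mapP [g _ ->].
apply/eqP => /(congr1 (@vars Om 'I_n)); rewrite vars_of_ground vars_plug.
by move: hm; rewrite hole_vars; case: (vars m).
Qed.

Lemma kind_setS (g : gterm Om) : g \in setS P -> kind (of_ground _ g) = ([::], [:: of_ground _ g]).
Proof.
move=> ig; rewrite /kind vars_of_ground; congr (_, _).
rewrite (filter_pred1_uniq (s := [seq of_ground 'I_n g | g <- setS P])) //; last exact: map_f.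
by rewrite map_inj_uniq ?undup_uniq //; apply: of_ground_inj.
Qed.

Lemma kind_setL (g : gterm Om) : setL P g -> kind (of_ground _ g) = ([::], [::]).
Proof.
move=> [_ ng]; rewrite /kind vars_of_ground; congr (_, _).
apply/eqP; rewrite -size_eq0 size_filter eqn0Ngt -has_count; apply/hasPn => _ /mapP [h ih ->].
by apply: contra ng => /eqP /(@of_ground_inj Om) <-.
Qed.

Lemma kind_format F e : of_format P F e -> (kind e.1, kind e.2) = format_kind F.
Proof.
case: F => [x y|y|g y|x|x g] /=.
- by move=> [s [t [hs ht ->]]]; rewrite /= !kind_plug.
- by move=> [s [t [hs ht ->]]]; rewrite /= kind_setL // kind_plug.
- by move=> [t [hs ht ->]]; rewrite /= kind_setS // kind_plug.
- by move=> [t [s [ht hs ->]]]; rewrite /= kind_setL // kind_plug.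
by move=> [t [ht hs ->]]; rewrite /= kind_setS // kind_plug.
Qed.

Lemma wf_format F e : of_format P F e -> wf e.1 && wf e.2.
Proof.
have wS g : g \in setS P -> wf (of_ground 'I_n g).
  by rewrite mem_setS wf_ok ok_of_ground -wf_ok => /orP [/wf_setG|/wf_setR].
have wL (g : gterm Om) : setL P g -> wf (of_ground 'I_n g).
  by move=> [/wf_setT wg _]; rewrite wf_ok ok_of_ground -wf_ok.
have wM (m : template Om) (x : 'I_n) : setMG P m -> wf (m ∙ Var x).
  by move=> /setMGE [wm _ _]; rewrite !wf_ok in wm *; apply: ok_plug.
case: F => [x y|y|g y|x|x g] /=.
- by move=> [s [t [hs ht ->]]]; rewrite !wM.
- by move=> [s [t [hs ht ->]]]; rewrite wL // wM.
- by move=> [t [hs ht ->]]; rewrite wS // wM.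
- by move=> [t [s [ht hs ->]]]; rewrite wL // wM.
by move=> [t [ht hs ->]]; rewrite wS // wM.
Qed.

End Kinds.

Section Pairs.
Definition pairs X Y (l : seq X) (r : seq Y) := flatten [seq [seq (x, y) | y <- r] | x <- l].

Lemma mem_pairs (X Y : eqType) (l : seq X) (r : seq Y) x y : ((x, y) \in pairs l r) = (x \in l) && (y \in r).
Proof.
apply/flattenP/andP => [[_ /mapP [a ia ->] /mapP [b ib [-> ->]]]//|[ix iy]].
by exists [seq (x, y) | y <- r]; [apply: (map_f (fun x => [seq (x, y) | y <- r]))|apply: map_f].
Qed.

Lemma cmp_pairs Z (eZ : Z -> data) X (eX : X -> data) Y (eY : Y -> data) (l : Z -> seq X) (r : Z -> seq Y) :
  cmp eZ (eseq eX) l -> cmp eZ (eseq eY) r -> cmp eZ (eseq (epair eX eY)) (fun z => pairs (l z) (r z)).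
Proof.
move=> hl hr; apply: cmp_flatten.
apply: (@cmp_map _ _ _ eX _ _ _ (fun q => [seq (q.2, y) | y <- r q.1])) => //.
apply: (@cmp_map _ _ _ eY _ _ _ (fun q => (q.1.2, q.2))); first by apply: (cmp_comp hr); proj.
by apply: cmp_pair; proj.
Qed.
End Pairs.

(** * Exhaustive search for a violation *)

Section Decision.
Variables (Om : signature) (code : Om -> nat) (n : nat) (P : program Om n).
Hypothesis code_inj : injective code.
Variables (S0 : seq Om) (K : nat).

Notation equ := (equality Om n).
(** [cmp] quantifies over a whole type, and arities are read correctly off well-formed terms only;
    two-variable equalities are well-formed by [wf_format]. *)
Definition wf_equality := {e : equ | wf e.1 && wf e.2}.
Definition instance := (seq wf_equality * seq wf_equality)%type.
Definition candidate := (template Om * template Om * gterm Om * gterm Om)%type.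

Let en (x : 'I_n) := enat x.
Let eT := eterm code en.
Let eM := eterm code (fun _ : unit => DNil).
Let eG := eterm code (fun _ : void => DNil).
Let eS := esym code.
Let eE := epair eT eT.
Let eW (e : wf_equality) := eE (val e).
Let eI := epair (eseq eW) (eseq eW).
Let eC := epair (epair (epair eM eM) eG) eG.

Definition holds (c : candidate) (e : equ) : bool :=
  c.1.1.1 ∙ eval c.1.2 e.1 == c.1.1.2 ∙ eval c.2 e.2.

(** The first premise deals with the formats F_{x,x}, where both sides share one value
    ([same_variable]). *)
Definition test (E : seq equ) (e0 : equ) (c : candidate) : bool :=
  (((kind P e0.1).1 == (kind P e0.2).1) ==> (c.1.2 == c.2)) ==>
  (all (fun e => ((kind P e.1 == kind P e0.1) && (kind P e.2 == kind P e0.2)) ==> holds c e) E ==> holds c e0).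

Definition used_symbols (x : instance) : seq Om :=
  flatten [seq symbols (val w).1 ++ symbols (val w).2 | w <- x.1 ++ x.2].

(** Each element is a legitimate value ([mem_values]), so those above the height bound do no harm;
    [values_mem] says that none below it is missing. *)
Definition values S D : seq (gterm Om) :=
  setS P ++ flatten [seq [seq m ∙ r | r <- setR P] | m <- [seq m <- kernel (setG P) S D | hole m]].

Definition candidates S D : seq candidate :=
  let ts := [seq t <- terms S D | hole t] in let vs := values S D in
  pairs (pairs (pairs ts ts) vs) vs.

(** The number of symbol occurrences in the instance bounds the height of all its terms
    ([height_symbols]) and serves as the [N] of [small_model]. *)
Definition decide (x : instance) : bool :=
  let Q := used_symbols x in
  let cs := candidates (S0 ++ Q) ((size Q + K) ^ 3) in
  all (fun e0 => all (fun c => test (map val x.1) e0 c) cs) (map val x.2).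

Let eG_inj : injective eG. Proof. by apply: eterm_inj => // -[]. Qed.
Let eT_inj : injective eT. Proof. by apply: eterm_inj => // x y /enat_inj /val_inj. Qed.

Lemma cmp_plug X (eX : X -> data) (V : eqType) (eV : V -> data) (m : X -> template Om) (u : X -> term Om V) :
  cmp eX eM m -> cmp eX (eterm code eV) u -> cmp eX (eterm code eV) (fun x => m x ∙ u x).
Proof.
move=> hm hu; apply: (@cmp_subst _ _ _ _ unit V _ eV m (fun p => u p.1) hm).
by apply: (cmp_comp hu); proj.
Qed.

Section Computability.
Variables (X : Type) (eX : X -> data).

Lemma cmp_eval (u : X -> gterm Om) (t : X -> term Om 'I_n) :
  cmp eX eG u -> cmp eX eT t -> cmp eX eG (fun x => eval (u x) (t x)).
Proof.
move=> hu ht; apply: (@cmp_subst _ _ _ _ 'I_n void _ _ t (fun p => u p.1) ht).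
by apply: (cmp_comp hu); proj.
Qed.

Lemma cmp_holds (c : X -> candidate) (e : X -> equ) :
  cmp eX eC c -> cmp eX eE e -> cmp eX dbool (fun x => holds (c x) (e x)).
Proof.
move=> hc he; have h1 := cmp_fst hc; have h2 := cmp_fst h1.
apply: (cmp_eq eG_inj); apply: cmp_plug.
- exact: cmp_fst h2.
- by apply: cmp_eval; [exact: cmp_snd h1|exact: cmp_fst he].
- exact: cmp_snd h2.
by apply: cmp_eval; [exact: cmp_snd hc|exact: cmp_snd he].
Qed.

Lemma cmp_kind (t : X -> term Om 'I_n) : cmp eX eT t ->
  cmp eX (epair (eseq en) (eseq eT)) (fun x => kind P (t x)).
Proof.
move=> ht; apply: cmp_pair; first exact: cmp_take1 (cmp_vars ht).
apply: (@cmp_filter _ _ _ eT _ (fun q => q.2 == t q.1)); first exact: cmp_const.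
by apply: (cmp_eq eT_inj); [proj|apply: (cmp_comp ht); proj].
Qed.

Lemma cmp_values (S : X -> seq Om) (D : X -> nat) : cmp eX (eseq eS) S -> cmp eX enat D ->
  cmp eX (eseq eG) (fun x => values (S x) (D x)).
Proof.
move=> hS hD; apply: cmp_cat; first exact: cmp_const.
apply: cmp_flatten; apply: (@cmp_map _ _ _ eM _ _ _ (fun q => [seq q.2 ∙ r | r <- setR P])).
  apply: (@cmp_filter _ _ _ eM _ (fun q => hole q.2)); first exact: cmp_kernel.
  by apply: (cmp_hole (code := code) (eV := fun=> DNil)); proj.
apply: (@cmp_map _ _ _ eG _ _ _ (fun q => q.1.2 ∙ q.2)); first exact: cmp_const.
by apply: cmp_plug; proj.
Qed.

Lemma cmp_candidates (S : X -> seq Om) (D : X -> nat) : cmp eX (eseq eS) S -> cmp eX enat D ->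
  cmp eX (eseq eC) (fun x => candidates (S x) (D x)).
Proof.
move=> hS hD; have hv := cmp_values hS hD; apply: cmp_pairs => //; apply: cmp_pairs => //.
have ht : cmp eX (eseq eM) (fun x => [seq t <- terms (S x) (D x) | hole t]).
  apply: (@cmp_filter _ _ _ eM _ (fun q => hole q.2)); first exact: cmp_terms.
  by apply: (cmp_hole (code := code) (eV := fun=> DNil)); proj.
exact: cmp_pairs.
Qed.

End Computability.

Lemma cmp_test X (eX : X -> data) (E : X -> seq equ) (e0 : X -> equ) (c : X -> candidate) :
  cmp eX (eseq eE) E -> cmp eX eE e0 -> cmp eX eC c -> cmp eX dbool (fun x => test (E x) (e0 x) (c x)).
Proof.
move=> hE h0 hc; have k1 := cmp_kind (cmp_fst h0); have k2 := cmp_kind (cmp_snd h0).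
have iN : injective (eseq en) by apply: eseq_inj => x y /enat_inj /val_inj.
have iK : injective (epair (eseq en) (eseq eT)) by apply: epair_inj => //; apply: eseq_inj.
apply: cmp_implb.
  apply: cmp_implb; first by apply: (cmp_eq iN); [exact: cmp_fst k1|exact: cmp_fst k2].
  by apply: (cmp_eq eG_inj); [exact: cmp_snd (cmp_fst hc)|exact: cmp_snd hc].
apply: cmp_implb; last exact: cmp_holds.
apply: (@cmp_all _ _ _ eE _ (fun q => ((kind P q.2.1 == kind P (e0 q.1).1) &&
   (kind P q.2.2 == kind P (e0 q.1).2)) ==> holds (c q.1) q.2)) => //.
have v1 : cmp (epair eX eE) eX fst by proj.
have v2 : cmp (epair eX eE) eE snd by proj.
apply: cmp_implb; last by apply: cmp_holds => //; apply: (cmp_comp hc).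
apply: cmp_andb; apply: (cmp_eq iK).
- exact: cmp_kind (cmp_fst v2).
- exact: (cmp_comp k1 v1).
- exact: cmp_kind (cmp_snd v2).
exact: (cmp_comp k2 v1).
Qed.

Lemma cmp_decide : cmp eI dbool decide.
Proof.
have v1 : cmp eI (eseq eW) fst by proj.
have v2 : cmp eI (eseq eW) snd by proj.
have vE X (eX : X -> data) (l : X -> seq wf_equality) : cmp eX (eseq eW) l -> cmp eX (eseq eE) (fun x => map val (l x)).
  by move=> [c hc]; exists c => x; rewrite hc; elim: (l x) => //= w s ->.
have hQ : cmp eI (eseq eS) used_symbols.
  apply: cmp_flatten; apply: (@cmp_map _ _ _ eW _ _ _ (fun q => symbols (val q.2).1 ++ symbols (val q.2).2)).
    exact: cmp_cat.
  have hw : cmp (epair eI eW) eE (fun q => val q.2) by exists (CTail CId).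
  apply: cmp_cat; apply: (cmp_symbols (eV := en)).
  - by move=> q; case/andP: (valP q.2).
  - exact: cmp_fst hw.
  - by move=> q; case/andP: (valP q.2).
  exact: cmp_snd hw.
have hcs : cmp eI (eseq eC) (fun x => candidates (S0 ++ used_symbols x) ((size (used_symbols x) + K) ^ 3)).
  apply: cmp_candidates; first by apply: cmp_cat => //; exact: cmp_const.
  by apply: cmp_cube; apply: cmp_addn; [exact: cmp_size hQ|exact: cmp_const].
apply: (@cmp_all _ _ _ eE _ (fun q => all (fun c => test (map val q.1.1) q.2 c)
   (candidates (S0 ++ used_symbols q.1) ((size (used_symbols q.1) + K) ^ 3)))).
  exact: vE.
apply: (@cmp_all _ _ _ eC _ (fun q => test (map val q.1.1.1) q.1.2 q.2)).
  by apply: (cmp_comp hcs); proj.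
by apply: cmp_test; [apply: vE; proj|proj|proj].
Qed.

Lemma wf_sub (E : seq equ) : (forall e, e \in E -> wf e.1 && wf e.2) ->
  exists2 x : seq wf_equality, map val x = E & eseq eW x = eseq (@enc_equality Om code n) E.
Proof.
elim: E => [|e E IH] h; first by exists [::].
have [|x <- ex] := IH; first by move=> e' ie; apply: h; rewrite inE ie orbT.
have we : wf e.1 && wf e.2 by apply: h; rewrite inE eqxx.
by exists (exist _ e we :: x) => //=; rewrite ex.
Qed.

Variable x0 : gterm Om.
Hypothesis Lx0 : setL P x0.
Hypothesis small : forall (S : seq Om) N (F : format Om n) (E : set equ) e0 A B u v,
    {subset S0 <= S} -> (forall e, E e \/ e = e0 -> of_format P F e /\ bounded [in S] N e) ->
    violation E e0 A B u v -> value P u -> value P v -> (forall x : 'I_n, F = FVV Om x x -> u = v) ->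
    exists A' B' u' v', [/\ violation E e0 A' B' u' v', value P u', value P v' &
        forall x : 'I_n, F = FVV Om x x -> u' = v'] /\
      let D := (N + K) ^ 3 in
      [/\ ok [in S] A' && (height A' <= D), ok [in S] B' && (height B' <= D),
          ok [in S] u' && (height u' <= D) & ok [in S] v' && (height v' <= D)].

Lemma mem_values (S : seq Om) D u : {subset S0 <= S} -> u \in values S D -> value P u.
Proof.
move=> sub; rewrite mem_cat => /orP [iu|/flattenP [_ /mapP [m + ->] /mapP [r ir ->]]]; first by right.
rewrite mem_filter => /andP [hm im]; left; exists m, r; split=> //.
have gm := kernel_gk (@setG_sub Om n P) im.
have wm := kernel_ok (@wf_setG Om n P) im.
by apply/setMGE.
Qed.

Lemma values_mem S D u : value P u -> ok [in S] u -> height u <= D -> u \in values S D.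
Proof.
move=> [[m [r [/setMGE [wm hm gm] ir eu]]] ou lu|iu _ _]; rewrite mem_cat; last by rewrite iu.
apply/orP; right; apply/flattenP; exists [seq m ∙ r | r <- setR P]; last by rewrite eu; apply: map_f.
apply: (map_f (fun m => [seq m ∙ r | r <- setR P])); rewrite mem_filter hm /= (mem_kernel (@setG_sub Om n P)) //.
  by apply: (@ok_plugl _ _ _ _ r); rewrite -eu.
by apply: leq_trans lu; rewrite eu; apply: height_plugl.
Qed.

Lemma height_symbols (t : term Om 'I_n) : height t <= size (symbols t).
Proof.
elim/term_ind2: t => [//|F ts IH].
rewrite [symbols _]/= [size _]/= height_leP; apply/allP => u iu; apply: leq_trans (IH u iu) _.
rewrite size_flatten /shape -map_comp; elim: ts iu {IH} => [//|a ts IHt] /=.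
by rewrite inE => /predU1P [->|/IHt le]; [apply: leq_addr|apply: leq_trans le (leq_addl _ _)].
Qed.

Lemma used_bounded (x : instance) e : e \in map val x.1 ++ map val x.2 ->
  bounded [in S0 ++ used_symbols x] (size (used_symbols x)) e.
Proof.
rewrite -map_cat => /mapP [w iw ->]; have /andP [w1 w2] := valP w.
have sub : {subset symbols (val w).1 ++ symbols (val w).2 <= used_symbols x}.
  by move=> F iF; apply/flattenP; exists (symbols (val w).1 ++ symbols (val w).2) => //; apply: map_f.
have le : size (symbols (val w).1) + size (symbols (val w).2) <= size (used_symbols x).
  rewrite -size_cat /used_symbols; elim: (x.1 ++ x.2) iw => [//|a l IH] /=.
  rewrite inE [X in _ <= X]size_cat => /predU1P [->|/IH h]; first exact: leq_addr.
  exact: leq_trans h (leq_addl _ _).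
split.
- by apply: ok_symbols => // F iF; rewrite mem_cat sub ?orbT // mem_cat iF.
- by apply: ok_symbols => // F iF; rewrite mem_cat sub ?orbT // mem_cat iF orbT.
- exact: leq_trans (height_symbols _) (leq_trans (leq_addr _ _) le).
exact: leq_trans (height_symbols _) (leq_trans (leq_addl _ _) le).
Qed.

Lemma same_format F e0 e : two_variable P e -> of_format P F e0 ->
  (kind P e.1 == kind P e0.1) && (kind P e.2 == kind P e0.2) <-> of_format P F e.
Proof.
move=> [F' Fe] F0; have k := kind_format Fe; have k0 := kind_format F0; split.
  by move=> /andP [/eqP e1 /eqP e2]; rewrite e1 e2 k0 in k; rewrite (format_kind_inj k).
by move=> /kind_format; rewrite -k0 => /eqP; rewrite xpair_eqE.
Qed.

Lemma same_variable F e0 : of_format P F e0 ->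
  ((kind P e0.1).1 == (kind P e0.2).1) <-> exists x : 'I_n, F = FVV Om x x.
Proof.
move=> /kind_format; rewrite [kind P e0.1]surjective_pairing [kind P e0.2]surjective_pairing.
case: F => [x y|y|g y|x|x g] /= [-> _ -> _]; split=> //; try by case.
  by move=> /eqP [->]; exists y.
by move=> [z [-> ->]].
Qed.

Lemma testP E F e0 c : [set` E] `<=` two_variable P -> of_format P F e0 ->
  test E e0 c <->
  ((forall x : 'I_n, F = FVV Om x x -> c.1.2 = c.2) ->
   (forall e, e \in E -> of_format P F e -> holds c e) -> holds c e0).
Proof.
move=> tv F0; rewrite /test; split=> [/implyP h hs hE|h].
  have /implyP : all (fun e => ((kind P e.1 == kind P e0.1) && (kind P e.2 == kind P e0.2)) ==> holds c e) E ==> holds c e0.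
    by apply: h; apply/implyP => /(same_variable F0) [x /hs ->].
  apply; apply/allP => e ie; apply/implyP => k; apply: hE => //.
  by apply/(same_format (tv _ ie) F0).
apply/implyP => /implyP hs; apply/implyP => /allP hE; apply: h => [x eF|e ie Fe].
  by apply/eqP; apply: hs; apply/(same_variable F0); exists x.
by apply: (implyP (hE e ie)); apply/(same_format (tv _ ie) F0).
Qed.

(** Every candidate that fails a test is a violation, and by [small] any violation entails one among
    the candidates. *)
Lemma decideP (x : instance) : [set` map val x.1] `<=` two_variable P -> [set` map val x.2] `<=` two_variable P ->
  decide x <-> approx_subsumes P [set` map val x.1] [set` map val x.2].
Proof.
move=> tv tv'; rewrite (approx_violation _ _ Lx0); split=> [/allP h F e0 A B u v E0 F0 Vu Vv hs vi|nv].
  have sub : {subset S0 <= S0 ++ used_symbols x} by move=> G iG; rewrite mem_cat iG.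
  have [|A' [B' [u' [v' [[[[hA hB wA wB] [s' v2]] Vu' Vv' hs'] [oA oB ou ov]]]]]] :=
      small sub _ vi Vu Vv hs (N := size (used_symbols x)).
    move=> e [[ie Fe]|->]; split=> //; apply: used_bounded; rewrite mem_cat; apply/orP; [by left|by right].
  have /allP/(_ (A', B', u', v')) := h e0 E0.
  have -> : (A', B', u', v') \in candidates (S0 ++ used_symbols x) ((size (used_symbols x) + K) ^ 3).
    rewrite !mem_pairs !mem_filter !mem_terms hA hB oA oB /=.
    by case/andP: ou => ou lu; case/andP: ov => ov lv; rewrite !values_mem.
  move=> /(_ isT) /(testP _ tv F0) /= t.
  by apply: v2; apply/eqP; apply: t => // e ie Fe; apply/eqP; apply: s'.
apply/allP => e0 E0; have [F F0] := tv' _ E0.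
apply/allP => -[[[A B] u] v]; rewrite !mem_pairs !mem_filter !mem_terms.
move=> /andP [/andP [/andP [/andP [hA /andP [oA _]] /andP [hB /andP [oB _]]] iu] iv].
have sub : {subset S0 <= S0 ++ used_symbols x} by move=> G iG; rewrite mem_cat iG.
apply/(testP _ tv F0) => /= hs hE; apply: contraT => ne.
case: (nv F e0 A B u v E0 F0 (mem_values sub iu) (mem_values sub iv) hs); split.
  by split=> //; [exact: ok_wf oA|exact: ok_wf oB].
by split=> [e [ie Fe]|]; [apply/eqP; apply: hE|apply/eqP].
Qed.

End Decision.

Lemma approx_decidable (Om : signature) (code : Om -> nat) (n : nat) (P : program Om n) :
  injective code ->
  decidable_problem (@enc_instance Om code n)
    [set EE : seq (equality Om n) * seq (equality Om n) |
       [set` EE.1] `<=` two_variable P /\ [set` EE.2] `<=` two_variable P]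
    [set EE : seq (equality Om n) * seq (equality Om n) |
       approx_subsumes P [set` EE.1] [set` EE.2]].
Proof.
move=> ic; case: (pselect (exists x0, setL P x0)) => [[x0 Lx0]|nL]; last first.
  (* Without large terms there is no assignment into L, as every format mentions a variable; so
     subsumption always holds, and the constant procedure is correct. *)
  exists (compile 0 (cconst dtrue)) => EE _; split=> [_|nap]; first by rewrite -(cconstE dtrue (enc_instance code EE)); apply: computes_compile.
  case: nap => s F _ a [_ _ hX].
  have x : 'I_n by case: F.
  by case: nL; exists (valX a x).
have [S0 [K sm]] := small_model Lx0; have [c hc] := cmp_decide P ic S0 K.
exists (compile 0 c) => -[E E'] /= [tv tv'].
have wfE (l : seq (equality Om n)) : [set` l] `<=` two_variable P -> forall e, e \in l -> wf e.1 && wf e.2.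
  by move=> h e /h [F]; apply: wf_format.
have [x1 m1 e1] := wf_sub code (wfE _ tv); have [x2 m2 e2] := wf_sub code (wfE _ tv').
have ex : enc_instance code (E, E') = DCons (eseq (@enc_equality Om code n) E) (eseq (@enc_equality Om code n) E') by [].
have res : computes (compile 0 c) (enc_instance code (E, E')) (dbool (decide P S0 K (x1, x2))).
  by rewrite -hc ex -e1 -e2; apply: computes_compile.
have dec := @decideP _ _ P S0 K _ Lx0 sm (x1, x2); rewrite /= m1 m2 in dec.
have {}dec := dec tv tv'.
split=> [ap|nap]; move: res; first by move/dec: ap => ->.
by case d: (decide _ _ _ _) => //; case: nap; apply/dec.
Qed.

Theorem theorem7 :
  (forall (Om : signature) (code : Om -> nat) (n : nat) (P : program Om n),
     injective code ->
     decidable_problem (@enc_instance Om code n)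
       [set EE : seq (equality Om n) * seq (equality Om n) |
          [set` EE.1] `<=` two_variable P /\ [set` EE.2] `<=` two_variable P]
       [set EE : seq (equality Om n) * seq (equality Om n) |
          approx_subsumes P [set` EE.1] [set` EE.2]])
  /\
  (exists c : nat,
     forall (Om : signature) (n : nat) (P : program Om n)
            (E : set (equality Om n)),
       E `<=` two_variable P ->
       satisfiable (setT_ P) E ->
       exists E0 : seq (equality Om n),
         [/\ [set` E0] `<=` E,
             size E0 <= c * (n ^ 2 * size (setS P) ^ 2) &
             approx_subsumes P [set` E0] E]).
Proof. by split; [exact: approx_decidable|exists 200; exact: approx_compactness]. Qed.
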